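(* Assume $d/p\le k$. (a) The map $(U_p^k)^0\to(\widetilde U_p^k)^0$, $b\mapsto\mu_b$, extends to an isometric embedding of $U_p^k$ into $\widetilde U_p^k$, denoted by $\mathcal I$. (b) There exists a linear continuous surjection of $\widetilde U_p^k$ onto $U_p^k$, denoted by $\mathcal E$, such that $$\ker(\mathcal E)\cap(\widetilde U_p^k)^0=(0)\quad\text{and}\quad\mathcal E\circ\mathcal I=\mathrm{id}.$$
   Context: Fix $d,k\in\mathbb N$, $1\le p<\infty$, $\frac1p+\frac1{p'}=1$, and let $Q^d:=[0,1]^d$. A cube is a closed cube in $\mathbb R^d$ homothetic to $Q^d$. A packing is a family of cubes with pairwise disjoint interiors; $\Pi$ is the set of finite packings consisting of cubes contained in $Q^d$. A $(k,p)$-atom is a function $a\in\ell_1(Q^d)$ (i.e. $\sum_{x\in Q^d}|a(x)|<\infty$) that is supported by some cube $Q\subset Q^d$, satisfies $\|a\|_1\le1$ and $\sum_{x\in Q^d}x^\alpha a(x)=0$ for all $|\alpha|\le k-1$; it is denoted $a_Q$. A $(k,p)$-chain subordinate to a packing $\pi\in\Pi$ is a function $b_\pi=\sum_{Q\in\pi}c_Qa_Q$, with $c_Q\in\mathbb R$ and $a_Q$ a $(k,p)$-atom supported by $Q$; $[b_\pi]_{p'}:=\big(\sum_{Q\in\pi}|c_Q|^{p'}\big)^{1/p'}$ (the maximum if $p'=\infty$). $(U_p^k)^0$ is the linear hull of all $(k,p)$-atoms, with norm $\|f\|_{U_p^k}:=\inf\sum_\pi[b_\pi]_{p'}$, the infimum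 over all presentations of $f$ as a finite sum $f=\sum_\pi b_\pi$ of $(k,p)$-chains. $U_p^k$ is the completion of $((U_p^k)^0,\|\cdot\|_{U_p^k})$. Let $M$ be the Banach space of finite signed Borel measures on $Q^d$ with the total variation norm $\|\mu\|_M$. The space $\widetilde U_p^k$ is defined by the same construction, with atoms replaced by measures $\mu_Q\in M$ such that $\operatorname{supp}\mu_Q\subset Q$ for a cube $Q\subset Q^d$, $\|\mu_Q\|_M\le1$, and $\int_{Q^d}x^\alpha\,d\mu_Q=0$ for $|\alpha|\le k-1$: $(\widetilde U_p^k)^0\subset M$ is the linear hull of these atoms, its seminorm $\|\cdot\|_{\widetilde U_p^k}$ is the infimum of $\sum_\pi(\sum_{Q\in\pi}|c_Q|^{p'})^{1/p'}$ over presentations as finite sums of chains $\sum_{Q\in\pi}c_Q\mu_Q$, $\pi\in\Pi$, and $\widetilde U_p^k$ is its completion (a Banach space). For $b\in(U_p^k)^0$, $\mu_b\in M$ is the discrete measure with $\mu_b(\{x\}):=b(x)$, $x\in Q^d$, i.e. $\mu_b=\sum_{x}b(x)\delta_x$. *)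

(* Defs.v *)
From HB Require Import structures.
From mathcomp Require Import all_boot all_order all_algebra.
From mathcomp Require Import all_classical all_reals all_analysis.

Set Implicit Arguments.
Unset Strict Implicit.
Unset Printing Implicit Defensive.

Import Order.TTheory GRing.Theory Num.Theory.
Import numFieldNormedType.Exports.

Local Open Scope classical_set_scope.
Local Open Scope ring_scope.

Section cubes.
Context {R : realType} {d : nat}.
Implicit Types Q : set 'rV[R]_d.

Definition unit_cube : set 'rV[R]_d := [set x | forall i, 0 <= x ord0 i <= 1].

(* Homothety of negative ratio gives nothing more: Q^d is symmetric about its
   centre. *)
Definition cube Q :=
  exists x r, 0 < r /\ Q = [set x + r *: y | y in unit_cube].

Definition cube_in Q := cube Q /\ Q `<=` unit_cube.

(* Cubes have nonempty interior, so an indexed family with pairwise disjoint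
   interiors is the same thing as an enumerated set of cubes. *)
Definition packing n (Q : 'I_n -> set 'rV[R]_d) :=
  (forall i, cube_in (Q i)) /\ trivIset setT (fun i => (Q i)°).

End cubes.
Arguments unit_cube : clear implicits.

Section points_of_unit_cube.
Context (R : realType) (d : nat).

Definition Qd : Type := set_type (unit_cube R d).

HB.instance Definition _ := Topological.on Qd.

Let unit_cube0 : unit_cube R d 0.
Proof. by move=> i; rewrite mxE lexx ler01. Qed.

HB.instance Definition _ := isPointed.Build Qd (SigSub (mem_set unit_cube0)).

Definition borelQd := g_sigma_algebraType (@open Qd).

HB.instance Definition _ := Measurable.on borelQd.

End points_of_unit_cube.

Definition monomial (R : realType) d (alpha : 'I_d -> nat) (x : Qd R d) : R :=
  \prod_(i < d) (\val x ord0 i) ^+ alpha i.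

(* Unordered sum of a summable family. *)
Definition rsum (R : realType) (T : choiceType) (D : set T) (f : T -> R) : R :=
  fine (esum D (EFin \o f)^\+ - esum D (EFin \o f)^\-)%E.

(* Finite signed measures as real-valued set functions; the value 0 is imposed
   on nonmeasurable sets so that equality of two of them means agreement on
   measurable sets. *)
Section signed_measures.
Context {disp} (T : measurableType disp) (R : realType).

Definition is_signed_measure (m : set T -> R) :=
  [/\ m set0 = 0, semi_sigma_additive (EFin \o m)
    & forall A, ~ measurable A -> m A = 0].

Definition signed_measure_pred : {pred set T -> R} :=
  [pred m | `[< is_signed_measure m >]].

Record signed_measure := SignedMeasure {
  signed_measure_val :> set T -> R ;
  _ : signed_measure_val \in signed_measure_pred }.

HB.instance Definition _ := [isSub for signed_measure_val].
HB.instance Definition _ := [Choice of signed_measure by <:].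

Lemma is_signed_measureP (m : set T -> R) :
  is_signed_measure m <->
  (exists nu : {charge set T -> \bar R},
     forall A, measurable A -> (m A)%:E = nu A) /\
  (forall A, ~ measurable A -> m A = 0).
Proof.
split=> [[m0 ms mN]|[[nu mnu] mN]]; split => //.
- have mfin A : measurable A -> (EFin \o m) A \is a fin_num by [].
  have mm0 : (EFin \o m) set0 = 0%E by rewrite /= m0.
  pose H := isCharge.Build _ _ _ (EFin \o m) mm0 mfin ms.
  pose nu : {charge set T -> \bar R} := HB.pack (EFin \o m) H.
  by exists nu.
- by apply: EFin_inj; rewrite mnu// charge0.
- move=> F mF tF mU; rewrite /= mnu//.
  rewrite [X in X @ _ --> _](_ : _ = fun n => (\sum_(0 <= i < n) nu (F i))%E).
    exact: charge_semi_sigma_additive.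
  by apply/funext => n; apply: eq_bigr => i _; rewrite /= mnu.
Qed.

Lemma signed_measure_predP (m : set T -> R) :
  reflect (is_signed_measure m) (m \in signed_measure_pred).
Proof. exact: asboolP. Qed.

Lemma signed_measure_submod_closed : submod_closed signed_measure_pred.
Proof.
split => [|a m1 m2].
  apply/signed_measure_predP; apply/is_signed_measureP; split => //.
  by exists czero.
move=> /signed_measure_predP /is_signed_measureP[[nu1 e1] n1].
move=> /signed_measure_predP /is_signed_measureP[[nu2 e2] n2].
apply/signed_measure_predP; apply/is_signed_measureP; split => [|A mA]; last first.
  have -> : (a *: m1 + m2) A = a * m1 A + m2 A by [].
  by rewrite n1// n2// mulr0 addr0.
exists (cadd (cscale a nu1) nu2) => A mA.
by transitivity (a%:E * nu1 A + nu2 A)%E => //; rewrite -e1// -e2.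
Qed.

HB.instance Definition _ := GRing.isSubmodClosed.Build R _ signed_measure_pred
  signed_measure_submod_closed.
HB.instance Definition _ := [SubChoice_isSubLmodule of signed_measure by <:].

Section charge_of.
Variable m : signed_measure.

Definition charge_of : set T -> \bar R := EFin \o m.

Let mP : is_signed_measure m.
Proof. by case: m => f /= /signed_measure_predP. Qed.

Let charge_of0 : charge_of set0 = 0%E.
Proof. by have [m0 _ _] := mP; rewrite /charge_of /= m0. Qed.

Let charge_of_fin A : measurable A -> charge_of A \is a fin_num.
Proof. by []. Qed.

Let charge_of_sigma_additive : semi_sigma_additive charge_of.
Proof. by have [_] := mP. Qed.

HB.instance Definition _ := isCharge.Build _ _ _ charge_of
  charge_of0 charge_of_fin charge_of_sigma_additive.

(* An arbitrary Hahn decomposition; the Jordan decomposition below does not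
   depend on it on measurable sets. *)
Definition hahn_pos : set T := sval (cid (Hahn_decomposition charge_of)).

Definition hahn_neg : set T :=
  sval (cid (svalP (cid (Hahn_decomposition charge_of)))).

Definition hahnP : hahn_decomposition charge_of hahn_pos hahn_neg :=
  svalP (cid (svalP (cid (Hahn_decomposition charge_of)))).

Definition variation_measure : set T -> \bar R := charge_variation hahnP.

Definition tv_norm : R := fine (variation_measure setT).

Definition signed_integral (f : T -> R) : R :=
  \int[jordan_pos hahnP]_x f x - \int[jordan_neg hahnP]_x f x.

End charge_of.

End signed_measures.

Section spaces.
Context (R : realType) (d k : nat).

Local Notation M := (signed_measure (borelQd R d) R).

Definition msupport (mu : M) : set (Qd R d) :=
  [set x | forall U : set (Qd R d), open U -> U x ->
    variation_measure mu U != 0%E].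

Definition fatom (Q : set 'rV[R]_d) (a : Qd R d -> R) :=
  [/\ cube_in Q,
      summable setT (EFin \o a),
      (forall x, a x != 0 -> Q (\val x)),
      rsum setT (fun x => `|a x|) <= 1
    & forall alpha : 'I_d -> nat, (\sum_i alpha i < k)%N ->
        rsum setT (fun x => monomial alpha x * a x) = 0].

Definition matom (Q : set 'rV[R]_d) (mu : M) :=
  [/\ cube_in Q,
      (forall x, msupport mu x -> Q (\val x)),
      tv_norm mu <= 1
    & forall alpha : 'I_d -> nat, (\sum_i alpha i < k)%N ->
        signed_integral mu (monomial alpha) = 0].

End spaces.

Definition lqnorm (R : realType) (q : \bar R) n (c : 'I_n -> R) : R :=
  if q is r%:E then (\sum_(i < n) `|c i| `^ r) `^ r^-1
  else \big[Order.max/0]_(i < n) `|c i|.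

(* The construction common to U_p^k and its measure analogue; [atom Q a] reads
   "a is an atom supported by the cube Q". *)
Section atomic_space.
Context (R : realType) (d : nat) (V : lmodType R).
Variables (atom : set 'rV[R]_d -> set V) (p : R).

Definition atom_hull : set V :=
  [set f | exists n (c : 'I_n -> R) (a : 'I_n -> V),
     (forall i, exists Q, atom Q (a i)) /\ f = \sum_(i < n) c i *: a i].

Record chain := Chain {
  chain_size : nat ;
  chain_cube : 'I_chain_size -> set 'rV[R]_d ;
  chain_coef : 'I_chain_size -> R ;
  chain_atom : 'I_chain_size -> V ;
  chain_packing : packing chain_cube ;
  chain_atomP : forall i, atom (chain_cube i) (chain_atom i) }.

Arguments chain_cube : clear implicits.
Arguments chain_coef : clear implicits.
Arguments chain_atom : clear implicits.

Definition chain_val (b : chain) : V :=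
  \sum_(i < chain_size b) chain_coef b i *: chain_atom b i.

Definition chain_norm (b : chain) : R :=
  lqnorm (hoelder_conjugate p%:E) (chain_coef b).

Definition atomic_norm (f : V) : R :=
  inf [set s | exists n (b : 'I_n -> chain),
    f = \sum_(j < n) chain_val (b j) /\ s = \sum_(j < n) chain_norm (b j)].

End atomic_space.

Section spaces_U.
Context (R : realType) (d k : nat) (p : R).

Definition U0 : set (Qd R d -> R) := atom_hull (fatom k).

Definition Unorm : (Qd R d -> R) -> R := atomic_norm (fatom k) p.

Definition Ut0 : set (signed_measure (borelQd R d) R) := atom_hull (matom k).

Definition Utnorm : signed_measure (borelQd R d) R -> R :=
  atomic_norm (matom k) p.

End spaces_U.
Arguments U0 : clear implicits.
Arguments Unorm {R} d k p.
Arguments Ut0 : clear implicits.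
Arguments Utnorm {R} d k p.

(* (W, i) is a completion of the subspace S of V seminormed by nrm; it is
   unique up to isometric isomorphism. The values of i off S are irrelevant. *)
Definition is_completion (R : realType) (V : lmodType R) (S : set V)
    (nrm : V -> R) (W : completeNormedModType R) (i : V -> W) :=
  [/\ (forall a v w, S v -> S w -> i (a *: v + w) = a *: i v + i w),
      (forall v, S v -> `|i v| = nrm v)
    & dense (i @` S)].

Section discrete_measure.
Context (R : realType) (d : nat).
Local Notation B := (borelQd R d).

Definition discrete_fun (b : Qd R d -> R) (A : set B) : R :=
  if `[< measurable A >] then rsum (A : set (Qd R d)) b else 0.

(* The default 0 is taken only for non-summable b: see [discrete_measureE]. *)
Definition discrete_measure (b : Qd R d -> R) : signed_measure B R :=
  insubd 0 (discrete_fun b).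

Lemma esum_is_charge (f : Qd R d -> \bar R) : (forall x, 0 <= f x)%E ->
  summable setT f ->
  exists nu : {charge set B -> \bar R},
    forall A, measurable A -> nu A = esum (A : set (Qd R d)) f.
Proof.
move=> f0 sf; pose m (A : set B) := esum (A : set (Qd R d)) f.
have m0 : m set0 = 0%E by rewrite /m esum_set0.
have mfin A : measurable A -> m A \is a fin_num.
  move=> _; rewrite ge0_fin_numE; last by apply: esum_ge0.
  apply: le_lt_trans sf; rewrite /m esum_mkcond; apply: le_esum => x _.
  by case: ifP => // _; rewrite gee0_abs.
have ms : semi_sigma_additive m.
  move=> F mF tF mU; rewrite /m esum_bigcupT// -nneseries_esumT; last first.
    by move=> n; apply: esum_ge0.
  by apply: is_cvg_nneseries => n _ _; apply: esum_ge0.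
pose H := isCharge.Build _ _ _ m m0 mfin ms.
pose nu : {charge set B -> \bar R} := HB.pack m H.
by exists nu.
Qed.

Lemma discrete_measureE (b : Qd R d -> R) (A : set B) :
  summable setT (EFin \o b) -> measurable A ->
  discrete_measure b A = rsum (A : set (Qd R d)) b.
Proof.
move=> sb mA.
suff bS : discrete_fun b \in @signed_measure_pred _ B R.
  by rewrite /discrete_measure insubdK// /discrete_fun asboolT.
apply/signed_measure_predP; apply/is_signed_measureP; split; last first.
  by move=> C nC; rewrite /discrete_fun asboolF.
have [nu1 e1] := esum_is_charge (@funepos_ge0 _ _ _) (summable_funepos sb).
have [nu2 e2] := esum_is_charge (@funeneg_ge0 _ _ _) (summable_funeneg sb).
exists (cadd nu1 (cscale (-1) nu2)) => C mC.
rewrite /discrete_fun asboolT// /rsum -e1// -e2//.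
transitivity (nu1 C + (-1)%:E * nu2 C)%E => //; rewrite mulN1e fineK//.
by rewrite fin_numB; apply/andP; split; exact: fin_num_measure.
Qed.

End discrete_measure.

(* Main.v *)
(* The discrete measures turn out to be isometrically embedded and dense in the
   hull of the measure atoms, so that I extends to an isometric isomorphism of
   the completions and E is its inverse.

   Isometry: given a presentation of mu_b by measure atoms, push all of them
   forward by one measurable map with countable range that fixes the points
   charged by b and barely changes the Lagrange polynomials of the finitely
   many cubes involved.  The new measures are discrete and still present mu_b;
   their moments are off by a little, which measures at the Lagrange nodes
   repair at a total cost O(eta).

   Density: remove from mu the countable set of its point masses, cut the
   diffuse rest along a grid and replace every piece by the measure on the
   Lagrange nodes with the same moments.  The error is a single chain whose
   coefficients are a constant times the masses of the pieces; their sum is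
   bounded and their maximum is small, hence so is their l^p' norm.

   Injectivity on finite combinations: on a cube of side r, a monomial is a
   polynomial of degree < k up to C r^k.  As k p >= d and the volumes of the
   cubes of a packing have a bounded sum, Hoelder's inequality bounds each
   moment of mu by a constant times the norm of mu; so a mu of norm 0 has all
   moments zero, and vanishes by polynomial approximation of indicators. *)

Require Import Defs.
From HB Require Import structures.
From mathcomp Require Import finmap.
From mathcomp Require Import all_boot all_order all_algebra.
From mathcomp Require Import all_classical all_reals all_analysis.
From mathcomp Require Import ring lra zify measurable_realfun.

Set Implicit Arguments.
Unset Strict Implicit.
Unset Printing Implicit Defensive.

Import Order.TTheory GRing.Theory Num.Theory.
Import numFieldNormedType.Exports.

Local Open Scope classical_set_scope.
Local Open Scope ring_scope.

(** * Signed measures *)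

Section signed_measure_theory.
Context {disp} (T : measurableType disp) (R : realType).
Local Notation M := (signed_measure T R).
Implicit Types (mu nu : M) (A B C : set T) (f g : T -> R).

(** Approximating the atoms in norm would not give the isometry: a presentation of [mu_b] may
    consist of diffuse measures that cancel, and the discrete atoms replacing them must again sum to
    [mu_b]. Hence one map for all of them; the error that it makes is a defect of finitely many
    moments per atom, which is repairable at small cost. In total variation a nonzero diffuse
    measure is far from every discrete one, so density has to come from the chain norm. As [p] is
    finite, [p' > 1], and many small coefficients with a bounded sum have a small l^p' norm. A point
    mass is equally heavy in every cube around it, so subdivision does not help there; this is why
    the point masses are split off. As E is an isometry, it kills an element of the hull only if the
    seminorm does: the claim on the kernel says that the seminorm is a norm. Moments are suited to
    detect this, because an atom sees a smooth function only through a Taylor remainder of order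
    [k]. *)

Lemma signed_measureD mu nu A : (mu + nu) A = mu A + nu A.
Proof. by []. Qed.

Lemma signed_measureZ (a : R) mu A : (a *: mu) A = a * mu A.
Proof. by []. Qed.

Lemma signed_measure0 A : (0 : M) A = 0.
Proof. by []. Qed.

Lemma signed_measure_sum (I : Type) (s : seq I) (P : pred I) (c : I -> R) (mu : I -> M) A :
  (\sum_(i <- s | P i) c i *: mu i) A = \sum_(i <- s | P i) c i * mu i A.
Proof.
elim/big_ind2 : _ => //= [x1 x2 y1 y2 <- <-//].
Qed.

Lemma signed_measureP mu : is_signed_measure mu.
Proof. by case: mu => f /= /signed_measure_predP. Qed.

Lemma signed_measure_set0 mu : mu set0 = 0.
Proof. by have [] := signed_measureP mu. Qed.

Lemma signed_measure_nonmeasurable mu A : ~ measurable A -> mu A = 0.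
Proof. by have [_ _] := signed_measureP mu; apply. Qed.

Lemma eq_signed_measure mu nu : (forall A, measurable A -> mu A = nu A) -> mu = nu.
Proof.
move=> h; apply: val_inj; apply/funext => A /=.
have [mA|nA] := pselect (measurable A); first exact: h.
by rewrite !signed_measure_nonmeasurable.
Qed.

Lemma signed_measureU mu A B : measurable A -> measurable B -> A `&` B = set0 ->
  mu (A `|` B) = mu A + mu B.
Proof.
move=> mA mB AB; apply: EFin_inj.
have := @chargeU _ _ _ (charge_of mu) A B mA mB AB.
by rewrite /charge_of /= EFinD.
Qed.

(* Junk value: [0] unless [m] is a real charge on the measurable sets. *)
Definition mk_signed_measure (m : set T -> R) : M :=
  insubd 0 (fun A => if `[< measurable A >] then m A else 0).

Lemma mk_signed_measureE (m : set T -> R) (nu : {charge set T -> \bar R}) A :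
  (forall A, measurable A -> (m A)%:E = nu A) -> measurable A ->
  mk_signed_measure m A = m A.
Proof.
move=> h mA; rewrite /mk_signed_measure insubdK; first by rewrite asboolT.
apply/signed_measure_predP; apply/is_signed_measureP; split.
  by exists nu => B mB; rewrite asboolT// h.
by move=> B nB; rewrite asboolF.
Qed.

Definition pos_part mu : {measure set T -> \bar R} := jordan_pos (hahnP mu).
Definition neg_part mu : {measure set T -> \bar R} := jordan_neg (hahnP mu).

Lemma signed_integralE mu f :
  signed_integral mu f = \int[pos_part mu]_x f x - \int[neg_part mu]_x f x.
Proof. by []. Qed.

Lemma pos_partE mu A : measurable A -> pos_part mu A = (mu (A `&` hahn_pos mu))%:E.
Proof. by move=> mA; rewrite [LHS]jordan_posE cjordan_posE /crestr0 mem_set. Qed.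

Lemma neg_partE mu A : measurable A -> neg_part mu A = (- mu (A `&` hahn_neg mu))%:E.
Proof. by move=> mA; rewrite [LHS]jordan_negE cjordan_negE /crestr0 mem_set. Qed.

Lemma signed_measureE mu A : measurable A -> (mu A)%:E = (pos_part mu A - neg_part mu A)%E.
Proof.
move=> mA; have := jordan_decomp (hahnP mu) mA.
by rewrite {1}/charge_of /= /cadd /= cscaleN1.
Qed.

Lemma variation_measureE mu A : variation_measure mu A = (pos_part mu A + neg_part mu A)%E.
Proof. by []. Qed.

Lemma measurable_hahn_pos mu : measurable (hahn_pos mu).
Proof. by have [[]] := hahnP mu. Qed.

Lemma measurable_hahn_neg mu : measurable (hahn_neg mu).
Proof. by have [_ []] := hahnP mu. Qed.

Hint Resolve measurable_hahn_pos measurable_hahn_neg : core.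

(** The class of test functions: integrable for every finite measure, so that [signed_integral], a
    difference of two real integrals, is bilinear on it, and closed under the operations that build
    monomials and indicators. *)
Definition bounded_mfun f := measurable_fun setT f /\ exists K, forall x, `|f x| <= K.

Lemma bounded_mfun_cst (c : R) : bounded_mfun (fun=> c).
Proof. by split; [exact: measurable_cst|exists `|c|]. Qed.

Lemma bounded_mfunD f g : bounded_mfun f -> bounded_mfun g -> bounded_mfun (fun x => f x + g x).
Proof.
move=> [mf [K fK]] [mg [L gL]]; split; first exact: measurable_funD.
by exists (K + L) => x; rewrite (le_trans (ler_normD _ _))// lerD.
Qed.

Lemma bounded_mfunM f g : bounded_mfun f -> bounded_mfun g -> bounded_mfun (fun x => f x * g x).
Proof.
move=> [mf [K fK]] [mg [L gL]]; split; first exact: measurable_funM.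
by exists (K * L) => x; rewrite normrM ler_pM.
Qed.

Lemma bounded_mfunZ (c : R) f : bounded_mfun f -> bounded_mfun (fun x => c * f x).
Proof. by move=> bf; apply: bounded_mfunM => //; exact: bounded_mfun_cst. Qed.

Lemma bounded_mfunB f g : bounded_mfun f -> bounded_mfun g -> bounded_mfun (fun x => f x - g x).
Proof.
move=> bf bg; have := bounded_mfunD bf (bounded_mfunZ (-1) bg).
by under eq_fun do rewrite mulN1r.
Qed.

Lemma bounded_mfun_sum (I : Type) (s : seq I) (F : I -> T -> R) :
  (forall i, bounded_mfun (F i)) -> bounded_mfun (fun x => \sum_(i <- s) F i x).
Proof.
move=> h; elim: s => [|i s ih].
  by under eq_fun do rewrite big_nil; exact: bounded_mfun_cst.
by under eq_fun do rewrite big_cons; exact: bounded_mfunD.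
Qed.

Lemma bounded_mfun_prod (I : Type) (s : seq I) (F : I -> T -> R) :
  (forall i, bounded_mfun (F i)) -> bounded_mfun (fun x => \prod_(i <- s) F i x).
Proof.
move=> h; elim: s => [|i s ih].
  by under eq_fun do rewrite big_nil; exact: bounded_mfun_cst.
by under eq_fun do rewrite big_cons; exact: bounded_mfunM.
Qed.

Lemma bounded_mfun_indic A : measurable A -> bounded_mfun (\1_A).
Proof.
move=> mA; split; first exact: measurable_indic.
by exists 1 => x; rewrite indicE; case: (_ \in _); rewrite ?normr1 ?normr0.
Qed.

Lemma bounded_mfun_integrable (m : {measure set T -> \bar R}) f :
  (m setT < +oo)%E -> bounded_mfun f -> m.-integrable setT (EFin \o f).
Proof.
move=> fm [mf [K fK]]; apply: measurable_bounded_integrable => //.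
exists K; split; first by apply: num_real.
by move=> y Ky x _ /=; rewrite (le_trans (fK x))// ltW.
Qed.

Lemma Rintegral_fin (m : {measure set T -> \bar R}) f :
  (m setT < +oo)%E -> bounded_mfun f ->
  (\int[m]_x f x)%:E = (\int[m]_x (f x)%:E)%E.
Proof.
move=> fm bf; rewrite /Rintegral fineK//.
by apply: integrable_fin_num => //; exact: bounded_mfun_integrable.
Qed.

Lemma Rintegral_mscale (k : {nonneg R}) (m : {measure set T -> \bar R}) f :
  (m setT < +oo)%E -> bounded_mfun f ->
  \int[mscale k m]_x f x = k%:num * \int[m]_x f x.
Proof.
move=> fm bf; have [mf _] := bf.
have mEf : measurable_fun setT (EFin \o f) by exact/measurable_EFinP.
have fi := bounded_mfun_integrable fm bf.
have fs : (mscale k m setT < +oo)%E.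
  by rewrite /mscale /= ltey_eq fin_numM// ge0_fin_numE.
apply: EFin_inj; rewrite EFinM !Rintegral_fin//.
rewrite integralE [in RHS]integralE !ge0_integral_mscale//.
- rewrite -muleBr// fin_num_adde_defr//.
  by apply: integrable_fin_num => //; apply: integrable_funepos.
- exact: measurable_funeneg.
- exact: measurable_funepos.
Qed.

Local Notation finm m := (m setT < +oo)%E.

Lemma pos_part_fin mu : finm (pos_part mu).
Proof. by rewrite pos_partE// ltry. Qed.
Lemma neg_part_fin mu : finm (neg_part mu).
Proof. by rewrite neg_partE// ltry. Qed.
Hint Resolve pos_part_fin neg_part_fin : core.

(** The Jordan parts of a sum are not the sums of the Jordan parts. Any splitting of [mu] into
    finite measures computes the integral, because [m1 + neg_part mu] and [pos_part mu + m2] are the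
    same measure; linearity in the measure and the transport formula rest on this. *)
Lemma signed_integral_diff (m1 m2 : {measure set T -> \bar R}) mu f :
  finm m1 -> finm m2 ->
  (forall A, measurable A -> (mu A)%:E = m1 A - m2 A)%E -> bounded_mfun f ->
  signed_integral mu f = \int[m1]_x f x - \int[m2]_x f x.
Proof.
move=> f1 f2 h bf; have [mf _] := bf.
have mEf : measurable_fun setT (EFin \o f) by exact/measurable_EFinP.
rewrite signed_integralE; apply/eqP; rewrite subr_eq addrAC eq_sym subr_eq; apply/eqP.
apply: EFin_inj; rewrite !EFinD !Rintegral_fin//.
rewrite -!integral_measure_add//;
  try (apply: bounded_mfun_integrable => //; by [exact: pos_part_fin|exact: neg_part_fin]).
apply: eq_measure_integral => A mA _.
rewrite [LHS](measure_addE m1 (neg_part mu)) [RHS](measure_addE (pos_part mu) m2).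
have := h A mA; rewrite signed_measureE//.
have fin (m : {measure set T -> \bar R}) : finm m -> m A \is a fin_num.
  move=> fm; rewrite ge0_fin_numE//; apply: le_lt_trans fm.
  by apply: le_measure => //; rewrite inE.
have q1 := fin _ f1; have q2 := fin _ f2.
have q3 := fin _ (pos_part_fin mu); have q4 := fin _ (neg_part_fin mu).
rewrite -(fineK q1) -(fineK q2) -(fineK q3) -(fineK q4).
rewrite -!EFinN -!EFinD => -[] e; congr EFin; lra.
Qed.

Lemma signed_integralDr mu f g : bounded_mfun f -> bounded_mfun g ->
  signed_integral mu (fun x => f x + g x) =
  signed_integral mu f + signed_integral mu g.
Proof.
move=> bf bg; rewrite signed_integralE !RintegralD//;
  try (apply: bounded_mfun_integrable => //; by [exact: pos_part_fin|exact: neg_part_fin]).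
by rewrite opprD addrACA.
Qed.

Lemma signed_integralZr mu c f : bounded_mfun f ->
  signed_integral mu (fun x => c * f x) = c * signed_integral mu f.
Proof.
move=> bf; rewrite signed_integralE !RintegralZl//;
  try (apply: bounded_mfun_integrable => //; by [exact: pos_part_fin|exact: neg_part_fin]).
by rewrite mulrBr.
Qed.

Lemma signed_integralBr mu f g : bounded_mfun f -> bounded_mfun g ->
  signed_integral mu (fun x => f x - g x) =
  signed_integral mu f - signed_integral mu g.
Proof.
move=> bf bg; rewrite -mulN1r -signed_integralZr// -signed_integralDr//; last exact: bounded_mfunZ.
by under [in RHS]eq_fun do rewrite mulN1r.
Qed.

Lemma signed_integral_sumr (I : Type) (s : seq I) (F : I -> T -> R) mu :
  (forall i, bounded_mfun (F i)) ->
  signed_integral mu (fun x => \sum_(i <- s) F i x) =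
  \sum_(i <- s) signed_integral mu (F i).
Proof.
move=> h; elim: s => [|i s ih].
  rewrite big_nil (_ : (fun _ => _) = (fun x => 0 * (fun=> 0) x)).
    by rewrite signed_integralZr ?mul0r//; exact: bounded_mfun_cst.
  by apply/funext => x; rewrite big_nil mul0r.
rewrite big_cons -ih -signed_integralDr//; last exact: bounded_mfun_sum.
by under eq_fun do rewrite big_cons.
Qed.

Lemma signed_integral_cst mu c : signed_integral mu (fun=> c) = c * mu setT.
Proof.
rewrite (_ : (fun=> c) = (fun x => c * (fun=> 1) x)); last first.
  by apply/funext => x; rewrite mulr1.
rewrite signed_integralZr; last exact: bounded_mfun_cst.
rewrite signed_integralE !Rintegral_cst// !mul1r; congr (_ * _).
by apply: EFin_inj; rewrite signed_measureE// EFinB !fineK// fin_num_measure.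
Qed.

Lemma signed_integral_indic mu A : measurable A -> signed_integral mu (\1_A) = mu A.
Proof.
move=> mA; rewrite signed_integralE /Rintegral !integral_indic// !setIT.
by apply: EFin_inj; rewrite signed_measureE// EFinB !fineK// fin_num_measure.
Qed.

Lemma signed_integralD mu nu f : bounded_mfun f ->
  signed_integral (mu + nu) f = signed_integral mu f + signed_integral nu f.
Proof.
move=> bf; have [mf _] := bf.
have mEf : measurable_fun setT (EFin \o f) by exact/measurable_EFinP.
have fadd (m1 m2 : {measure set T -> \bar R}) : finm m1 -> finm m2 ->
    (measure_add m1 m2 setT < +oo)%E.
  by move=> h1 h2; rewrite [X in (X < _)%E](measure_addE m1 m2) lte_add_pinfty.
rewrite (@signed_integral_diff (measure_add (pos_part mu) (pos_part nu)) (measure_add (neg_part mu) (neg_part nu)));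
  [|by apply: fadd; [exact: pos_part_fin|exact: pos_part_fin]
   |by apply: fadd; [exact: neg_part_fin|exact: neg_part_fin]| |by []].
- rewrite signed_integralE.
  have E (m1 m2 : {measure set T -> \bar R}) : finm m1 -> finm m2 ->
    \int[measure_add m1 m2]_x f x = \int[m1]_x f x + \int[m2]_x f x.
    move=> h1 h2; apply: EFin_inj; rewrite EFinD !Rintegral_fin//.
      by rewrite integral_measure_add//; exact: bounded_mfun_integrable.
    exact: fadd.
  rewrite !E; try exact: pos_part_fin; try exact: neg_part_fin.
  by rewrite opprD addrACA.
- move=> A mA; rewrite signed_measureD EFinD !signed_measureE//.
  have E (m1 m2 : {measure set T -> \bar R}) :
    (measure_add m1 m2 : {measure set T -> \bar R}) A = (m1 A + m2 A)%E.
    exact: measure_addE.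
  rewrite !E.
  have fin (m : {measure set T -> \bar R}) : finm m -> m A \is a fin_num.
    move=> fm; rewrite ge0_fin_numE//; apply: le_lt_trans fm.
    by apply: le_measure => //; rewrite inE.
  have q1 := fin _ (pos_part_fin mu); have q2 := fin _ (pos_part_fin nu).
  have q3 := fin _ (neg_part_fin mu); have q4 := fin _ (neg_part_fin nu).
  rewrite -(fineK q1) -(fineK q2) -(fineK q3) -(fineK q4).
  set a := fine _; set b := fine _; set c := fine _; set e := fine _.
  have h : (a - b) + (c - e) = (a + c) - (b + e) by ring.
  exact: (congr1 EFin h).
Qed.

Lemma mscale_fin (k : {nonneg R}) (m : {measure set T -> \bar R}) :
  finm m -> finm (mscale k m).
Proof. by move=> fm; rewrite /mscale /= ltey_eq fin_numM// ge0_fin_numE. Qed.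

Lemma mscaleE (k : {nonneg R}) (m : {measure set T -> \bar R}) A :
  (mscale k m : {measure set T -> \bar R}) A = (k%:num%:E * m A)%E.
Proof. by []. Qed.

Lemma signed_integralZ mu c f : bounded_mfun f ->
  signed_integral (c *: mu) f = c * signed_integral mu f.
Proof.
move=> bf.
have jpf A : measurable A -> pos_part mu A \is a fin_num by move=> mA; rewrite pos_partE.
have jnf A : measurable A -> neg_part mu A \is a fin_num by move=> mA; rewrite neg_partE.
have [c0|c0] := leP 0 c.
  rewrite (@signed_integral_diff (mscale (NngNum c0) (pos_part mu)) (mscale (NngNum c0) (neg_part mu)));
    [|by apply: mscale_fin; exact: pos_part_fin|by apply: mscale_fin; exact: neg_part_fin| |by []].
    rewrite !Rintegral_mscale; [|exact: neg_part_fin|by []|exact: pos_part_fin|by []].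
    by rewrite -mulrBr.
  move=> A mA; rewrite signed_measureZ EFinM signed_measureE// !mscaleE /= muleBr//.
  by rewrite fin_num_adde_defl// fin_numN jnf.
(* For a negative factor the two Jordan parts exchange roles. *)
have c0' : 0 <= - c by lra.
rewrite (@signed_integral_diff (mscale (NngNum c0') (neg_part mu)) (mscale (NngNum c0') (pos_part mu)));
  [|by apply: mscale_fin; exact: neg_part_fin|by apply: mscale_fin; exact: pos_part_fin| |by []].
  rewrite !Rintegral_mscale; [|exact: pos_part_fin|by []|exact: neg_part_fin|by []].
  by rewrite signed_integralE /=; ring.
move=> A mA; rewrite signed_measureZ EFinM signed_measureE// !mscaleE.
have q3 := jpf _ mA; have q4 := jnf _ mA.
rewrite -(fineK q3) -(fineK q4); set a := fine _; set b := fine _.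
have h : c * (a - b) = (- c) * b - (- c) * a by ring.
exact: (congr1 EFin h).
Qed.

Lemma signed_integral_sum (I : Type) (s : seq I) (P : pred I) (c : I -> R) (mu : I -> M) f :
  bounded_mfun f -> signed_integral (\sum_(i <- s | P i) c i *: mu i) f =
  \sum_(i <- s | P i) c i * signed_integral (mu i) f.
Proof.
move=> bf; elim/big_ind2 : _ => //= [|x1 x2 y1 y2 <- <-|i _].
- by rewrite -(scale0r (0 : M)) signed_integralZ// mul0r.
- by rewrite signed_integralD.
- by rewrite signed_integralZ.
Qed.

Lemma signed_integral0 f : bounded_mfun f -> signed_integral (0 : M) f = 0.
Proof. by move=> bf; rewrite -(scale0r (0 : M)) signed_integralZ// mul0r. Qed.

Lemma signed_integralN mu f : bounded_mfun f -> signed_integral (- mu) f = - signed_integral mu f.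
Proof. by move=> bf; rewrite -scaleN1r signed_integralZ// mulN1r. Qed.

(** Stands in for [msupport]: no topology is involved, so it passes easily to sums, push-forwards
    and restrictions. For closed subsets of the unit cube the two notions agree, by
    [carried_msupport] and [msupport_carried]. *)
Definition carried C mu := forall A, measurable A -> A `&` C = set0 -> mu A = 0.

Lemma carriedD C mu nu : carried C mu -> carried C nu -> carried C (mu + nu).
Proof. by move=> h1 h2 A mA AC; rewrite signed_measureD h1// h2// addr0. Qed.

Lemma carriedZ C c mu : carried C mu -> carried C (c *: mu).
Proof. by move=> h1 A mA AC; rewrite signed_measureZ h1// mulr0. Qed.

Lemma carried0 C : carried C 0.
Proof. by []. Qed.

Lemma carried_sum C (I : Type) (s : seq I) (P : pred I) (c : I -> R) (mu : I -> M) :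
  (forall i, carried C (mu i)) -> carried C (\sum_(i <- s | P i) c i *: mu i).
Proof.
move=> h; elim/big_ind : _ => //; first exact: carriedD.
by move=> i _; exact: carriedZ.
Qed.

Lemma carriedS C C' mu : C `<=` C' -> carried C mu -> carried C' mu.
Proof.
move=> CC' h A mA AC; apply: h => //.
by rewrite -subset0 -AC; apply: setIS.
Qed.

Lemma pos_part_carried C mu : measurable C -> carried C mu -> pos_part mu (~` C) = 0%E.
Proof.
move=> mC h; rewrite pos_partE; last exact: measurableC.
rewrite h//; first by apply: measurableI => //; exact: measurableC.
by rewrite setIAC setICl set0I.
Qed.

Lemma neg_part_carried C mu : measurable C -> carried C mu -> neg_part mu (~` C) = 0%E.
Proof.
move=> mC h; rewrite neg_partE; last exact: measurableC.
rewrite h ?oppr0//; first by apply: measurableI => //; exact: measurableC.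
by rewrite setIAC setICl set0I.
Qed.

Lemma signed_integral_carried0 C mu f : measurable C -> carried C mu -> bounded_mfun f ->
  (forall x, C x -> f x = 0) -> signed_integral mu f = 0.
Proof.
move=> mC cC [mf _] f0.
have mEf : measurable_fun setT (EFin \o f) by exact/measurable_EFinP.
have E (m : {measure set T -> \bar R}) : m (~` C) = 0%E -> \int[m]_x f x = 0.
  move=> mC0; rewrite /Rintegral (@ae_eq_integral _ _ _ _ _ (cst 0%E))//.
    by rewrite integral0.
  exists (~` C); split => //; first exact: measurableC.
  move=> x /= h Cx; apply: h => _; by rewrite f0.
by rewrite signed_integralE !E ?subr0//; [exact: neg_part_carried|exact: pos_part_carried].
Qed.

Lemma eq_signed_integral_carried C mu f g : measurable C -> carried C mu -> bounded_mfun f -> bounded_mfun g ->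
  (forall x, C x -> f x = g x) -> signed_integral mu f = signed_integral mu g.
Proof.
move=> mC cC bf bg fg; apply/eqP; rewrite -subr_eq0 -signed_integralBr//; apply/eqP.
by apply: (signed_integral_carried0 mC) => //; [exact: bounded_mfunB|move=> x /fg ->; rewrite subrr].
Qed.

(** * The total variation norm *)

Lemma tv_normE mu : tv_norm mu = mu (hahn_pos mu) - mu (hahn_neg mu).
Proof.
rewrite /tv_norm variation_measureE.
by rewrite -/(pos_part mu) -/(neg_part mu) pos_partE// neg_partE// !setTI -EFinD.
Qed.

Lemma tv_norm_variation mu : (tv_norm mu)%:E = variation_measure mu setT.
Proof.
by rewrite tv_normE variation_measureE -/(pos_part mu) -/(neg_part mu) pos_partE// neg_partE// !setTI -EFinD.
Qed.

Lemma tv_norm_ge0 mu : 0 <= tv_norm mu.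
Proof. by rewrite -lee_fin tv_norm_variation. Qed.

(** The integrand is the sign function of the Hahn decomposition, bounded by 1; the triangle
    inequality and the contraction under push-forward then follow from [signed_integral_le]. *)
Lemma tv_norm_integral mu :
  tv_norm mu = signed_integral mu (fun x => \1_(hahn_pos mu) x - \1_(hahn_neg mu) x).
Proof. by rewrite signed_integralBr; [rewrite !signed_integral_indic// tv_normE|exact: bounded_mfun_indic..]. Qed.

Lemma signed_integral_le mu f K : bounded_mfun f -> (forall x, `|f x| <= K) ->
  `|signed_integral mu f| <= K * tv_norm mu.
Proof.
move=> bf fK.
have E (m : {measure set T -> \bar R}) : finm m ->
    `|\int[m]_x f x| <= K * fine (m setT).
  move=> fm; apply: le_trans (le_normr_Rintegral _ _) _ => //.
    exact: bounded_mfun_integrable.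
  rewrite -(Rintegral_cst m measurableT K); apply: le_Rintegral => //.
    apply: bounded_mfun_integrable => //; have [mf _] := bf; split.
      exact: measurableT_comp.
    by exists K => x; rewrite normr_id.
  by apply: bounded_mfun_integrable => //; exact: bounded_mfun_cst.
rewrite signed_integralE (le_trans (ler_normB _ _))//.
rewrite /tv_norm variation_measureE fineD; [|by rewrite -/(pos_part mu) pos_partE..|by rewrite -/(neg_part mu) neg_partE].
by rewrite mulrDr lerD//; apply: E; [exact: pos_part_fin|exact: neg_part_fin].
Qed.

Lemma signed_integral_carried_le C mu f K : measurable C -> carried C mu -> bounded_mfun f ->
  0 <= K -> (forall x, C x -> `|f x| <= K) ->
  `|signed_integral mu f| <= K * tv_norm mu.
Proof.
move=> mC cC bf K0 fK.
rewrite (@eq_signed_integral_carried C _ _ (fun x => f x * \1_C x))//.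
- apply: signed_integral_le; first by apply: bounded_mfunM => //; exact: bounded_mfun_indic.
  move=> x; rewrite indicE; case: (boolP (x \in C)) => [|_].
    by rewrite inE mulr1 => /fK.
  by rewrite mulr0 normr0.
- by apply: bounded_mfunM => //; exact: bounded_mfun_indic.
- by move=> x Cx; rewrite indicE mem_set// mulr1.
Qed.

Lemma hahn_sign_le mu x : `|\1_(hahn_pos mu) x - \1_(hahn_neg mu) x : R| <= 1.
Proof.
rewrite !indicE; case: (_ \in _); case: (_ \in _) => /=;
  by rewrite ?subrr ?subr0 ?sub0r ?normrN ?normr0 ?normr1.
Qed.

Lemma bounded_mfun_hahn_sign mu : bounded_mfun (fun x => \1_(hahn_pos mu) x - \1_(hahn_neg mu) x).
Proof. by apply: bounded_mfunB; exact: bounded_mfun_indic. Qed.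

Lemma ler_tv_normD mu nu : tv_norm (mu + nu) <= tv_norm mu + tv_norm nu.
Proof.
rewrite tv_norm_integral signed_integralD; last exact: bounded_mfun_hahn_sign.
have b x := signed_integral_le x (bounded_mfun_hahn_sign (mu + nu)) (@hahn_sign_le (mu + nu)).
apply: le_trans (ler_norm _) _; apply: le_trans (ler_normD _ _) _.
by rewrite lerD// (le_trans (b _))// mul1r.
Qed.

Lemma ler_tv_normZ c mu : tv_norm (c *: mu) <= `|c| * tv_norm mu.
Proof.
rewrite tv_norm_integral signed_integralZ; last exact: bounded_mfun_hahn_sign.
have b x := signed_integral_le x (bounded_mfun_hahn_sign (c *: mu)) (@hahn_sign_le (c *: mu)).
apply: le_trans (ler_norm _) _; rewrite normrM ler_wpM2l//.
by rewrite (le_trans (b _))// mul1r.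
Qed.

Lemma tv_norm0 : tv_norm (0 : M) = 0.
Proof. by rewrite tv_normE !signed_measure0 subrr. Qed.

Lemma tv_norm_sum (I : Type) (s : seq I) (P : pred I) (c : I -> R) (mu : I -> M) :
  tv_norm (\sum_(i <- s | P i) c i *: mu i) <=
  \sum_(i <- s | P i) `|c i| * tv_norm (mu i).
Proof.
elim/big_rec2 : _ => [|i x y _ h]; first by rewrite tv_norm0.
by rewrite (le_trans (ler_tv_normD _ _))// lerD// ler_tv_normZ.
Qed.

Lemma ler_norm_tv mu A : measurable A -> `|mu A| <= tv_norm mu.
Proof.
move=> mA; rewrite -signed_integral_indic// -[leRHS]mul1r.
apply: signed_integral_le; first exact: bounded_mfun_indic.
by move=> x; rewrite indicE; case: (_ \in _); rewrite ?normr1 ?normr0.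
Qed.

Lemma tv_norm_eq0 mu : tv_norm mu = 0 -> mu = 0.
Proof.
move=> h; apply: eq_signed_measure => A mA; apply/eqP; rewrite -normr_le0 -h.
exact: ler_norm_tv.
Qed.

(** * Push-forwards, restrictions and Dirac measures *)

Definition push_measure (s : T -> T) mu : M := mk_signed_measure (fun A => mu (s @^-1` A)).

Lemma push_measureE (s : T -> T) mu A : measurable_fun setT s -> measurable A ->
  push_measure s mu A = mu (s @^-1` A).
Proof.
move=> ms mA.
pose s' : {mfun T >-> T} := HB.pack s (isMeasurableFun.Build _ _ _ _ s ms).
by rewrite (@mk_signed_measureE _ (pushforward (charge_of mu) s')).
Qed.

Definition restrict_measure (E : set T) mu : M := mk_signed_measure (fun A => mu (A `&` E)).

Lemma restrict_measureE E mu A : measurable E -> measurable A ->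
  restrict_measure E mu A = mu (A `&` E).
Proof. by move=> mE mA; rewrite (@mk_signed_measureE _ (crestr (charge_of mu) mE)). Qed.

Definition signed_dirac (x : T) : M := mk_signed_measure (fun A => \1_A x).

Lemma signed_diracE x A : measurable A -> signed_dirac x A = \1_A x.
Proof. by move=> mA; rewrite (@mk_signed_measureE _ (charge_of_finite_measure (\d_x)))//. Qed.

Lemma signed_integral_push (s : T -> T) mu f : measurable_fun setT s -> bounded_mfun f ->
  signed_integral (push_measure s mu) f = signed_integral mu (f \o s).
Proof.
move=> ms bf; have [mf [K fK]] := bf.
have bfs : bounded_mfun (f \o s).
  by split; [exact: measurableT_comp|exists K => x; exact: fK].
have mEf : measurable_fun setT (EFin \o f) by exact/measurable_EFinP.
pose s' : {mfun T >-> T} := HB.pack s (isMeasurableFun.Build _ _ _ _ s ms).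
(* The images of the Jordan parts need not be mutually singular, hence need not be the Jordan parts
   of the image. *)
rewrite (@signed_integral_diff (pushforward (pos_part mu) s') (pushforward (neg_part mu) s')) //.
- rewrite signed_integralE /Rintegral !integral_pushforward//.
  + by apply: (@bounded_mfun_integrable (neg_part mu)) => //; exact: neg_part_fin.
  + by apply: (@bounded_mfun_integrable (pos_part mu)) => //; exact: pos_part_fin.
- exact: pos_part_fin.
- exact: neg_part_fin.
- move=> A mA; rewrite push_measureE// signed_measureE//; rewrite -[X in measurable X]setTI; exact: (measurable_funPT s').
Qed.

Lemma tv_norm_push (s : T -> T) mu : measurable_fun setT s ->
  tv_norm (push_measure s mu) <= tv_norm mu.
Proof.
move=> ms; rewrite tv_norm_integral signed_integral_push//; last exact: bounded_mfun_hahn_sign.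
apply: le_trans (ler_norm _) _; rewrite -[leRHS]mul1r; apply: signed_integral_le.
  have [mf [K fK]] := bounded_mfun_hahn_sign (push_measure s mu).
  by split; [exact: measurableT_comp|exists K => x; exact: fK].
by move=> x; exact: hahn_sign_le.
Qed.

Lemma push_measure_sum (s : T -> T) (I : Type) (r : seq I) (P : pred I) (c : I -> R)
    (mu : I -> M) : measurable_fun setT s ->
  push_measure s (\sum_(i <- r | P i) c i *: mu i) = \sum_(i <- r | P i) c i *: push_measure s (mu i).
Proof.
move=> ms; apply: eq_signed_measure => A mA; rewrite push_measureE// !signed_measure_sum.
by apply: eq_bigr => i _; rewrite push_measureE.
Qed.

Lemma signed_integral_dirac x f : bounded_mfun f -> signed_integral (signed_dirac x) f = f x.
Proof.
move=> bf; have [mf _] := bf.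
have mEf : measurable_fun setT (EFin \o f) by exact/measurable_EFinP.
rewrite (@signed_integral_diff (\d_x) mzero)//.
- rewrite /Rintegral integral_dirac// integral_measure_zero subr0.
  by rewrite diracT mul1e.
- by rewrite [X in (X < _)%E]diracT ltry.
- by rewrite [X in (X < _)%E](_ : _ = 0%E)// ltry.
- by move=> A mA; rewrite signed_diracE// sube0.
Qed.

Lemma tv_norm_dirac x : tv_norm (signed_dirac x) <= 1.
Proof.
rewrite tv_norm_integral signed_integral_dirac; last exact: bounded_mfun_hahn_sign.
by apply: le_trans (ler_norm _) _; exact: hahn_sign_le.
Qed.

Lemma carried_dirac x C : C x -> carried C (signed_dirac x).
Proof.
move=> Cx A mA AC; rewrite signed_diracE// indicE memNset// => Ax.
by have : (A `&` C) x by []; rewrite AC.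
Qed.

Lemma ler_norm_variation mu A : measurable A ->
  (`|mu A|%:E <= variation_measure mu A)%E.
Proof. by move=> mA; have := abse_charge_variation (hahnP mu) mA. Qed.

(** The Hahn sets of the restriction enter only through the bound of [|mu A|] by the variation of
    [A]. The right-hand side is a measure in [E], so that these bounds add up over a partition. *)
Lemma tv_norm_restrict E mu : measurable E ->
  ((tv_norm (restrict_measure E mu))%:E <= variation_measure mu E)%E.
Proof.
move=> mE; have [_ _ U I] := hahnP (restrict_measure E mu).
rewrite tv_normE !restrict_measureE// -[X in variation_measure mu X](setTI E) -U setIUl.
rewrite -[X in (_ <= X)%E]/(charge_variation (hahnP mu) _).
rewrite (measureU (charge_variation (hahnP mu))); last first.
- by rewrite setIACA I set0I.
- exact: measurableI.
- exact: measurableI.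
rewrite EFinD leeD//.
  apply: le_trans (ler_norm_variation _ _); last exact: measurableI.
  by rewrite lee_fin ler_norm.
apply: le_trans (ler_norm_variation _ _); last exact: measurableI.
by rewrite lee_fin -normrN ler_norm.
Qed.

Lemma carried_restrict E mu : measurable E -> carried E (restrict_measure E mu).
Proof. by move=> mE A mA AE; rewrite restrict_measureE// AE signed_measure_set0. Qed.

Lemma restrict_measureU E F mu : measurable E -> measurable F -> E `&` F = set0 ->
  restrict_measure (E `|` F) mu = restrict_measure E mu + restrict_measure F mu.
Proof.
move=> mE mF EF; apply: eq_signed_measure => A mA; rewrite signed_measureD !restrict_measureE//; last exact: measurableU.
by rewrite setIUr signed_measureU//; [exact: measurableI|exact: measurableI|rewrite setIACA EF setI0].
Qed.

Lemma restrict_measureT mu : restrict_measure setT mu = mu.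
Proof. by apply: eq_signed_measure => A mA; rewrite restrict_measureE// setIT. Qed.

End signed_measure_theory.

(** * Borel measures on the unit cube *)

Section borel_cube.
Context (R : realType) (d : nat).
Local Notation B := (borelQd R d).
Local Notation QD := (Qd R d).
Local Notation M := (signed_measure B R).

Definition cube_coord (i : 'I_d) (x : QD) : R := (\val x) ord0 i.

Lemma coord01 i x : 0 <= cube_coord i x <= 1.
Proof. by have := set_mem (valP x); apply. Qed.

Lemma Qd_eq (x y : QD) : (forall i, cube_coord i x = cube_coord i y) -> x = y.
Proof.
move=> h; apply: val_inj; apply/rowP => i; exact: h.
Qed.

Lemma exists_Qd (f : 'I_d -> R) : (forall i, 0 <= f i <= 1) ->
  exists x : QD, forall i, cube_coord i x = f i.
Proof.
move=> h.
have hx : unit_cube R d (\row_i f i) by move=> i; rewrite mxE.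
by exists (SigSub (mem_set hx)) => i; rewrite /cube_coord /= mxE.
Qed.

Lemma val_continuous : continuous (\val : QD -> 'rV[R]_d).
Proof. exact: initial_continuous. Qed.

Lemma coord_cont i : continuous (cube_coord i).
Proof.
move=> x; apply: (@continuous_comp _ _ _ (\val : QD -> 'rV[R]_d)
  (fun z : 'rV[R]_d => z ord0 i)); first exact: val_continuous.
exact: coord_continuous.
Qed.

Lemma open_measurableQd (U : set QD) : open U -> measurable (U : set B).
Proof. by move=> oU; apply: sub_sigma_algebra. Qed.

Lemma cont_measurableQd (f : QD -> R) : continuous f ->
  measurable_fun setT (f : B -> R).
Proof.
move=> cf; apply: (measurability _ (RGenOpens.measurableE R)).
move=> _ [_ [a [b ->] <-]]; rewrite setTI; apply: open_measurableQd.
by move/continuousP : cf; apply; exact: interval_open.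
Qed.

Lemma bounded_mfun_coord i : bounded_mfun (cube_coord i : B -> R).
Proof.
split; first by apply: cont_measurableQd; exact: coord_cont.
by exists 1 => x; have /andP[? ?] := coord01 i x; rewrite ger0_norm.
Qed.

Lemma bounded_mfun_monomial (al : 'I_d -> nat) : bounded_mfun (monomial al : B -> R).
Proof.
apply: bounded_mfun_prod => i; elim: (al i) => [|n ih].
  by under eq_fun do rewrite expr0; exact: bounded_mfun_cst.
under eq_fun do rewrite exprS; apply: bounded_mfunM => //; exact: bounded_mfun_coord.
Qed.

Lemma monomial_ge0 (al : 'I_d -> nat) (x : QD) : 0 <= monomial al x.
Proof.
by apply: prodr_ge0 => i _; apply: exprn_ge0; case/andP : (coord01 i x).
Qed.

Lemma measurable_coord_lt i u : measurable ([set x | cube_coord i x < u] : set B).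
Proof.
have -> : [set x | cube_coord i x < u] = cube_coord i @^-1` `]-oo, u[.
  by apply/seteqP; split => x /=; rewrite in_itv.
by apply: open_measurableQd; move/continuousP : (@coord_cont i); apply; exact: interval_open.
Qed.

Lemma measurable_set1Qd (x : B) : measurable ([set x] : set B).
Proof.
have -> : [set x] = \bigcap_(i in [set: 'I_d]) (cube_coord i @^-1` [set cube_coord i x]).
  apply/seteqP; split => y /=; first by move=> -> i _.
  by move=> h; apply: Qd_eq => i; exact: h.
apply: fin_bigcap_measurable; first exact: finite_finset.
move=> i _; rewrite -[X in measurable X]setTI.
by apply: (bounded_mfun_coord i).1.
Qed.

(** A countable stock of sets out of which every open set is made. Half-open, so that only the
    conditions [cube_coord i x < u] and their negations occur; these half-spaces therefore generate
    the Borel sets. *)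
Definition rat_box (j : {ffun 'I_d -> rat * rat}) : set QD :=
  [set x | forall i, ratr (j i).1 <= cube_coord i x < ratr (j i).2].

Lemma nbhs_rat_box (x : QD) (U : set QD) : nbhs x U ->
  exists2 j, rat_box j x & rat_box j `<=` U.
Proof.
move=> [_ [[V oV <-] /= Vx VU]].
have /nbhs_ballP[e /= e0 eV] : nbhs (\val x) V by exact: open_nbhs_nbhs.
have rl i : exists q : rat, cube_coord i x - e < ratr q < cube_coord i x.
  have [|q] := @rat_in_itvoo _ (cube_coord i x - e) (cube_coord i x).
    by rewrite ltrBlDr ltrDl.
  by rewrite in_itv /= => h; exists q.
have ru i : exists q : rat, cube_coord i x < ratr q < cube_coord i x + e.
  have [|q] := @rat_in_itvoo _ (cube_coord i x) (cube_coord i x + e).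
    by rewrite ltrDl.
  by rewrite in_itv /= => h; exists q.
exists [ffun i => (sval (cid (rl i)), sval (cid (ru i)))].
  move=> i; rewrite ffunE /=.
  case: cid => p /= /andP[_ /ltW ->]; by case: cid => q /= /andP[->].
move=> y hy; apply: VU => /=; apply: eV; split=> // i0 i; rewrite (ord1 i0).
have := hy i; rewrite ffunE /=; case: cid => p /= /andP[h1 h2].
case: cid => q /= /andP[h3 h4]; rewrite /cube_coord in h1 h2 h3 h4 * => /andP[h5 h6].
rewrite /ball /= ltr_norml; apply/andP; split; lra.
Qed.

Lemma rat_boxE j : rat_box j = \bigcap_(i in [set: 'I_d])
    (~` [set x | cube_coord i x < ratr (j i).1] `&` [set x | cube_coord i x < ratr (j i).2]).
Proof.
apply/seteqP; split => y /=.
  by move=> h i _ /=; have /andP[h1 h2] := h i; split => //; apply/negP; rewrite -leNgt.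
move=> h i; have [/= /negP] := h i I.
by rewrite -leNgt => -> ->.
Qed.

Lemma measurable_rat_box j : measurable (rat_box j : set B).
Proof.
rewrite rat_boxE; apply: fin_bigcap_measurable; first exact: finite_finset.
move=> i _; apply: measurableI; last exact: measurable_coord_lt.
by apply: measurableC; exact: measurable_coord_lt.
Qed.

Lemma open_rat_box (U : set QD) : open U ->
  U = \bigcup_(j in [set j | rat_box j `<=` U]) rat_box j.
Proof.
move=> oU; apply/seteqP; split => [x Ux|x [j jU jx]]; last exact: jU.
have [j jx jU] := nbhs_rat_box (open_nbhs_nbhs (conj oU Ux)).
by exists j.
Qed.

(** The null neighbourhoods may be uncountably many, but each contains a rational box around its
    point, and countably many null boxes then cover [A]. *)
Lemma locally_null (mu : M) (A : set QD) : measurable (A : set B) ->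
  (forall x, A x -> exists U, [/\ open U, U x & variation_measure mu U = 0%E]) ->
  mu A = 0.
Proof.
move=> mA h; apply/eqP; rewrite -normr_le0 -lee_fin.
apply: le_trans (ler_norm_variation mu mA) _.
pose F n : set B := if unpickle n is Some j then
  if variation_measure mu (rat_box j) == 0%E then rat_box j else set0 else set0.
have mF n : measurable (F n).
  by rewrite /F; case: unpickle => // j; case: ifP => // _; exact: measurable_rat_box.
have F0 n : (charge_variation (hahnP mu)).-negligible (F n).
  exists (F n); split => //; rewrite /F; case: unpickle => [j|]; last exact: measure0.
  by case: ifP => [/eqP//|_]; exact: measure0.
have [N [mN N0 FN]] := negligible_bigcup F0.
rewrite -[leRHS]N0; apply: (@le_measure _ _ _ (charge_variation (hahnP mu))); rewrite ?inE//.
move=> x Ax; apply: FN; have [U [oU Ux U0]] := h x Ax.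
have [j jx jU] := nbhs_rat_box (open_nbhs_nbhs (conj oU Ux)).
exists (pickle j) => //; rewrite /F pickleK ifT//.
rewrite -measure_le0 -[leRHS]U0; apply: le_measure; rewrite ?inE//.
  exact: measurable_rat_box.
exact: open_measurableQd.
Qed.

Lemma carried_msupport (mu : M) (C : set QD) :
  (forall x, msupport mu x -> C x) -> carried (C : set B) mu.
Proof.
move=> h A mA AC; apply: (@locally_null mu) => // x Ax.
have : ~ C x by move=> Cx; have : (A `&` C) x by []; rewrite AC.
move=> nC; have : ~ msupport mu x by move=> /h.
move=> /existsNP[U]; rewrite !not_implyE => -[oU [Ux /negP]].
by rewrite negbK => /eqP U0; exists U.
Qed.

Lemma msupport_carried (mu : M) (C : set QD) : closed C ->
  carried (C : set B) mu -> forall x, msupport mu x -> C x.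
Proof.
move=> cC cm x sx; apply: contrapT => nCx.
have oU : open (~` C) by exact: closed_openC.
have mC : measurable (C : set B).
  by rewrite -[C]setCK; apply: measurableC; exact: open_measurableQd.
have := sx _ oU nCx; rewrite variation_measureE -/(pos_part mu) -/(neg_part mu).
by rewrite pos_part_carried// neg_part_carried// adde0 eqxx.
Qed.

Definition lower_box (a : 'I_d -> R) : set QD := [set x | forall i, cube_coord i x < a i].

Lemma measurable_lower_box a : measurable (lower_box a : set B).
Proof.
have -> : lower_box a = \bigcap_(i in [set: 'I_d]) [set x | cube_coord i x < a i].
  by apply/seteqP; split => y h i => [_|]; exact: h.
apply: fin_bigcap_measurable; first exact: finite_finset.
by move=> i _; exact: measurable_coord_lt.
Qed.

(** Lower boxes are stable under intersection and generate the Borel sets, so the Jordan parts agree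
    once they agree on them. Corners with entries above 1 are included because the strict
    inequalities would otherwise miss the faces [x_i = 1]; the upper bound 2 will keep the arguments
    of [step_poly] in [0, 1]. *)
Lemma lower_box_unique (mu : M) : (forall a, (forall i, 0 <= a i <= 2) -> mu (lower_box a) = 0) ->
  mu = 0.
Proof.
move=> h.
pose G : set (set B) := [set lower_box a | a in [set a | forall i, 0 <= a i <= 2]].
have GE i u : <<s G >> [set x : B | cube_coord i x < u].
  have [u0|u0] := leP u 0.
    rewrite (_ : [set x | _] = set0); last first.
      apply/seteqP; split => // x /=; have /andP[? ?] := coord01 i x; lra.
    have : sigma_algebra setT <<s G >> by exact: smallest_sigma_algebra.
    by case.
  have [u2|u2] := leP u 2.
    apply: sub_sigma_algebra; exists (fun i' => if i' == i then u else 2).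
      by move=> i' /=; case: ifP => _; lra.
    apply/seteqP; split => x /= hx; first by have := hx i; rewrite eqxx.
    move=> i'; case: eqP => [->//|_]; have /andP[? ?] := coord01 i' x; lra.
  rewrite (_ : [set x | _] = lower_box (fun=> 2)); last first.
    by apply/seteqP; split => x /= hx; [move=> i'; have /andP[? ?] := coord01 i' x; lra
      |have /andP[? ?] := coord01 i x; lra].
  by apply: sub_sigma_algebra; exists (fun=> 2) => //= i'; lra.
have mG : measurable = <<s G >> :> set (set B).
  apply/seteqP; split; last first.
    apply: smallest_sub; first exact: sigma_algebra_measurable.
    by move=> _ [a _ <-]; exact: measurable_lower_box.
  apply: smallest_sub; first exact: smallest_sigma_algebra.
  move=> U oU; rewrite (open_rat_box oU).
  pose D := g_sigma_algebraType G.
  have mU : measurable (\bigcup_(j in [set j | rat_box j `<=` U]) rat_box j : set D).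
    rewrite bigcup_mkcond; apply: countable_bigcupT_measurable => // j.
    case: ifP => // _; rewrite rat_boxE.
    apply: fin_bigcap_measurable; first exact: finite_finset.
    by move=> i _; apply: measurableI; [apply: measurableC; exact: GE|exact: GE].
  exact: mU.
have low2 : lower_box (fun=> 2) = setT.
  by apply/seteqP; split => x // _ i; have /andP[? ?] := coord01 i x; lra.
have G2 : G (lower_box (fun=> 2)) by exists (fun=> 2) => //= i; lra.
have E A : measurable A -> pos_part mu A = neg_part mu A.
  apply: (measure_unique G (fun=> lower_box (fun=> 2))) => //.
  - move=> _ _ [a ha <-] [b hb <-]; exists (fun i => Num.min (a i) (b i)).
      by move=> i; rewrite le_min ge_min; have := ha i; have := hb i; lra.
    apply/seteqP; split => x /=.
      by move=> hx; split => i; have := hx i; rewrite lt_min => /andP[].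
    by move=> [h1 h2] i; rewrite lt_min h1 h2.
  - by apply/seteqP; split => // x _; exists 0%N => //; rewrite low2.
  - move=> _ [a ha <-]; have := congr1 EFin (h a ha).
    rewrite signed_measureE; last exact: measurable_lower_box.
    rewrite pos_partE; last exact: measurable_lower_box.
    rewrite neg_partE; last exact: measurable_lower_box.
    by move=> [] e; congr EFin; lra.
  - by move=> _; rewrite low2 pos_part_fin.
apply: eq_signed_measure => A mA; apply: EFin_inj; rewrite signed_measureE// E// subee// neg_partE//.
Qed.

(** The measures [discrete_measure b] with [b] summable: on them [point_mass] inverts
    [discrete_measure], by [discrete_point_mass] and [point_mass_discrete]. In this form, closure
    under sums is a union of countable sets. *)
Definition countably_carried (mu : M) := exists2 C : set QD, countable C & carried (C : set B) mu.

Definition point_mass (mu : M) : QD -> R := fun x => mu [set x].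

Lemma countably_carried0 : countably_carried 0.
Proof. by exists set0; [exact: countable0|exact: carried0]. Qed.

Lemma countably_carriedD mu nu : countably_carried mu -> countably_carried nu -> countably_carried (mu + nu).
Proof.
move=> [C cC hC] [D cD hD]; exists (C `|` D).
  by rewrite -bigcup2E; apply: bigcup_countable => // -[|[|i]] _ //=; exact: countable0.
by apply: carriedD; [apply: carriedS hC|apply: carriedS hD]; [left|right].
Qed.

Lemma countably_carriedZ c mu : countably_carried mu -> countably_carried (c *: mu).
Proof. by move=> [C cC hC]; exists C => //; exact: carriedZ. Qed.

Lemma countably_carried_sum (I : Type) (s : seq I) (P : pred I) (c : I -> R) (mu : I -> M) :
  (forall i, countably_carried (mu i)) -> countably_carried (\sum_(i <- s | P i) c i *: mu i).
Proof.
move=> h; elim/big_ind : _ => [||i _]; [exact: countably_carried0|exact: countably_carriedD|exact: countably_carriedZ].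
Qed.

Lemma countably_carried_dirac x : countably_carried (signed_dirac R (x : B)).
Proof. by exists [set x]; [exact: countable1|exact: carried_dirac]. Qed.

Lemma measurable_countable (C : set QD) : countable C -> measurable (C : set B).
Proof. by move=> cC; apply: (@countable_measurable _ B C) => // x; exact: measurable_set1Qd. Qed.

Lemma integral_countable (m : {measure set B -> \bar R}) (C : set QD) (f : QD -> R) :
  countable C -> m (~` C) = 0%E -> measurable_fun setT (f : B -> R) ->
  (forall x, 0 <= f x) ->
  (\int[m]_x (f x)%:E)%E = (\esum_(x in [set: QD]) ((f x)%:E * m [set x]))%E.
Proof.
move=> cC mC0 mf f0; have mC := measurable_countable cC.
have mEf : measurable_fun setT (fun x : B => (f x)%:E) by exact/measurable_EFinP.
have nn x : (0 <= (f x)%:E)%E by rewrite lee_fin.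
rewrite (@ge0_negligible_integral _ _ _ m setT (~` C))//; last exact: measurableC.
rewrite setDE setCK setTI.
have /countable_injP[g ig] := cC.
(* [F n] has at most one point, since [g] is injective on [C]. *)
pose F n := C `&` g @^-1` [set n].
have mF n : measurable (F n : set B).
  by apply: measurable_countable; apply: sub_countable cC; apply: subset_card_le; exact: subIsetl.
have tF : trivIset setT F.
  by move=> i j _ _ [x [[_ /= <-] [_ /= <-]]].
have CF : C = \bigcup_n F n.
  apply/seteqP; split => [x Cx|x [n _ []]//].
  by exists (g x).
rewrite {1}CF ge0_integral_bigcup//; last by rewrite -CF; exact: measurable_funTS.
transitivity (\esum_(x in C) ((f x)%:E * m [set x]))%E; last first.
  rewrite esum_mkcond; apply: eq_esum => x _; case: ifPn => // /negP xC.
  rewrite (_ : m [set x] = 0%E) ?mule0//; apply/eqP.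
  rewrite -measure_le0 -mC0; apply: le_measure; rewrite ?inE//.
  - exact: measurable_set1Qd.
  - exact: measurableC.
  - by move=> y -> Cx; apply: xC; rewrite inE.
rewrite {1}CF nneseries_sum_bigcup//; last by move=> x; rewrite mule_ge0.
apply: eq_eseriesr => n _.
have [->|/set0P[x Fx]] := eqVneq (F n) set0.
  by rewrite integral_set0 esum_set0.
have -> : F n = [set x].
  apply/seteqP; split => [y [Cy gy]|y ->//].
  case: Fx => Cx gx; apply: ig; rewrite ?inE//.
  by rewrite gx.
rewrite esum_set1 ?mule_ge0//.
rewrite (@eq_integral _ _ _ m _ (cst (f x)%:E)); last by move=> y; rewrite inE => ->.
by rewrite integral_cst//; exact: measurable_set1Qd.
Qed.

(** The positive and negative parts [f^+] and [f^-] taken by [rsum] are not [g] and [h], which may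
    overlap; but [f^+ + h = f^- + g] pointwise, and all four sums are finite. *)
Lemma rsum_diff (g h : QD -> R) : (forall x, 0 <= g x) -> (forall x, 0 <= h x) ->
  (\esum_(x in [set: QD]) (g x)%:E < +oo)%E -> (\esum_(x in [set: QD]) (h x)%:E < +oo)%E ->
  rsum setT (fun x => g x - h x) =
  fine (\esum_(x in [set: QD]) (g x)%:E) - fine (\esum_(x in [set: QD]) (h x)%:E).
Proof.
move=> g0 h0 gfin hfin; rewrite /rsum.
set f := EFin \o _.
have lep x : (f^\+ x <= (g x)%:E)%E.
  by rewrite funeposE /f /= -EFin_max lee_fin ge_max; have := g0 x; have := h0 x; lra.
have len x : (f^\- x <= (h x)%:E)%E.
  by rewrite funenegE /f /= -EFin_max lee_fin ge_max; have := g0 x; have := h0 x; lra.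
have pf : (\esum_(x in [set: QD]) f^\+ x)%E \is a fin_num.
  rewrite ge0_fin_numE; last by apply: esum_ge0.
  by apply: le_lt_trans gfin; apply: le_esum.
have nf : (\esum_(x in [set: QD]) f^\- x)%E \is a fin_num.
  rewrite ge0_fin_numE; last by apply: esum_ge0.
  by apply: le_lt_trans hfin; apply: le_esum.
have E : (\esum_(x in [set: QD]) f^\+ x + \esum_(x in [set: QD]) (h x)%:E =
          \esum_(x in [set: QD]) f^\- x + \esum_(x in [set: QD]) (g x)%:E)%E.
  rewrite -!esumD//; try by move=> *; rewrite ?lee_fin.
  apply: eq_esum => x _; rewrite funeposE funenegE /f /= -!EFin_max -!EFinD.
  congr EFin; rewrite /Num.max; case: ifP; case: ifP; lra.
have gf : (\esum_(x in [set: QD]) (g x)%:E)%E \is a fin_num.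
  by rewrite ge0_fin_numE//; apply: esum_ge0 => x _; rewrite lee_fin.
have hf : (\esum_(x in [set: QD]) (h x)%:E)%E \is a fin_num.
  by rewrite ge0_fin_numE//; apply: esum_ge0 => x _; rewrite lee_fin.
move/(congr1 fine) : E; rewrite fineB// !fineD//; lra.
Qed.

Lemma rsum_mkcond (A : set QD) (b : QD -> R) :
  rsum A b = rsum setT (fun x => \1_A x * b x).
Proof.
rewrite /rsum; congr (fine (_ - _)); rewrite esum_mkcond; apply: eq_esum => x _;
  rewrite ?(funeposE, funenegE) /= indicE; case: ifPn => xA;
  by rewrite ?mul1r// mul0r ?oppr0 maxxx.
Qed.

(** Only finitely many terms reach [1 / (n + 1)]: more than [K] of them would push the sum above its
    bound [K / (n + 1)]. *)
Lemma countable_esum (a : QD -> \bar R) : (forall x, 0 <= a x)%E ->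
  (\esum_(x in [set: QD]) a x < +oo)%E -> countable [set x | a x != 0%E].
Proof.
move=> a0 afin.
have fS n : finite_set [set x | (n.+1%:R^-1%:E <= a x)%E].
  apply: contrapT => infS.
  have [K hK] : exists K : nat, (\esum_(x in [set: QD]) a x <= (K%:R / n.+1%:R)%:E)%E.
    have : \esum_(x in [set: QD]) a x \is a fin_num.
      by rewrite ge0_fin_numE//; exact: esum_ge0.
    move=> /fineK <-; set e := fine _.
    exists (Num.bound (e * n.+1%:R)); rewrite lee_fin ler_pdivlMr//.
    by apply/ltW; apply: archi_boundP; rewrite mulr_ge0//; apply: fine_ge0; exact: esum_ge0.
  have [X XS Xn] := infinite_set_fset K.+1 infS.
  have : (\sum_(x \in [set` X]) a x <= (K%:R / n.+1%:R)%:E)%E.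
    by apply: le_trans hK; apply: esum_ge; exists [set` X].
  apply/negP; rewrite -ltNge.
  apply: (@lt_le_trans _ _ (\sum_(x \in [set` X]) n.+1%:R^-1%:E)%E); last first.
    by apply: lee_fsum => // x xX; exact: XS.
  rewrite fsbig_finite// set_fsetK sumEFin big_const_seq count_predT iter_addr addr0.
  rewrite lte_fin -(mulr_natl _ (size _)) ltr_pM2r ?invr_gt0// ltr_nat.
  exact: Xn.
apply: (@sub_countable _ _ _ (\bigcup_n [set x | (n.+1%:R^-1%:E <= a x)%E])); last first.
  by apply: bigcup_countable => // n _; exact: finite_set_countable.
apply: subset_card_le => x /= ax0.
have : (0 < a x)%E by rewrite lt_neqAle eq_sym ax0 a0.
case E : (a x) => [r| |] //= r0; last by exists 0%N => //=; rewrite E leey.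
exists (Num.bound r^-1) => //=; rewrite E lee_fin -[leRHS]invrK lef_pV2 ?posrE ?invr_gt0//.
apply/ltW; apply: (lt_trans (archi_boundP _)); first by rewrite invr_ge0 ltW.
by rewrite ltr_nat.
Qed.

Definition variation_mass (mu : M) (x : QD) : R := fine (variation_measure mu [set x]).

Lemma variation_massE (mu : M) x : variation_mass mu x = `|point_mass mu x|.
Proof.
have m1 := measurable_set1Qd x.
have [_ _ U I] := hahnP mu.
rewrite /variation_mass /point_mass variation_measureE -/(pos_part mu) -/(neg_part mu) pos_partE// neg_partE// -EFinD /=.
have [xP|xP] := pselect (hahn_pos mu x).
  have xN : ~ hahn_neg mu x.
    by move=> xN; have : (hahn_pos mu `&` hahn_neg mu) x by []; rewrite I.
  have -> : [set x] `&` hahn_neg mu = set0 by apply/seteqP; split => // y /= [->].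
  have -> : [set x] `&` hahn_pos mu = [set x] by apply/seteqP; split => [y []|y ->].
  rewrite signed_measure_set0 oppr0 addr0 ger0_norm// -lee_fin.
  have [[_ +] _ _ _] := hahnP mu; apply => //; by move=> y ->.
have xN : hahn_neg mu x.
  by have [] : (hahn_pos mu `|` hahn_neg mu) x by rewrite U.
have -> : [set x] `&` hahn_pos mu = set0 by apply/seteqP; split => // y /= [->].
have -> : [set x] `&` hahn_neg mu = [set x] by apply/seteqP; split => [y []|y ->].
rewrite signed_measure_set0 add0r ler0_norm// -lee_fin.
have [_ [_ +] _ _] := hahnP mu; apply => //; by move=> y ->.
Qed.

Section cc_measure.
Variables (mu : M) (ccmu : countably_carried mu).

Lemma countably_carried_parts : exists C : set QD, [/\ countable C, pos_part mu (~` C) = 0%E & neg_part mu (~` C) = 0%E].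
Proof.
have [C cC hC] := ccmu; have mC := measurable_countable cC.
by exists C; split => //; [exact: pos_part_carried|exact: neg_part_carried].
Qed.

(** With [f] nonnegative, the integral for each Jordan part is a sum of terms of one sign, and
    [rsum_diff] recombines the two. Monomials on the unit cube and indicators are of this kind. *)
Lemma rsum_point_mass (f : QD -> R) : bounded_mfun (f : B -> R) -> (forall x, 0 <= f x) ->
  rsum setT (fun x => f x * point_mass mu x) = signed_integral mu (f : B -> R).
Proof.
move=> bf f0; have [mf _] := bf.
have [C [cC p0 n0]] := countably_carried_parts.
have fp x : pos_part mu [set x] \is a fin_num by rewrite pos_partE//; exact: measurable_set1Qd.
have fn x : neg_part mu [set x] \is a fin_num by rewrite neg_partE//; exact: measurable_set1Qd.
have Ep : (\int[pos_part mu]_x (f x)%:E = \esum_(x in [set: QD]) (f x * fine (pos_part mu [set x]))%:E)%E.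
  rewrite (integral_countable cC p0 mf f0); apply: eq_esum => x _.
  by rewrite EFinM fineK.
have En : (\int[neg_part mu]_x (f x)%:E = \esum_(x in [set: QD]) (f x * fine (neg_part mu [set x]))%:E)%E.
  rewrite (integral_countable cC n0 mf f0); apply: eq_esum => x _.
  by rewrite EFinM fineK.
rewrite signed_integralE /Rintegral Ep En -rsum_diff.
- congr (rsum _ _); apply/funext => x; rewrite -mulrBr; congr (_ * _).
  rewrite /point_mass; apply: EFin_inj; rewrite signed_measureE; last exact: measurable_set1Qd.
  by rewrite EFinB !fineK.
- by move=> x; rewrite mulr_ge0// fine_ge0.
- by move=> x; rewrite mulr_ge0// fine_ge0.
- by rewrite -Ep -Rintegral_fin// ?ltry//; exact: pos_part_fin.
- by rewrite -En -Rintegral_fin// ?ltry//; exact: neg_part_fin.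
Qed.

Lemma esum_variation_mass : (\esum_(x in [set: QD]) (variation_mass mu x)%:E)%E = (tv_norm mu)%:E.
Proof.
have [C [cC p0 n0]] := countably_carried_parts.
rewrite tv_norm_variation.
have := @integral_countable (charge_variation (hahnP mu)) C (fun=> 1) cC.
move=> h; transitivity (\int[charge_variation (hahnP mu)]_x (1:R)%:E)%E; last first.
  by rewrite integral_cst// mul1e.
rewrite h//; last by rewrite [LHS]variation_measureE -/(pos_part mu) -/(neg_part mu) p0 n0 adde0.
apply: eq_esum => x _; rewrite mul1e /variation_mass fineK//.
have m1 := measurable_set1Qd x.
by rewrite variation_measureE -/(pos_part mu) -/(neg_part mu) pos_partE// neg_partE.
Qed.

Lemma summable_point_mass : summable setT (EFin \o point_mass mu).
Proof.
rewrite /summable; under eq_esum do rewrite /= -variation_massE.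
by rewrite esum_variation_mass ltry.
Qed.

Lemma rsum_point_mass_norm : rsum setT (fun x => `|point_mass mu x|) = tv_norm mu.
Proof.
transitivity (rsum setT (fun x => variation_mass mu x - (fun=> 0) x)).
  by congr (rsum _ _); apply/funext => x; rewrite subr0 variation_massE.
rewrite rsum_diff//.
- by rewrite esum_variation_mass [X in _ - fine X]esum1//= subr0.
- by move=> x; rewrite variation_massE.
- by rewrite esum_variation_mass ltry.
- by rewrite esum1// ltry.
Qed.

Lemma rsum_point_mass_set (A : set QD) : measurable (A : set B) ->
  rsum A (point_mass mu) = mu A.
Proof.
move=> mA; rewrite rsum_mkcond rsum_point_mass.
- exact: signed_integral_indic.
- exact: bounded_mfun_indic.
- by move=> x; rewrite indicE.
Qed.

Lemma discrete_point_mass : discrete_measure (point_mass mu) = mu.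
Proof.
by apply: eq_signed_measure => A mA; rewrite discrete_measureE// ?rsum_point_mass_set//; exact: summable_point_mass.
Qed.

End cc_measure.

Section discrete.
Variables (b : QD -> R) (sb : summable setT (EFin \o b)).

Lemma rsum_set1 x : rsum [set x] b = b x.
Proof.
rewrite /rsum !esum_set1// funeposE funenegE /= -!EFin_max -EFinB /=.
by rewrite /Num.max; case: ifP; case: ifP; lra.
Qed.

Lemma point_mass_discrete : point_mass (discrete_measure b) = b.
Proof.
apply/funext => x; rewrite /point_mass discrete_measureE//; last exact: measurable_set1Qd.
exact: rsum_set1.
Qed.

Lemma rsum_eq0 (A : set QD) : (forall x, A x -> b x = 0) -> rsum A b = 0.
Proof.
move=> h; rewrite /rsum !esum1 ?subee//.
- by move=> x Ax; rewrite funenegE /= h// oppr0 maxxx.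
- by move=> x Ax; rewrite funeposE /= h// maxxx.
Qed.

Lemma carried_discrete (C : set QD) : (forall x, b x != 0 -> C x) ->
  carried (C : set B) (discrete_measure b).
Proof.
move=> h A mA AC; rewrite discrete_measureE//; apply: rsum_eq0 => x Ax.
apply: contrapT => /eqP/h Cx.
by have : (A `&` C) x by []; rewrite AC.
Qed.

Lemma countable_supp : countable [set x | b x != 0].
Proof.
have := @countable_esum (fun x => `|(b x)%:E|%E) (fun x => abse_ge0 _) sb.
rewrite (_ : [set x | `|(b x)%:E|%E != 0%E] = [set x | b x != 0])//.
by apply/seteqP; split => x /=; rewrite eqe normr_eq0.
Qed.

Lemma countably_carried_discrete : countably_carried (discrete_measure b).
Proof.
exists [set x | b x != 0]; first exact: countable_supp.
exact: carried_discrete.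
Qed.

End discrete.

(** Checked on point masses, where linearity is immediate; a computation with [rsum] would have to
    compare positive and negative parts again. *)
Lemma discrete_measureP (a : R) (b b' : QD -> R) :
  summable setT (EFin \o b) -> summable setT (EFin \o b') ->
  discrete_measure (a *: b + b') = a *: discrete_measure b + discrete_measure b'.
Proof.
move=> sb sb'; set nu := RHS.
have cnu : countably_carried nu by apply: countably_carriedD; [apply: countably_carriedZ|]; exact: countably_carried_discrete.
rewrite -(discrete_point_mass cnu); congr discrete_measure.
apply/funext => x; rewrite /point_mass signed_measureD signed_measureZ.
rewrite -[X in a * X]/(point_mass _ x) -[X in _ = _ + X]/(point_mass _ x).
by rewrite !point_mass_discrete.
Qed.

End borel_cube.

(** * Lagrange interpolation and atoms *)

Lemma lagrange_1d (R : realType) (k : nat) : (0 < k)%N ->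
  exists (t : nat -> R) (l : 'I_k -> {poly R}) (K : R),
    [/\ 0 <= K, (forall j : 'I_k, 0 <= t j <= 1),
     (forall (p : {poly R}) x, (size p <= k)%N -> p.[x] = \sum_(j : 'I_k) p.[t j] * (l j).[x])
    & (forall j x, 0 <= x <= 1 -> `|(l j).[x]| <= K)].
Proof.
move=> k0; pose t (j : nat) : R := j%:R / k%:R.
have kR : (0 : R) < k%:R by rewrite ltr0n.
have tinj : injective t.
  by move=> i j /(mulIf (invr_neq0 (lt0r_neq0 kR)))/eqP; rewrite eqr_nat => /eqP.
pose l (j : 'I_k) : {poly R} := (qpoly.lagrange k t)`_j.
have lb j : exists K, forall x, 0 <= x <= 1 -> `|(l j).[x]| <= K.
  by have [K h] := poly_itv_bound (l j) 0 1; exists K.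
(* The sum over the nodes serves as a common bound for all basis polynomials. *)
exists t, l, (\sum_j `|sval (cid (lb j))|); split.
- by apply: sumr_ge0.
- by move=> j; rewrite divr_ge0//= ler_pdivrMr// mul1r ler_nat ltnW.
- move=> p x sp; rewrite {1}(qpoly.lagrange_gen k0 tinj sp) horner_sum.
  by apply: eq_bigr => j _; rewrite hornerM hornerC /l qpoly.nth_lagrange.
- move=> j x x01; rewrite (bigD1 j)//=.
  rewrite (@le_trans _ _ `|sval (cid (lb j))|)//.
    by case: cid => K /= h; rewrite (le_trans (h x x01))// ler_norm.
  by rewrite lerDl sumr_ge0.
Qed.

Lemma itv01_div (R : realType) (x y r : R) : 0 < r -> x <= y <= x + r ->
  0 <= (y - x) / r <= 1.
Proof.
move=> r0 /andP[? ?]; rewrite ler_pdivrMr// mul1r lerBlDl.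
by rewrite divr_ge0 ?subr_ge0//=; apply: ltW.
Qed.

Section atoms.
Context (R : realType) (d k : nat).
Hypothesis d_gt0 : (0 < d)%N.
Hypothesis k_gt0 : (0 < k)%N.
Local Notation B := (borelQd R d).
Local Notation QD := (Qd R d).
Local Notation M := (signed_measure B R).
Implicit Types (mu nu : M) (a : 'I_d -> R) (r : R).

Definition box a r : set 'rV[R]_d := [set z | forall i, a i <= z ord0 i <= a i + r].
Definition Qd_box a r : set QD := [set x | forall i, a i <= cube_coord i x <= a i + r].
Definition subbox a r := 0 < r /\ forall i, 0 <= a i /\ a i + r <= 1.

Lemma subbox_le1 a r : subbox a r -> r <= 1.
Proof. by move=> [r0 /(_ (Ordinal d_gt0))[]]; lra. Qed.

Lemma cube_inP (Q : set 'rV[R]_d) :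
  cube_in Q <-> exists a r, subbox a r /\ Q = box a r.
Proof.
split=> [[[x [r [r0 ->]]] sub]|[a [r [[r0 ar] ->]]]].
  have E : [set x + r *: y | y in unit_cube R d] = box (fun i => x ord0 i) r.
    apply/seteqP; split => [_ [y hy <-] i|z hz].
      by rewrite !mxE; have /andP[? ?] := hy i; nra.
    exists (\row_i ((z ord0 i - x ord0 i) / r)).
      by move=> i; rewrite mxE; apply: itv01_div => //; exact: hz.
    by apply/rowP => i; rewrite !mxE mulrC divfK ?lt0r_neq0//; lra.
  exists (fun i => x ord0 i), r; split => //; split => // i.
  (* The two extreme corners of the cube lie in the unit cube, which bounds the corner from below
     and the corner plus [r] from above. *)
  have h1 : box (fun i => x ord0 i) r x by move=> j; lra.
  have h2 : box (fun i => x ord0 i) r (x + r *: const_mx 1).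
    by move=> j; rewrite !mxE; lra.
  rewrite -E in h1 h2.
  have := sub _ h1 i; have := sub _ h2 i; rewrite !mxE; lra.
split.
  exists (\row_i a i), r; split => //.
  apply/seteqP; split => [z hz|_ [y hy <-] i].
    exists (\row_i ((z ord0 i - a i) / r)).
      by move=> i; rewrite mxE; apply: itv01_div => //; exact: hz.
    by apply/rowP => i; rewrite !mxE mulrC divfK ?lt0r_neq0//; lra.
  by rewrite !mxE; have /andP[? ?] := hy i; nra.
by move=> z hz i; have := hz i; have := ar i; lra.
Qed.

Lemma cube_in_box a r : subbox a r -> cube_in (box a r).
Proof. by move=> h; apply/cube_inP; exists a, r. Qed.

Lemma Qd_boxE a r : Qd_box a r = \bigcap_(i in [set: 'I_d]) (cube_coord i @^-1` `[a i, a i + r]).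
Proof.
apply/seteqP; split => x h i => [_|]; rewrite /= ?in_itv /=; first exact: h.
by have := h i I; rewrite /= in_itv.
Qed.

Lemma closed_Qd_box a r : closed (Qd_box a r).
Proof.
rewrite Qd_boxE; apply: closed_bigI => i _; apply: preimage_closed.
  by move=> x _; exact: coord_cont.
exact: interval_closed.
Qed.

Lemma measurable_Qd_box a r : measurable (Qd_box a r : set B).
Proof.
rewrite -[Qd_box a r]setCK; apply: measurableC; apply: open_measurableQd.
by apply: closed_openC; exact: closed_Qd_box.
Qed.

Definition vanishing mu := forall al : 'I_d -> nat, (\sum_i al i < k)%N ->
  signed_integral mu (monomial al : B -> R) = 0.

Lemma vanishingD mu nu : vanishing mu -> vanishing nu -> vanishing (mu + nu).
Proof.
by move=> h1 h2 al hal; rewrite signed_integralD ?h1 ?h2 ?addr0//; exact: bounded_mfun_monomial.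
Qed.

Lemma vanishingZ c mu : vanishing mu -> vanishing (c *: mu).
Proof.
by move=> h al hal; rewrite signed_integralZ ?h ?mulr0//; exact: bounded_mfun_monomial.
Qed.

Lemma vanishing0 : vanishing 0.
Proof. by move=> al _; rewrite signed_integral0//; exact: bounded_mfun_monomial. Qed.

Lemma vanishing_sum (I : Type) (s : seq I) (P : pred I) (c : I -> R) (mu : I -> M) :
  (forall i, vanishing (mu i)) -> vanishing (\sum_(i <- s | P i) c i *: mu i).
Proof.
by move=> h; elim/big_ind : _ => [||i _]; [exact: vanishing0|exact: vanishingD|exact: vanishingZ].
Qed.

Lemma matomP a r mu : subbox a r ->
  matom k (box a r) mu <-> [/\ carried (Qd_box a r : set B) mu, tv_norm mu <= 1 & vanishing mu].
Proof.
move=> ar; split=> [[_ h1 h2 h3]|[h1 h2 h3]]; split => //.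
- exact: carried_msupport.
- exact: cube_in_box.
- exact: (msupport_carried (@closed_Qd_box a r) h1).
Qed.

Lemma matom_cube Q mu : matom k Q mu -> exists a r, subbox a r /\ Q = box a r.
Proof. by move=> [/cube_inP]. Qed.

Lemma fatom_point_mass Q mu : countably_carried mu -> matom k Q mu -> fatom k Q (point_mass mu).
Proof.
move=> cmu mQ; have [a [r [ar E]]] := matom_cube mQ.
move: mQ; rewrite E => mQ; have [h1 h2 h3] := (matomP _ ar).1 mQ; split.
- exact: cube_in_box.
- exact: summable_point_mass.
- move=> x nx; apply: contrapT => nQ; move/negP : nx; apply.
  apply/eqP; apply: (h1 [set x] (measurable_set1Qd x)).
  by apply/seteqP; split => // y /= [->].
- by rewrite rsum_point_mass_norm.
- move=> al hal; rewrite rsum_point_mass ?h3//; first exact: bounded_mfun_monomial.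
  exact: monomial_ge0.
Qed.

Lemma matom_discrete Q (b : QD -> R) : fatom k Q b -> matom k Q (discrete_measure b).
Proof.
move=> [Qc sb suppb nb vb]; have [a [r [ar E]]] := (cube_inP Q).1 Qc.
rewrite E in suppb *; apply/(matomP _ ar); split.
- exact: carried_discrete.
- by rewrite -(rsum_point_mass_norm (countably_carried_discrete sb)) point_mass_discrete.
- move=> al hal; rewrite -(rsum_point_mass (countably_carried_discrete sb)) ?point_mass_discrete ?vb//.
  + exact: bounded_mfun_monomial.
  + exact: monomial_ge0.
Qed.

(** The bound is asked for on the cube only, as the basis polynomials grow outside; monomials are
    reproduced everywhere, so that moments are preserved also for measures not carried by the
    cube. *)
Definition interpolates (K : R) (a : 'I_d -> R) (r : R)
    (L : {ffun 'I_d -> 'I_k} -> QD -> R) (pt : {ffun 'I_d -> 'I_k} -> QD) :=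
  [/\ (forall j, bounded_mfun (L j : B -> R)),
      (forall j x, Qd_box a r x -> `|L j x| <= K),
      (forall j, Qd_box a r (pt j)) &
      (forall al : 'I_d -> nat, (\sum_i al i < k)%N -> forall x,
         monomial al x = \sum_j monomial al (pt j) * L j x)].

(* Tensor products of the one-dimensional interpolation scheme, rescaled; the
   point is that [K] depends only on [d] and [k]. *)
Lemma lagrange_box : exists2 K : R, 0 <= K & forall a r, subbox a r ->
  exists L pt, interpolates K a r L pt.
Proof.
have [t [l [K [K0 t01 lag lb]]]] := lagrange_1d R k_gt0.
exists (K ^+ d); first exact: exprn_ge0.
move=> a r ar; have [r0 ha] := ar.
exists (fun j x => \prod_i (l (j i)).[(cube_coord i x - a i) / r]).
have hpt (j : {ffun 'I_d -> 'I_k}) : exists x : QD, forall i, cube_coord i x = a i + r * t (j i).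
  apply: exists_Qd => i; have := t01 (j i); have := ha i; nra.
exists (fun j => sval (cid (hpt j))); split.
- move=> j; apply: bounded_mfun_prod => i; move: (l (j i)) => p.
  have bc : bounded_mfun ((fun x => (cube_coord i x - a i) / r) : B -> R).
    apply: (@bounded_mfunM _ _ _ (fun x : B => cube_coord i x - a i) (fun=> r^-1)); last exact: bounded_mfun_cst.
    by apply: bounded_mfunB; [exact: bounded_mfun_coord|exact: bounded_mfun_cst].
  elim/poly_ind : p => [|p c ih].
    by under eq_fun do rewrite horner0; exact: bounded_mfun_cst.
  under eq_fun do rewrite hornerMXaddC.
  by apply: bounded_mfunD; [exact: bounded_mfunM|exact: bounded_mfun_cst].
- move=> j x hx; rewrite normr_prod -[X in _ <= K ^+ X]card_ord -prodr_const.
  apply: ler_prod => i _; rewrite normr_ge0 /=; apply: lb.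
  by apply: itv01_div => //; exact: hx.
- move=> j i; case: cid => x /= ->; have := t01 (j i); nra.
- move=> al hal x.
  rewrite /monomial.
  pose F i (j : 'I_k) := (a i + r * t j) ^+ al i * (l j).[(cube_coord i x - a i) / r].
  transitivity (\prod_i \sum_(j : 'I_k) F i j).
    apply: eq_bigr => i _; rewrite /F.
    (* In the rescaled variable this factor is a polynomial of degree at most [al i], which is below
       [k] because the total degree is. *)
    pose p : {poly R} := ((a i)%:P + r *: 'X) ^+ al i.
    have pE y : p.[y] = (a i + r * y) ^+ al i.
      by rewrite /p horner_exp hornerD hornerC hornerZ hornerX.
    rewrite -[LHS]/((cube_coord i x) ^+ al i).
    rewrite (_ : cube_coord i x ^+ al i = p.[(cube_coord i x - a i) / r]); last first.
      by rewrite pE [r * _]mulrC divfK ?lt0r_neq0// addrC subrK.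
    rewrite lag; first by apply: eq_bigr => j _; rewrite pE.
    have hi : (al i < k)%N by apply: leq_ltn_trans hal; rewrite (bigD1 i)//= leq_addr.
    apply: leq_trans hi.
    have s2 : (size ((a i)%:P + r *: 'X)%R <= 2)%N.
      by rewrite (leq_trans (size_polyD _ _))// geq_max (leq_trans (size_polyC_leq1 _))//
        (leq_trans (size_scale_leq _ _))// size_polyX.
    rewrite /p; elim: (al i) => [|n ih]; first by rewrite expr0 size_poly1.
    rewrite exprS (leq_trans (size_polyMleq _ _))//.
    by move: ih s2; lia.
  (* Expanding the product of sums gives one term for each choice of a node in every coordinate. *)
  rewrite bigA_distr_bigA /=; apply: eq_bigr => j _.
  rewrite /F big_split /=; congr (_ * _); apply: eq_bigr => i _; case: cid => y /= hy.
  by rewrite -[RHS]/(cube_coord i y ^+ al i) hy.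
Qed.

(** The transpose of Lagrange interpolation: integrating a function against it amounts to
    integrating the interpolant of that function against [mu]. *)
Definition nodal_measure (L : {ffun 'I_d -> 'I_k} -> QD -> R) (pt : {ffun 'I_d -> 'I_k} -> QD) mu : M :=
  \sum_j signed_integral mu (L j : B -> R) *: signed_dirac R (pt j : B).

Section nodal_measure.
Variables (K : R) (a : 'I_d -> R) (r : R) (L : {ffun 'I_d -> 'I_k} -> QD -> R)
  (pt : {ffun 'I_d -> 'I_k} -> QD).
Hypothesis h : interpolates K a r L pt.

Lemma countably_carried_nodal mu : countably_carried (nodal_measure L pt mu).
Proof. by apply: countably_carried_sum => j; exact: countably_carried_dirac. Qed.

Lemma carried_nodal mu : carried (Qd_box a r : set B) (nodal_measure L pt mu).
Proof.
have [_ _ hp _] := h.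
by apply: carried_sum => j; apply: carried_dirac; exact: hp.
Qed.

(** The integrals of the basis functions are kept, instead of the norm of [mu]: for the difference
    between a measure and its quantized image they are small, while the norm need not be. *)
Lemma tv_norm_nodal mu : tv_norm (nodal_measure L pt mu) <= \sum_j `|signed_integral mu (L j : B -> R)|.
Proof.
apply: le_trans (tv_norm_sum _ _ _ _) _; apply: ler_sum => j _.
by rewrite -[leRHS]mulr1 ler_wpM2l// tv_norm_dirac.
Qed.

Lemma signed_integral_nodal mu al : (\sum_i al i < k)%N ->
  signed_integral (nodal_measure L pt mu) (monomial al : B -> R) =
  signed_integral mu (monomial al : B -> R).
Proof.
have [bL _ _ hm] := h; move=> hal.
rewrite signed_integral_sum; last exact: bounded_mfun_monomial.
rewrite (_ : (monomial al : B -> R) = (fun x : B => \sum_j monomial al (pt j) * L j x)); last first.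
  by apply/funext => x; exact: hm.
rewrite signed_integral_sumr; last by move=> j; exact: bounded_mfunZ.
apply: eq_bigr => j _; rewrite signed_integralZr// mulrC; congr (_ * _).
rewrite signed_integral_dirac; last by apply: bounded_mfun_sum => i; exact: bounded_mfunZ.
by rewrite -hm.
Qed.

Lemma vanishing_nodal mu : vanishing (mu - nodal_measure L pt mu).
Proof.
move=> al hal; have bm := bounded_mfun_monomial R al.
by rewrite signed_integralD// signed_integralN// signed_integral_nodal// subrr.
Qed.

Lemma tv_norm_nodal_box mu : 0 <= K -> carried (Qd_box a r : set B) mu ->
  tv_norm (nodal_measure L pt mu) <= (#|{ffun 'I_d -> 'I_k}|%:R * K) * tv_norm mu.
Proof.
move=> K0 cm; apply: le_trans (tv_norm_nodal _) _.
rewrite -mulrA mulr_natl -sumr_const; apply: ler_sum => j _.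
have [bL hK _ _] := h.
by apply: (signed_integral_carried_le (measurable_Qd_box a r)) => //; exact: hK.
Qed.

End nodal_measure.

End atoms.

(** * Isometry *)

Section quantizer.
Context (R : realType) (d : nat).
Local Notation B := (borelQd R d).
Local Notation QD := (Qd R d).
Local Notation M := (signed_measure B R).

(* Off [D], [s x] is a fixed representative of the class of [x] for the
   countably many labels [floor (f i x / eta)]. *)
Lemma exists_quantization (J : finType) (f : J -> QD -> R) (eta : R) (D : set QD) :
  (forall i, measurable_fun setT (f i : B -> R)) -> 0 < eta -> countable D ->
  exists s : QD -> QD, [/\ measurable_fun setT (s : B -> B), countable (range s),
    (forall x, D x -> s x = x) & forall i x, `|f i (s x) - f i x| <= eta].
Proof.
move=> mf eta0 cD.
pose lab x : {ffun J -> int} := [ffun i => Num.floor (f i x / eta)].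
pose rep l : QD := xget point [set x | lab x = l].
have labrep x : lab (rep (lab x)) = lab x.
  by rewrite /rep; apply: (@xgetPex _ point [set y | lab y = lab x]); exists x.
pose s x : QD := if `[< D x >] then x else rep (lab x).
have mlab l : measurable (lab @^-1` [set l] : set B).
  have -> : lab @^-1` [set l] = \bigcap_(i in [set: J])
      (f i @^-1` `[(l i)%:~R * eta, (l i + 1)%:~R * eta[).
    apply/seteqP; split => x /=.
      move=> <- i _ /=; rewrite in_itv /= ffunE.
      by rewrite -ler_pdivlMr// floor_le -ltr_pdivrMr// floorD1_gt.
    move=> h; apply/ffunP => i; rewrite ffunE; apply: floor_def.
    have := h i I; rewrite /= in_itv /=.
    by rewrite -ler_pdivlMr// -ltr_pdivrMr//.
  apply: fin_bigcap_measurable; first exact: finite_finset.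
  by move=> i _; rewrite -[X in measurable X]setTI; apply: mf => //; exact: measurable_itv.
exists s; split.
- move=> _ A mA; rewrite setTI.
  have mD := measurable_countable cD.
  have -> : s @^-1` A = (D `&` A) `|` (~` D `&` \bigcup_(l in [set l | A (rep l)]) (lab @^-1` [set l])).
    apply/seteqP; split => x /=; rewrite /s; case: asboolP => Dx.
    + by left.
    + by move=> Ax; right; split => //; exists (lab x).
    + by case=> [[]|[]].
    + by case=> [[]|[_ [l /= Al El]]]; rewrite // El.
  apply: measurableU; first exact: measurableI.
  apply: measurableI; first exact: measurableC.
  rewrite bigcup_mkcond; apply: countable_bigcupT_measurable => // l.
  by case: ifP.
- apply: (@sub_countable _ _ _ (D `|` range rep)).
    apply: subset_card_le => _ [x _ <-]; rewrite /s; case: asboolP => Dx; [by left|].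
    by right; exists (lab x).
  have crep : countable (range rep).
    by apply: sub_countable (countableP [set: {ffun J -> int}]); exact: card_image_le.
  by rewrite -bigcup2E; apply: bigcup_countable => // -[|[|i]].
- by move=> x Dx; rewrite /s asboolT.
- move=> i x; rewrite /s; case: asboolP => Dx; first by rewrite subrr normr0 ltW.
  have /ffunP/(_ i) := labrep x; rewrite !ffunE => E.
  set y := rep _ in E *.
  have /andP[h1 h2] := floor_itv (f i x / eta).
  have /andP[h3 h4] := floor_itv (f i y / eta).
  rewrite E in h3 h4; rewrite intrD in h2 h4.
  rewrite ler_pdivlMr// in h1; rewrite ltr_pdivrMr// in h2.
  rewrite ler_pdivlMr// in h3; rewrite ltr_pdivrMr// in h4.
  rewrite ler_norml; apply/andP; split; lra.
Qed.

Lemma bounded_mfun_comp (f : QD -> R) (s : QD -> QD) : bounded_mfun (f : B -> R) ->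
  measurable_fun setT (s : B -> B) -> bounded_mfun (f \o s : B -> R).
Proof.
move=> [mf [K fK]] ms; split; first exact: measurableT_comp mf ms.
by exists K => x; exact: fK.
Qed.

Lemma push_measure_discrete (s : QD -> QD) (b : QD -> R) :
  measurable_fun setT (s : B -> B) -> summable setT (EFin \o b) ->
  (forall x, b x != 0 -> s x = x) ->
  push_measure (s : B -> B) (discrete_measure b) = discrete_measure b.
Proof.
move=> ms sb hs; apply: eq_signed_measure => A mA; rewrite push_measureE//.
have msA : measurable (s @^-1` A : set B) by rewrite -[X in measurable X]setTI; exact: ms.
rewrite !discrete_measureE// rsum_mkcond [RHS]rsum_mkcond; congr (rsum _ _).
apply/funext => x; have [->|bx] := eqVneq (b x) 0; first by rewrite !mulr0.
congr (_ * _); rewrite !indicE; congr (_%:R); congr nat_of_bool.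
by apply/idP/idP; rewrite !inE /= hs.
Qed.

Lemma countably_carried_push (s : QD -> QD) (mu : M) : measurable_fun setT (s : B -> B) ->
  countable (range s) -> countably_carried (push_measure (s : B -> B) mu).
Proof.
move=> ms cs; exists (range s) => // A mA AC; rewrite push_measureE//.
rewrite (_ : s @^-1` A = set0) ?signed_measure_set0//.
apply/seteqP; split => // x /= Asx.
have : (A `&` range s) (s x) by split => //; exists x.
by rewrite AC.
Qed.

Variable k : nat.
Hypothesis d_gt0 : (0 < d)%N.
Hypothesis k_gt0 : (0 < k)%N.

(* [nu t] is the image of [mu t] under a quantization [s], corrected by a nodal
   measure and normalised; as [s] fixes the support of [b], only the
   corrections contribute to [g].  Quantizing the indicators of the cubes with
   an error [< 1] makes [s] preserve them. *)
Lemma replace_atoms (T : finType) (c : T -> R) (a : T -> 'I_d -> R) (r : T -> R)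
    (mu : T -> M) (b : QD -> R) (eta : R) :
  (forall t, subbox (a t) (r t)) -> (forall t, carried (Qd_box (a t) (r t) : set B) (mu t)) ->
  (forall t, tv_norm (mu t) <= 1) -> (forall t, vanishing k (mu t)) ->
  summable setT (EFin \o b) -> discrete_measure b = \sum_t c t *: mu t -> 0 < eta ->
  exists (nu : T -> M) (g : M), [/\ (forall t, countably_carried (nu t)),
    (forall t, [/\ carried (Qd_box (a t) (r t) : set B) (nu t), tv_norm (nu t) <= 1 & vanishing k (nu t)]),
    [/\ countably_carried g, tv_norm g <= eta & vanishing k g] &
    discrete_measure b = \sum_t ((1 + eta) * c t) *: nu t + g].
Proof.
move=> ar cmu tmu vmu sb bE eta0.
have [K K0 hK] := lagrange_box R d_gt0 k_gt0.
have /choice[Lp hL] : forall t, exists Lp : ({ffun 'I_d -> 'I_k} -> QD -> R) * ({ffun 'I_d -> 'I_k} -> QD),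
    interpolates K (a t) (r t) Lp.1 Lp.2.
  by move=> t; have [L [pt h]] := hK _ _ (ar t); exists (L, pt).
pose N : R := #|{ffun 'I_d -> 'I_k}|%:R.
pose S := \sum_t `|c t|.
have S0 : 0 <= S by apply: sumr_ge0.
have N0 : 0 <= N by rewrite ler0n.
have NS0 : 0 < (1 + N) * (1 + S) by rewrite mulr_gt0//; lra.
(* The bound [1 / 2] makes the quantization respect indicators. The other one gives [N * e' <= eta],
   absorbed by the normalisation of the new atoms, and [N * e' * S <= eta], which bounds the norm of
   [g]. *)
pose e' := Num.min 2^-1 (eta / ((1 + N) * (1 + S))).
have e'0 : 0 < e' by rewrite lt_min divr_gt0// andbT; lra.
have e'1 : e' <= 2^-1 by rewrite ge_min lexx.
have e'2 : (1 + N) * (1 + S) * e' <= eta.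
  by rewrite mulrC -ler_pdivlMr// ge_min lexx orbT.
have NSe : N * e' * S <= eta by nra.
have Ne : N * e' <= eta by nra.
pose f (i : (T * {ffun 'I_d -> 'I_k}) + T) : QD -> R :=
  match i with inl (t, j) => (Lp t).1 j | inr t => \1_(Qd_box (a t) (r t)) end.
have mf i : measurable_fun setT (f i : B -> R).
  case: i => [[t j]|t] /=; last by apply: measurable_indic; exact: measurable_Qd_box.
  by have [h _ _ _] := hL t; exact: (h j).1.
have [s [ms cs sD sf]] := exists_quantization mf e'0 (countable_supp sb).
pose nu0 t := push_measure (s : B -> B) (mu t).
(* As the moments of [mu t] vanish, this has the moments of [nu0 t]. Subtracting [mu t] turns its
   coefficients into integrals of differences [L (s x) - L x], bounded by [e']. *)
pose e t := nodal_measure (Lp t).1 (Lp t).2 (nu0 t - mu t).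
have tve t : tv_norm (e t) <= N * e'.
  apply: le_trans (tv_norm_nodal _ _ _) _; rewrite /N mulr_natl -sumr_const.
  apply: ler_sum => j _; have [bL _ _ _] := hL t.
  have bLs : bounded_mfun ((Lp t).1 j \o s : B -> R) by exact: bounded_mfun_comp.
  rewrite signed_integralD// signed_integralN// signed_integral_push// -signed_integralBr//.
  have h := @signed_integral_le _ _ _ (mu t) (fun x : B => (Lp t).1 j (s x) - (Lp t).1 j x) e'.
  apply: le_trans (h _ _) _.
  - exact: bounded_mfunB.
  - by move=> x; exact: (sf (inl (t, j))).
  - by rewrite -[leRHS]mulr1 ler_wpM2l// ltW.
have i1 : 0 < 1 + eta by lra.
exists (fun t => (1 + eta)^-1 *: (nu0 t - e t)), (\sum_t c t *: e t).
have vnu t : vanishing k (nu0 t - e t).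
  rewrite (_ : nu0 t - e t = mu t + ((nu0 t - mu t) - e t)).
    by apply: vanishingD => //; exact: (vanishing_nodal (hL t)).
  by rewrite addrA (addrC (mu t)) subrK.
have bE' : discrete_measure b = \sum_t ((1 + eta) * c t) *: ((1 + eta)^-1 *: (nu0 t - e t)) + \sum_t c t *: e t.
  rewrite -(push_measure_discrete ms sb sD) bE push_measure_sum// -big_split /=.
  apply: eq_bigr => t _.
  by rewrite scalerA mulrAC mulfV ?lt0r_neq0// mul1r -scalerDr subrK.
split => //.
- move=> t; apply: countably_carriedZ; apply: countably_carriedD; first exact: countably_carried_push.
  by rewrite -scaleN1r; apply: countably_carriedZ; exact: countably_carried_nodal.
- move=> t; split.
  + apply: carriedZ; apply: carriedD.
      move=> A mA AC; rewrite push_measureE//; apply: cmu.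
        by rewrite -[X in measurable X]setTI; exact: ms.
      apply/seteqP; split => // x [/= Asx Qx].
      suff : (A `&` Qd_box (a t) (r t)) (s x) by rewrite AC.
      split => //; apply: contrapT => nQ.
      have := sf (inr t) x; rewrite /= !indicE memNset// mem_set//= sub0r normrN normr1.
      by move: e'1; lra.
    by rewrite -scaleN1r; apply: carriedZ; exact: (carried_nodal (hL t)).
  + apply: le_trans (ler_tv_normZ _ _) _.
    rewrite gtr0_norm ?invr_gt0// mulrC ler_pdivrMr// mul1r.
    apply: le_trans (ler_tv_normD _ _) _; apply: lerD.
      by apply: le_trans (tv_norm_push _ _) _.
    rewrite -scaleN1r; apply: le_trans (ler_tv_normZ _ _) _.
    by rewrite normrN normr1 mul1r (le_trans (tve t)).
  + exact: vanishingZ.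
- split.
  + by apply: countably_carried_sum => t; exact: countably_carried_nodal.
  + apply: le_trans (tv_norm_sum _ _ _ _) _; apply: le_trans NSe.
    rewrite mulr_sumr; apply: ler_sum => t _; rewrite mulrC.
    by rewrite ler_wpM2r.
  (* A single [e t] may have nonzero moments; those of the sum vanish because it is the difference
     of two combinations of measures with vanishing moments. *)
  + have -> : \sum_t c t *: e t = discrete_measure b +
       (-1) *: \sum_t ((1 + eta) * c t) *: ((1 + eta)^-1 *: (nu0 t - e t)).
      by rewrite {1}bE' scaleN1r addrC addrA addNr add0r.
    apply: vanishingD.
      by rewrite bE; exact: vanishing_sum.
    by apply: vanishingZ; apply: vanishing_sum => t; exact: vanishingZ.
Qed.

End quantizer.

(** * The l^p' norm *)

Section lq.
Context (R : realType) (p : R) (p_ge1 : 1 <= p).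
Local Notation q := (hoelder_conjugate p%:E).

Lemma hoelder_conjugate_cases : (p = 1 /\ q = +oo%E) \/
  exists r : R, [/\ 1 < p, 1 < r, q = r%:E & p^-1 + r^-1 = 1].
Proof.
have [->|p1] := eqVneq p 1; first by left; rewrite hoelder_conjugate1.
right; have p1' : 1 < p by rewrite lt_neqAle eq_sym p1.
have p0 : 0 < p by lra.
have pm : 0 < p - 1 by lra.
exists (p / (p - 1)); split => //.
- by rewrite ltr_pdivlMr// mul1r; lra.
- rewrite /hoelder_conjugate /= eqe gt_eqF//=.
  by rewrite -EFinB inver gt_eqF// -EFinM.
- by rewrite invf_div -[X in X + _]mul1r -mulrDl [1 + _]addrC subrK mulfV// gt_eqF.
Qed.

Lemma lqnorm_ge0 n (c : 'I_n -> R) : 0 <= lqnorm q c.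
Proof.
have [[_ ->]|[r [_ _ -> _]]] /= := hoelder_conjugate_cases; first by rewrite bigmax_idl le_max lexx.
exact: powR_ge0.
Qed.

Lemma lqnorm_scale n (t : R) (c : 'I_n -> R) : 0 <= t ->
  lqnorm q (fun i => t * c i) = t * lqnorm q c.
Proof.
move=> t0; have [[_ ->]|[r [_ r1 -> _]]] /= := hoelder_conjugate_cases.
  elim/big_ind2 : _ => [|x1 x2 y1 y2 -> ->|i _].
  - by rewrite mulr0.
  - by rewrite maxr_pMr.
  - by rewrite normrM (ger0_norm t0).
under eq_bigr do rewrite normrM powRM// (ger0_norm t0).
rewrite -mulr_sumr powRM; [|exact: powR_ge0|by apply: sumr_ge0 => i _; exact: powR_ge0].
by rewrite -powRrM mulfV ?powRr1// gt_eqF//; lra.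
Qed.

Lemma lqnorm1 (c : 'I_1 -> R) : lqnorm q c = `|c ord0|.
Proof.
have [[_ ->]|[r [_ r1 -> _]]] /= := hoelder_conjugate_cases; rewrite big_ord_recl big_ord0.
  by rewrite max_l.
rewrite addr0.
by rewrite -powRrM mulfV ?powRr1// gt_eqF//; lra.
Qed.

(* For finite exponents, [\sum_i c i `^ r <= m `^ (r - 1) * \sum_i c i]. *)
Lemma lqnorm_small (S e : R) : 0 <= S -> 0 < e -> exists2 m, 0 < m &
  forall n (c : 'I_n -> R), (forall i, 0 <= c i <= m) -> \sum_i c i <= S ->
  lqnorm q c <= e.
Proof.
move=> S0 e0; have [[_ ->]|[r [_ r1 -> _]]] /= := hoelder_conjugate_cases.
  exists e => // n c cm _; apply: bigmax_le => [|i _]; first exact: ltW.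
  by have /andP[? ?] := cm i; rewrite ger0_norm.
have r0 : 0 < r by lra.
have r10 : 0 < r - 1 by lra.
have S1 : 0 < 1 + S by lra.
have e1 : 0 < e `^ r / (1 + S) by rewrite divr_gt0// powR_gt0.
(* The solution of [m^(r - 1) * (1 + S) = e^r]; it is available because [r > 1], that is, because
   [p] is finite. *)
exists ((e `^ r / (1 + S)) `^ (r - 1)^-1); first exact: powR_gt0.
set m := _ `^ _ => n c cm cS.
have m0 : 0 < m by exact: powR_gt0.
have mE : m `^ (r - 1) = e `^ r / (1 + S).
  by rewrite -powRrM mulVf ?gt_eqF// powRr1// ltW.
rewrite -[leRHS](powRr1 (ltW e0)) -(mulfV (lt0r_neq0 r0)) powRrM.
apply: ge0_ler_powR; rewrite ?nnegrE ?invr_ge0 ?powR_ge0 ?(ltW r0)//.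
  by apply: sumr_ge0 => i _; exact: powR_ge0.
apply: (@le_trans _ _ (\sum_i m `^ (r - 1) * c i)).
  apply: ler_sum => i _; have /andP[c0 ci] := cm i.
  rewrite ger0_norm//.
  have [->|cn0] := eqVneq (c i) 0; first by rewrite powR0 ?gt_eqF// mulr0.
  have -> : c i `^ r = c i `^ (r - 1) * c i.
    by rewrite -[X in _ * X](powRr1 c0) -powRD ?subrK// cn0 implybT.
  rewrite ler_wpM2r//.
  by apply: ge0_ler_powR; rewrite ?nnegrE ?(ltW r10) ?(ltW m0).
rewrite -mulr_sumr mE mulrAC ler_pdivrMr// ler_wpM2l ?powR_ge0//; lra.
Qed.

(* Young's inequality after normalising [c]. *)
Lemma lqnorm_hoelder (S : R) : 0 <= S -> exists2 C, 0 <= C &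
  forall n (c x : 'I_n -> R), (forall i, 0 <= x i) -> \sum_i x i `^ p <= S ->
  \sum_i `|c i| * x i <= C * lqnorm q c.
Proof.
move=> S0; have [[-> ->]|[r [p1 r1 -> pr]]] /= := hoelder_conjugate_cases.
  exists S => // n c x x0 xS; apply: le_trans (_ : \sum_i (\big[Order.max/0]_(i < n) `|c i|) * x i <= _).
    by apply: ler_sum => i _; rewrite ler_wpM2r//; apply: le_bigmax.
  rewrite -mulr_sumr mulrC ler_wpM2r//; first by rewrite bigmax_idl le_max lexx.
  by apply: le_trans xS; apply: ler_sum => i _; rewrite powRr1.
have r0 : 0 < r by lra.
have p0 : 0 < p by lra.
(* Young's inequality for [|c i| / l] and [x i] sums up to [1 / r] from the normalised [c] and
   [S / p] from [x]. *)
exists (r^-1 + S / p); first by rewrite addr_ge0// ?invr_ge0 ?divr_ge0// ltW.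
move=> n c x x0 xS; set l := _ `^ r^-1.
have l0 : 0 <= l by exact: powR_ge0.
have sc : \sum_i `|c i| `^ r = l `^ r.
  rewrite /l -powRrM mulVf ?gt_eqF// powRr1//.
  by apply: sumr_ge0 => i _; exact: powR_ge0.
have [l00|ln0] := eqVneq l 0.
  rewrite l00 mulr0 big1// => i _.
  have : `|c i| `^ r <= 0.
    rewrite -(powR0 (lt0r_neq0 r0)) -l00 -sc (bigD1 i)//= lerDl.
    by apply: sumr_ge0 => j _; exact: powR_ge0.
  move=> h; have : `|c i| `^ r = 0 by apply/eqP; rewrite eq_le h powR_ge0.
  by move/eqP; rewrite powR_eq0 => /andP[/eqP -> _]; rewrite mul0r.
have lp : 0 < l by rewrite lt_neqAle eq_sym ln0.
rewrite -ler_pdivrMr// mulr_suml.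
apply: (@le_trans _ _ (\sum_i ((`|c i| / l) `^ r / r + x i `^ p / p))).
  apply: ler_sum => i _; rewrite mulrAC.
  by apply: conjugate_powR => //; rewrite ?divr_ge0// addrC.
rewrite big_split /= -!mulr_suml.
under eq_bigr do rewrite powRM// ?invr_ge0//.
rewrite -mulr_suml sc -powRM ?invr_ge0// mulfV// powR1 mul1r.
by rewrite lerD2l ler_wpM2r// invr_ge0 ltW.
Qed.

End lq.

(** * Chains and the norm that they generate *)

Section atomic.
Context (R : realType) (d : nat) (V : lmodType R).
Variables (atom : set 'rV[R]_d -> set V) (p : R).
Hypothesis p_ge1 : 1 <= p.
Hypothesis atom_cube : forall Q a, atom Q a -> cube_in Q.

Lemma chain_norm_ge0 (b : chain atom) : 0 <= chain_norm p b.
Proof. exact: lqnorm_ge0. Qed.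

Lemma atomic_norm_le (f : V) n (b : 'I_n -> chain atom) :
  f = \sum_(j < n) chain_val (b j) ->
  atomic_norm atom p f <= \sum_(j < n) chain_norm p (b j).
Proof.
move=> fE; apply: ge_inf; last by exists n, b.
exists 0 => _ [m [c [_ ->]]]; apply: sumr_ge0 => i _; exact: chain_norm_ge0.
Qed.

Lemma single_chain Q a c : atom Q a -> exists b : chain atom,
  chain_val b = c *: a /\ chain_norm p b = `|c|.
Proof.
move=> aQ.
have pk : packing (fun _ : 'I_1 => Q).
  split => [i|]; first exact: atom_cube aQ.
  by move=> i j _ _ _; rewrite !ord1.
exists (@Chain R d V atom 1 (fun=> Q) (fun=> c) (fun=> a) pk (fun=> aQ)).
by rewrite /chain_val /chain_norm big_ord1 /= lqnorm1.
Qed.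

Lemma atom_hull_chains f : atom_hull atom f ->
  exists n (b : 'I_n -> chain atom), f = \sum_(j < n) chain_val (b j).
Proof.
move=> [n [c [a [ha ->]]]].
have /choice[b hb] : forall i, exists b : chain atom, chain_val b = c i *: a i.
  by move=> i; have [Q aQ] := ha i; have [b [h _]] := single_chain (c i) aQ; exists b.
by exists n, b; apply: eq_bigr => i _; rewrite hb.
Qed.

Lemma atom_hullP (a : R) f g : atom_hull atom f -> atom_hull atom g ->
  atom_hull atom (a *: f + g).
Proof.
move=> [n [c [u [hu ->]]]] [m [e [v [hv ->]]]].
exists (n + m)%N, (fun i => match fintype.split i with inl i => a * c i | inr i => e i end),
  (fun i => match fintype.split i with inl i => u i | inr i => v i end); split.
  by move=> i; case: (fintype.split i).
rewrite big_split_ord /= scaler_sumr; congr (_ + _); apply: eq_bigr => i _.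
  by rewrite (unsplitK (inl i)) scalerA.
by rewrite (unsplitK (inr i)).
Qed.

Lemma atom_hull0 : atom_hull atom 0.
Proof.
exists 0%N, (fun=> 0), (fun=> 0); split; first by case.
by rewrite big_ord0.
Qed.

Lemma atom_hull_atom Q a : atom Q a -> atom_hull atom a.
Proof.
move=> h; exists 1%N, (fun=> 1), (fun=> a); split; first by move=> _; exists Q.
by rewrite big_ord1 scale1r.
Qed.

Lemma atom_hullZ (c : R) f : atom_hull atom f -> atom_hull atom (c *: f).
Proof. by move=> h; rewrite -[_ *: _]addr0; apply: atom_hullP => //; exact: atom_hull0. Qed.

(** A member of the hull has a presentation, with one chain per atom; this excludes the default
    value of the infimum of an empty set. *)
Lemma atomic_norm_ge f (x : R) : atom_hull atom f ->
  (forall n (b : 'I_n -> chain atom), f = \sum_(j < n) chain_val (b j) ->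
     x <= \sum_(j < n) chain_norm p (b j)) ->
  x <= atomic_norm atom p f.
Proof.
move=> hf h; apply: lb_le_inf.
  have [n [b fE]] := atom_hull_chains hf.
  by exists (\sum_(j < n) chain_norm p (b j)), n, b.
by move=> _ [n [b [fE ->]]]; exact: h.
Qed.

End atomic.

(** * Equality of the two norms on discrete measures *)

Section transfer.
Context (R : realType) (d k : nat) (p : R).
Hypothesis d_gt0 : (0 < d)%N.
Hypothesis k_gt0 : (0 < k)%N.
Hypothesis p_ge1 : 1 <= p.
Local Notation B := (borelQd R d).
Local Notation QD := (Qd R d).
Local Notation M := (signed_measure B R).
Local Notation FA := (@fatom R d k).
Local Notation MA := (@matom R d k).

Lemma fatom_cube Q a : FA Q a -> cube_in Q. Proof. by case. Qed.
Lemma matom_cube_in Q a : MA Q a -> cube_in Q. Proof. by case. Qed.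

Lemma point_mass_sum (I : Type) (s : seq I) (P : pred I) (c : I -> R) (mu : I -> M) :
  point_mass (\sum_(i <- s | P i) c i *: mu i) = \sum_(i <- s | P i) c i *: point_mass (mu i).
Proof. by apply/funext => x; rewrite /point_mass signed_measure_sum fct_sumE. Qed.

Lemma point_massD (mu nu : M) : point_mass (mu + nu) = point_mass mu + point_mass nu.
Proof. by []. Qed.

Lemma discrete_sum (I : Type) (s : seq I) (P : pred I) (c : I -> R) (b : I -> QD -> R) :
  (forall i, summable setT (EFin \o b i)) ->
  discrete_measure (\sum_(i <- s | P i) c i *: b i) =
  \sum_(i <- s | P i) c i *: discrete_measure (b i).
Proof.
move=> sb; set nu := RHS.
have cnu : countably_carried nu by apply: countably_carried_sum => i; exact: countably_carried_discrete.
rewrite -(discrete_point_mass cnu) point_mass_sum; congr discrete_measure.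
by apply: eq_bigr => i _; rewrite point_mass_discrete.
Qed.

Lemma summable_sum (I : Type) (s : seq I) (P : pred I) (c : I -> R) (b : I -> QD -> R) :
  (forall i, summable setT (EFin \o b i)) ->
  summable setT (EFin \o (\sum_(i <- s | P i) c i *: b i)).
Proof.
move=> sb; have cnu : countably_carried (\sum_(i <- s | P i) c i *: discrete_measure (b i)).
  by apply: countably_carried_sum => i; exact: countably_carried_discrete.
have := summable_point_mass cnu; rewrite point_mass_sum.
by under eq_bigr do rewrite point_mass_discrete//.
Qed.

Lemma U0_summable b : U0 R d k b -> summable setT (EFin \o b).
Proof.
move=> [n [c [a [ha ->]]]]; apply: summable_sum => i.
by have [Q []] := ha i.
Qed.

Lemma Ut0_discrete b : U0 R d k b -> Ut0 R d k (discrete_measure b).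
Proof.
move=> [n [c [a [ha ->]]]]; exists n, c, (fun i => discrete_measure (a i)); split.
  by move=> i; have [Q h] := ha i; exists Q; exact: matom_discrete.
by rewrite discrete_sum// => i; have [Q []] := ha i.
Qed.

Lemma Ut0_vanish mu : Ut0 R d k mu -> vanishing k mu.
Proof.
move=> [n [c [a [ha ->]]]]; apply: vanishing_sum => i.
by have [Q []] := ha i.
Qed.

Definition cubeT : 'I_d -> R := fun=> 0.

Lemma subboxT : subbox cubeT 1.
Proof. by split => // i; rewrite add0r lexx. Qed.

Lemma carriedT (mu : M) : carried (Qd_box cubeT 1 : set B) mu.
Proof.
apply: (@carriedS _ _ _ setT); last by move=> A mA; rewrite setIT => ->; exact: signed_measure_set0.
by move=> x _ i; rewrite /cubeT add0r; exact: coord01.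
Qed.

Lemma vanishing_atom (nu : M) (c : R) : countably_carried nu -> vanishing k nu -> tv_norm nu <= c -> 0 < c ->
  FA (box cubeT 1) (point_mass (c^-1 *: nu)).
Proof.
move=> cnu vnu tnu c0; apply: fatom_point_mass; first exact: countably_carriedZ.
apply/(matomP k _ subboxT); split; [exact: carriedT| |exact: vanishingZ].
apply: le_trans (ler_tv_normZ _ _) _; rewrite gtr0_norm ?invr_gt0//.
by rewrite mulrC ler_pdivrMr// mul1r.
Qed.

(** The unit cube is itself an admissible cube, so a multiple of [nu] is a single atom; the factor
    [1 + tv_norm nu] is never zero. *)
Lemma vanishing_U0 (nu : M) : countably_carried nu -> vanishing k nu -> U0 R d k (point_mass nu).
Proof.
move=> cnu vnu; have c0 : 0 < 1 + tv_norm nu by rewrite ltr_pwDl// tv_norm_ge0.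
have tc : tv_norm nu <= 1 + tv_norm nu by rewrite lerDr.
have := vanishing_atom cnu vnu tc c0.
move=> /atom_hull_atom/(atom_hullZ (1 + tv_norm nu)).
rewrite (_ : _ *: _ = point_mass nu)//; apply/funext => x.
rewrite -[LHS]/((1 + tv_norm nu) * ((1 + tv_norm nu)^-1 * point_mass nu x)) mulrA mulfV ?mul1r// gt_eqF//.
Qed.

Definition map_chain (c : chain FA) : chain MA :=
  @Chain R d M MA (chain_size c) (chain_cube (c := c)) (chain_coef (c := c))
    (fun i => discrete_measure (@chain_atom _ _ _ _ c i))
    (@chain_packing _ _ _ _ c)
    (fun i => matom_discrete (@chain_atomP _ _ _ _ c i)).

Lemma map_chain_val (c : chain FA) :
  chain_val (map_chain c) = discrete_measure (chain_val c).
Proof.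
rewrite /chain_val discrete_sum// => i.
by have [] := @chain_atomP _ _ _ _ c i.
Qed.

Lemma chain_summable (c : chain FA) : summable setT (EFin \o chain_val c).
Proof.
apply: summable_sum => i; by have [] := @chain_atomP _ _ _ _ c i.
Qed.

Lemma Utnorm_le b : U0 R d k b -> Utnorm d k p (discrete_measure b) <= Unorm d k p b.
Proof.
move=> hb; apply: atomic_norm_ge => //; first exact: fatom_cube.
move=> n c bE; apply: le_trans (@atomic_norm_le _ _ _ MA p p_ge1 _ _ (fun j => map_chain (c j)) _) _ => //.
rewrite bE.
under [in LHS]eq_bigr do rewrite -[chain_val _]scale1r.
rewrite discrete_sum; last by move=> j; exact: chain_summable.
by apply: eq_bigr => j _; rewrite scale1r map_chain_val.
Qed.

(** The hard half: measure atoms have to be turned into discrete ones on the same packings, with the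
    coefficients enlarged by a factor [1 + eta] only. *)
Lemma Unorm_le b : U0 R d k b -> Unorm d k p b <= Utnorm d k p (discrete_measure b).
Proof.
move=> hb; apply: atomic_norm_ge => //; first exact: matom_cube_in.
  exact: Ut0_discrete.
move=> n c bE; apply/ler_addgt0Pr => e e0.
set S := \sum_(j < n) _.
have S0 : 0 <= S by apply: sumr_ge0 => j _; exact: chain_norm_ge0.
(* Chosen so that [(1 + eta) * S + eta = S + e]: the enlarged old chains plus the cost of the
   correction. *)
pose eta := e / (1 + S); have eta0 : 0 < eta by rewrite divr_gt0//; lra.
(* The atoms of all chains form one family, as a single quantization must serve them all. *)
pose T := {j : 'I_n & 'I_(chain_size (c j))}.
pose cf (t : T) := @chain_coef _ _ _ _ (c (tag t)) (tagged t).
pose Q (t : T) := @chain_cube _ _ _ _ (c (tag t)) (tagged t).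
pose mu (t : T) := @chain_atom _ _ _ _ (c (tag t)) (tagged t).
have muQ t : MA (Q t) (mu t) by exact: (@chain_atomP _ _ _ _ (c (tag t)) (tagged t)).
have /choice[ar har] : forall t, exists ar : ('I_d -> R) * R, subbox ar.1 ar.2 /\ Q t = box ar.1 ar.2.
  by move=> t; have [a [r h]] := matom_cube (muQ t); exists (a, r).
have hmu t : [/\ carried (Qd_box (ar t).1 (ar t).2 : set B) (mu t), tv_norm (mu t) <= 1 & vanishing k (mu t)].
  apply/(matomP k (mu t) (har t).1); rewrite -(har t).2; exact: muQ.
have sb := U0_summable hb.
have bE' : discrete_measure b = \sum_t cf t *: mu t.
  by rewrite bE /chain_val (@sig_big_dep _ _ _ 'I_n (fun j => 'I_(chain_size (c j)))).
have [nu [g [cnu hnu [cg tg vg] bE2]]] := @replace_atoms R d k d_gt0 k_gt0 T cf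
  (fun t => (ar t).1) (fun t => (ar t).2) mu b eta (fun t => (har t).1)
  (fun t => let: And3 h _ _ := hmu t in h) (fun t => let: And3 _ h _ := hmu t in h)
  (fun t => let: And3 _ _ h := hmu t in h) sb bE' eta0.
have nuQ t : FA (Q t) (point_mass (nu t)).
  apply: fatom_point_mass => //; rewrite (har t).2; apply/matomP => //; exact: (har t).1.
(* The correction is a chain of its own: one atom on the whole unit cube, with coefficient [eta]. *)
have [cl [clv cln]] := @single_chain _ _ _ FA p p_ge1 fatom_cube _ _ eta (vanishing_atom cg vg tg eta0).
pose ch (j : 'I_n) : chain FA := @Chain R d _ FA (chain_size (c j)) (@chain_cube _ _ _ _ (c j))
  (fun i => (1 + eta) * @chain_coef _ _ _ _ (c j) i)
  (fun i => point_mass (nu (@Tagged _ j (fun j => 'I_(chain_size (c j))) i)))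
  (@chain_packing _ _ _ _ (c j))
  (fun i => nuQ (@Tagged _ j (fun j => 'I_(chain_size (c j))) i)).
pose ch' (j : 'I_(n + 1)) := match fintype.split j with inl j => ch j | inr _ => cl end.
have : Unorm d k p b <= \sum_(j < n + 1) chain_norm p (ch' j).
  apply: atomic_norm_le => //.
  rewrite big_split_ord /= big_ord1 /ch' (unsplitK (inr ord0)) clv.
  under eq_bigr => j _ do rewrite (unsplitK (inl j)).
  rewrite -(point_mass_discrete sb) bE2 point_massD point_mass_sum; congr (_ + _).
    by rewrite /chain_val /= (@sig_big_dep _ _ _ 'I_n (fun j => 'I_(chain_size (c j))))/=;
      apply: eq_bigr => -[j i].
  apply/funext => x; rewrite -[RHS]/(eta * (eta^-1 * point_mass g x)) mulrA mulfV ?mul1r// gt_eqF//.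
rewrite big_split_ord /= big_ord1 /ch' (unsplitK (inr ord0)) cln.
under eq_bigr => j _.
  rewrite (unsplitK (inl j)) /chain_norm /= lqnorm_scale//; last by lra.
  over.
rewrite -mulr_sumr -/S (gtr0_norm eta0) => h; apply: le_trans h _.
have eE : eta * (1 + S) = e by rewrite /eta divfK// gt_eqF//; lra.
have -> : (1 + eta) * S + eta = S + eta * (1 + S) by ring.
by rewrite eE.
Qed.

Lemma Unorm_eq b : U0 R d k b -> Utnorm d k p (discrete_measure b) = Unorm d k p b.
Proof. by move=> hb; apply/le_anti; rewrite Utnorm_le// Unorm_le. Qed.

End transfer.

(** * Density *)

Section diffuse_measures.
Context (R : realType) (d : nat).
Local Notation B := (borelQd R d).
Local Notation QD := (Qd R d).
Local Notation M := (signed_measure B R).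

Definition sup_ball (z : 'rV[R]_d) (h : R) : set QD :=
  [set y | forall i, z ord0 i - h <= cube_coord i y <= z ord0 i + h].

Lemma measurable_sup_ball z h : measurable (sup_ball z h : set B).
Proof.
have -> : sup_ball z h = Qd_box (fun i => z ord0 i - h) (h + h).
  by apply/seteqP; split => y hy i; have := hy i; rewrite addrA subrK.
exact: measurable_Qd_box.
Qed.

Lemma countable_atoms (m : {measure set B -> \bar R}) : (m setT < +oo)%E ->
  countable [set x : QD | m [set x] != 0%E].
Proof.
move=> fm; apply: countable_esum => //; apply: le_lt_trans fm.
apply: ub_ereal_sup => _ [X [fX _] <-].
rewrite -(measure_fsbig m fX).
- apply: le_measure; rewrite ?inE// fsbig_finite//=.
  by apply: bigsetU_measurable => // x _; exact: measurable_set1Qd.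
- by move=> x _; exact: measurable_set1Qd.
- by move=> x y _ _ [z [/= -> ->]].
Qed.

(** The closed balls about [z] decrease to at most one point of the unit cube, so continuity from
    above applies. *)
Lemma sup_ball_small (m : {measure set B -> \bar R}) (z : 'rV[R]_d) (e : R) :
  (m setT < +oo)%E -> (forall x, m [set x] = 0%E) -> 0 < e ->
  exists2 h, 0 < h & (m (sup_ball z h) < e%:E)%E.
Proof.
move=> fm m0 e0.
pose F n := sup_ball z n.+1%:R^-1.
have mF n : measurable (F n : set B) by exact: measurable_sup_ball.
have I0 : m (\bigcap_n F n) = 0%E.
  have [E|/set0P[x Fx]] := eqVneq (\bigcap_n F n) set0; first by rewrite E.
  apply/eqP; rewrite -measure_le0 -(m0 x); apply: le_measure; rewrite ?inE.
  - exact: bigcapT_measurable.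
  - exact: measurable_set1Qd.
  - move=> y Fy; apply: Qd_eq => i; apply/eqP; rewrite -subr_eq0 -normr_le0.
    suff key (t : R) : 0 < t -> `|cube_coord i y - cube_coord i x| <= t.
      by apply/ler_addgt0Pr => t t0; rewrite add0r; exact: key.
    move=> t0; have t2 : 0 < t / 2 by lra.
    pose n := Num.bound (t / 2)^-1.
    have := Fx n I; have := Fy n I; rewrite /F /sup_ball /= => /(_ i) h1 /(_ i) h2.
    have hn : n.+1%:R^-1 <= t / 2.
      rewrite -[leRHS]invrK lef_pV2 ?posrE ?invr_gt0//.
      apply/ltW; apply: (lt_trans (archi_boundP _)); first by rewrite invr_ge0 ltW.
      by rewrite ltr_nat.
    rewrite ler_norml; move: h1 h2 hn => /andP[+ +] /andP[].
    move: (n.+1%:R^-1 : R) => w h1 h2 h3 h4 hn.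
    apply/andP; split; lra.
have := @nonincreasing_cvg_mu _ B R m F.
rewrite I0 => /(_ _ mF) h.
have {}h : (m \o F) x @[x --> \oo] --> 0%E.
  apply: h.
  - by apply: le_lt_trans fm; apply: le_measure; rewrite ?inE.
  - exact: bigcapT_measurable.
  - move=> i j ij; apply/subsetPset => y hy l; have := hy l.
    have : (j.+1%:R^-1 : R) <= i.+1%:R^-1 by rewrite lef_pV2 ?posrE// ler_nat.
    by move: (_.+1%:R^-1 : R) (i.+1%:R^-1 : R) => u v *; lra.
have : \forall n \near \oo, ((m \o F) n < e%:E)%E.
  move/fine_cvgP : h => [ff /cvgrPdist_lt/(_ _ e0)].
  move=> hh; near=> n.
  have fn : (m \o F) n \is a fin_num by near: n; exact: ff.
  rewrite -(fineK fn) lte_fin.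
  have : `|0 - fine ((m \o F) n)| < e by near: n; exact: hh.
  by rewrite sub0r normrN; apply: le_lt_trans; exact: ler_norm.
move=> [N _ /(_ N (leqnn N)) hN]; exists N.+1%:R^-1 => //.
Unshelve. all: by end_near. Qed.

Lemma unit_cube_compact : compact (unit_cube R d).
Proof.
have := @rV_compact R d (fun=> `[0, 1]%classic) (fun=> @segment_compact R 0 1).
congr compact; apply/seteqP; split => x h i; have := h i; by rewrite /= in_itv.
Qed.

(** Compactness makes the radius of [sup_ball_small] uniform in the centre, and a cube of side at
    most [h] lies in the ball of radius [h] about any of its points. *)
Lemma small_cubes (m : {measure set B -> \bar R}) (e : R) :
  (m setT < +oo)%E -> (forall x, m [set x] = 0%E) -> 0 < e ->
  exists2 h, 0 < h & forall a r, r <= h -> (m (Qd_box a r) <= e%:E)%E.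
Proof.
move=> fm m0 e0.
pose P (h : R) (z : 'rV[R]_d) := (m (sup_ball z h) < e%:E)%E.
have /compact_near_coveringP/(_ R (0^'+) P) := unit_cube_compact.
have mono (z z' : 'rV[R]_d) (h h' : R) : (forall i, `|z ord0 i - z' ord0 i| <= h' - h) -> 
    (m (sup_ball z h) <= m (sup_ball z' h'))%E.
  move=> zz; apply: le_measure; rewrite ?inE; [exact: measurable_sup_ball..|].
  by move=> y hy i; have := hy i; have := zz i; rewrite ler_norml; lra.
have HP z : unit_cube R d z -> \forall z' \near z & h \near 0^'+, P h z'.
  move=> _; have [h h0 mh] := sup_ball_small z fm m0 e0.
  (* Half of the radius pays for moving the centre, the other half for the new ball. *)
  exists (ball z (h / 2), [set t | t < h / 2]).
    split; first by apply: nbhsx_ballx; lra.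
    by apply: nbhs_right_lt; lra.
  move=> [z' t] /= [[_ bz] th]; rewrite /P /=.
  apply: le_lt_trans mh; apply: mono => i.
  have := bz ord0 i; rewrite /ball /= distrC => /ltW h1.
  by apply: le_trans h1 _; lra.
move=> /(_ _ HP)[t /= t0 ht].
pose h := t / 2.
have h0 : 0 < h by rewrite /h; lra.
have hP : forall z, unit_cube R d z -> P h z.
  apply: ht; rewrite /= /h; last by lra.
  rewrite sub0r normrN gtr0_norm; lra.
exists h => // a r rh.
have [->|/set0P[x xQ]] := eqVneq (Qd_box a r) set0; first by rewrite measure0 lee_fin ltW.
have ux : unit_cube R d (\val x) by exact: set_mem (valP x).
apply: le_trans (ltW (hP _ ux)); apply: le_measure; rewrite ?inE.
- exact: measurable_Qd_box.
- exact: measurable_sup_ball.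
- move=> y yQ i; have := yQ i; have := xQ i; rewrite /cube_coord; lra.
Qed.

End diffuse_measures.

Section density.
Context (R : realType) (d k : nat) (p : R).
Hypothesis d_gt0 : (0 < d)%N.
Hypothesis k_gt0 : (0 < k)%N.
Hypothesis p_ge1 : 1 <= p.
Local Notation B := (borelQd R d).
Local Notation QD := (Qd R d).
Local Notation M := (signed_measure B R).
Local Notation FA := (@fatom R d k).
Local Notation MA := (@matom R d k).

Lemma restrict_measure_sum (mu : M) (E : nat -> set B) n : (forall i, measurable (E i)) ->
  trivIset setT E -> \sum_(i < n) restrict_measure (E i) mu = restrict_measure (\big[setU/set0]_(i < n) E i) mu.
Proof.
move=> mE tE; elim: n => [|n ih].
  by rewrite !big_ord0; apply: eq_signed_measure => A mA; rewrite restrict_measureE// setI0 signed_measure_set0.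
rewrite !big_ord_recr /= ih restrict_measureU//; first exact: bigsetU_measurable.
apply/seteqP; split => // x [].
rewrite -bigcup_mkord => -[i /= iltn Ei] En.
have : i = n by apply: (tE i n) => //; exists x.
by move=> ein; rewrite ein ltnn in iltn.
Qed.

(** Moving an interior point along the diagonal by [e / 2], in both directions, gives all the strict
    inequalities at once. *)
Lemma interior_box (a : 'I_d -> R) r (z : 'rV[R]_d) :
  (box a r)° z -> forall i, a i < z ord0 i < a i + r.
Proof.
move=> /nbhs_ballP[e /= e0 he] i.
have b (t : R) : `|t| < e -> box a r (z + const_mx t).
  move=> te; apply: he; split => // j l; rewrite !mxE /ball /=.
  by rewrite opprD addrA subrr sub0r normrN.
have e2 : `|e / 2| < e by rewrite gtr0_norm; lra.
have e2' : `|- (e / 2)| < e by rewrite normrN.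
have := b _ e2 i; have := b _ e2' i; rewrite !mxE; lra.
Qed.

Section grid.
Variables (N : nat) (N_gt0 : (0 < N)%N).
Local Notation G := {ffun 'I_d -> 'I_N}.

Definition grid_corner (g : G) : 'I_d -> R := fun i => (g i)%:R / N%:R.

Let NR : (0 : R) < N%:R. Proof. by rewrite ltr0n. Qed.

Lemma subbox_grid g : subbox (grid_corner g) N%:R^-1.
Proof.
split; first by rewrite invr_gt0.
move=> i; rewrite /grid_corner divr_ge0//; split => //.
rewrite -[X in _ + X]mul1r -mulrDl ler_pdivrMr// mul1r natr1 ler_nat.
exact: ltn_ord.
Qed.

Lemma grid_cover (x : QD) : exists g, Qd_box (grid_corner g) N%:R^-1 x.
Proof.
have h i : exists j : 'I_N, j%:R / N%:R <= cube_coord i x <= j%:R / N%:R + N%:R^-1.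
  have /andP[x0 x1] := coord01 i x.
  have Nx0 : 0 <= N%:R * cube_coord i x by rewrite mulr_ge0.
  pose j := Num.trunc (N%:R * cube_coord i x).
  have /andP[j1 j2] := truncn_itv Nx0; rewrite -/j in j1 j2.
  have E (l : nat) : l%:R <= N%:R * cube_coord i x <= l.+1%:R ->
     l%:R / N%:R <= cube_coord i x <= l%:R / N%:R + N%:R^-1.
    move=> /andP[l1 l2]; rewrite ler_pdivrMr// mulrC l1 /=.
    by rewrite -[X in _ + X]mul1r -mulrDl natr1 ler_pdivlMr// mulrC.
  have [jN|jN] := ltnP j N.
    by exists (Ordinal jN); apply: E => /=; rewrite j1 ltW.
  (* On the face where the coordinate is 1 the truncation gives [N], and the last cell is taken
     instead. *)
  have pN : (N.-1 < N)%N by rewrite prednK.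
  exists (Ordinal pN); apply: E => /=; rewrite prednK//.
  apply/andP; split.
    by apply: le_trans j1; rewrite ler_nat (leq_trans _ jN)// leq_pred.
  by rewrite -[leRHS]mulr1 ler_wpM2l.
exists [ffun i => sval (cid (h i))] => i; rewrite /grid_corner ffunE.
by case: cid.
Qed.

Lemma grid_packing :
  packing (fun l : 'I_#|{: G}| => box (grid_corner (enum_val l)) N%:R^-1).
Proof.
split => [l|]; first exact/cube_in_box/subbox_grid.
move=> l l' _ _ [z [/interior_box h1 /interior_box h2]].
apply: enum_val_inj; apply/ffunP => i; apply: val_inj => /=.
have := h1 i; have := h2 i; rewrite /grid_corner.
move: (enum_val l i) (enum_val l' i) => [u hu] [v hv] /=.
have E (s t : nat) : s%:R / N%:R < z ord0 i -> z ord0 i < t%:R / N%:R + N%:R^-1 -> (s <= t)%N.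
  move=> h3 h4; rewrite -ltnS -(ltr_nat R) -(@ltr_pM2r _ N%:R^-1) ?invr_gt0//.
  by rewrite -natr1 mulrDl mul1r (lt_trans h3).
by move=> /andP[h3 h4] /andP[h5 h6]; apply/eqP; rewrite eqn_leq !E.
Qed.

End grid.

Lemma dense_discrete (mu : M) (e : R) : Ut0 R d k mu -> 0 < e ->
  exists2 b, U0 R d k b & Utnorm d k p (mu - discrete_measure b) <= e.
Proof.
move=> hmu e0.
have vmu := Ut0_vanish hmu.
pose D := [set x : QD | charge_variation (hahnP mu) [set x] != 0%E].
have cD : countable D.
  by apply: (@countable_atoms R d (charge_variation (hahnP mu))); rewrite -[X in (X < _)%E]tv_norm_variation ltry.
have mD := measurable_countable cD; have mCD := measurableC mD.
pose mu' := restrict_measure (~` D : set B) mu.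
have var0 x : charge_variation (hahnP mu') [set x] = 0%E.
  have : variation_mass mu' x = 0.
    rewrite variation_massE /point_mass restrict_measureE//; last exact: measurable_set1Qd.
    have [Dx|nDx] := pselect (D x).
      rewrite (_ : _ `&` _ = set0) ?signed_measure_set0 ?normr0//.
      by apply/seteqP; split => // y [/= ->].
    have -> : [set x] `&` ~` D = [set x] by apply/seteqP; split => [y []//|y /= ->].
    rewrite -[LHS]/(`|point_mass mu x|) -variation_massE /variation_mass.
    by move/negP : nDx; rewrite negbK => /eqP; rewrite /variation_measure => ->.
  rewrite /variation_mass => /eqP; rewrite fine_eq0.
    by move=> /eqP.
  have m1 := @measurable_set1Qd R d x.
  by rewrite variation_measureE -/(pos_part mu') -/(neg_part mu') pos_partE// neg_partE.
have [K K0 hK] := lagrange_box R d_gt0 k_gt0.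
(* Bounds the norm of the map that subtracts from a measure on a cube its nodal measure. *)
pose NK : R := 1 + #|{ffun 'I_d -> 'I_k}|%:R * K.
have NK0 : 0 < NK by rewrite ltr_pwDl// mulr_ge0.
have S0 : 0 <= NK * tv_norm mu' by rewrite mulr_ge0 ?tv_norm_ge0// ltW.
have [m m0 hm] := lqnorm_small p_ge1 S0 e0.
have fin' : (charge_variation (hahnP mu') setT < +oo)%E.
  by rewrite -[X in (X < _)%E]tv_norm_variation ltry.
(* A piece of mass at most [m / NK] will have a coefficient of at most [m]. *)
have mNK : 0 < m / NK by rewrite divr_gt0.
have [h h0 small] := small_cubes fin' var0 mNK.
pose N := (Num.bound h^-1).+1.
have N0 : (0 < N)%N by [].
have Nh : (N%:R^-1 : R) <= h.
  rewrite -[leRHS]invrK lef_pV2 ?posrE ?invr_gt0//.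
  apply/ltW; apply: (lt_trans (archi_boundP _)); first by rewrite invr_ge0 ltW.
  by rewrite ltr_nat.
pose G := {ffun 'I_d -> 'I_N}.
pose n := #|{: G}|.
pose a (l : 'I_n) : 'I_d -> R := grid_corner (enum_val l).
pose r : R := N%:R^-1.
have sa l : subbox (a l) r by exact: subbox_grid.
pose F (i : nat) : set B := if insub i is Some l then Qd_box (a l) r else set0.
have FE (l : 'I_n) : F l = Qd_box (a l) r by rewrite /F valK.
have mF i : measurable (F i).
  by rewrite /F; case: insubP => // l _ _; exact: measurable_Qd_box.
(* The closed grid cubes share faces, so they are made disjoint; each piece stays inside its
   cube. *)
pose E i := seqDU F i.
have mE i : measurable (E i) by exact: seqDU_measurable.
have tE : trivIset setT E by exact: trivIset_seqDU.
have Ecov : \big[setU/set0]_(i < n) E i = setT.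
  rewrite -bigsetU_seqDU; apply/seteqP; split => // x _.
  have [g hg] := grid_cover N0 x.
  rewrite -bigcup_mkord; exists (enum_rank g); first exact: (ltn_ord (enum_rank g)).
  by rewrite (FE (enum_rank g)) /a enum_rankK.
pose mui (l : 'I_n) := restrict_measure (E l) mu'.
have mui_sum : \sum_(l < n) mui l = mu'.
  by rewrite /mui (restrict_measure_sum mu' n mE tE) Ecov restrict_measureT.
have cmui l : carried (Qd_box (a l) r : set B) (mui l).
  apply: carriedS (carried_restrict _ (mE l)); rewrite -FE; exact: subset_seqDU.
have /choice[Lp hL] : forall l, exists Lp : ({ffun 'I_d -> 'I_k} -> QD -> R) * ({ffun 'I_d -> 'I_k} -> QD),
    interpolates K (a l) r Lp.1 Lp.2.
  by move=> l; have [L [pt hh]] := hK _ _ (sa l); exists (L, pt).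
pose nui l := mui l - nodal_measure (Lp l).1 (Lp l).2 (mui l).
have tvnui l : tv_norm (nui l) <= NK * tv_norm (mui l).
  apply: le_trans (ler_tv_normD _ _) _; rewrite mulrDl mul1r lerD2l.
  rewrite -scaleN1r; apply: le_trans (ler_tv_normZ _ _) _; rewrite normrN normr1 mul1r.
  exact: (tv_norm_nodal_box (hL l)).
pose c (l : 'I_n) := NK * tv_norm (mui l).
have c0 l : 0 <= c l by rewrite mulr_ge0 ?tv_norm_ge0// ltW.
pose al l := (c l)^-1 *: nui l.
have alE l : nui l = c l *: al l.
  (* For [c l = 0] the inverse is 0 and so is [al l]; this is consistent, as [nui l] then has norm
     0. *)
  have [cl0|cl0] := eqVneq (c l) 0.
    rewrite cl0 scale0r; apply: tv_norm_eq0; apply/eqP; rewrite eq_le tv_norm_ge0 andbT.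
    by rewrite -cl0 tvnui.
  by rewrite /al scalerA mulfV// scale1r.
have alA l : MA (box (a l) r) (al l).
  apply/(matomP k _ (sa l)); split.
  - apply: carriedZ; apply: carriedD => //; rewrite -scaleN1r; apply: carriedZ.
    exact: (carried_nodal (hL l)).
  - apply: le_trans (ler_tv_normZ _ _) _; rewrite ger0_norm ?invr_ge0//.
    have [cl0|cl0] := eqVneq (c l) 0; first by rewrite cl0 invr0 mul0r.
    by rewrite mulrC ler_pdivrMr ?mul1r ?tvnui// lt_neqAle eq_sym cl0 c0.
  - by apply: vanishingZ; exact: (vanishing_nodal (hL l)).
pose ch : chain MA := @Chain R d M MA n (fun l => box (a l) r) c al (grid_packing N0) alA.
pose nu := mu - \sum_(l < n) nui l.
have nuE : mu - nu = \sum_(l < n) nui l by rewrite /nu opprB addrC subrK.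
have ccnu : countably_carried nu.
  (* What the subtraction leaves: the point masses of [mu], and the nodal measures put in place of
     the diffuse pieces. *)
  have -> : nu = restrict_measure (D : set B) mu + \sum_(l < n) 1 *: nodal_measure (Lp l).1 (Lp l).2 (mui l).
    rewrite /nu /nui sumrB mui_sum opprB addrA addrAC.
    have -> : mu - mu' = restrict_measure (D : set B) mu.
      apply/eqP; rewrite subr_eq /mu' -restrict_measureU// ?setUv ?restrict_measureT ?setICr//.
    by congr (_ + _); apply: eq_bigr => l _; rewrite scale1r.
  apply: countably_carriedD; first by exists D => //; exact: carried_restrict.
  by apply: countably_carried_sum => l; exact: countably_carried_nodal.
have vnu : vanishing k nu.
  rewrite /nu -scaleN1r; apply: vanishingD => //; apply: vanishingZ.
  under eq_bigr do rewrite alE; apply: vanishing_sum => l.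
  by have [_ _ _] := alA l.
exists (point_mass nu); first exact: vanishing_U0.
rewrite discrete_point_mass// nuE.
have := @atomic_norm_le R d M MA p p_ge1 (\sum_(l < n) nui l) 1 (fun=> ch).
rewrite !big_ord1 => hn; apply: le_trans (hn _) _.
  by rewrite /chain_val /=; apply: eq_bigr => l _; exact: alE.
rewrite /chain_norm /=; apply: hm => [l|].
  rewrite c0 /=.
  have := tv_norm_restrict mu' (mE l); rewrite -/(mui l) => h1.
  have h2 : ((tv_norm (mui l))%:E <= (m / NK)%:E)%E.
    apply: le_trans h1 _; apply: le_trans (small (a l) r Nh).
    apply: (@le_measure _ _ _ (charge_variation (hahnP mu'))); rewrite ?inE//.
      exact: measurable_Qd_box.
    by rewrite -FE; exact: subset_seqDU.
  by move: h2; rewrite lee_fin ler_pdivlMr// mulrC.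
rewrite -mulr_sumr ler_wpM2l ?(ltW NK0)//.
rewrite -lee_fin tv_norm_variation -sumEFin.
rewrite -[X in (_ <= variation_measure _ X)%E]Ecov.
rewrite -[X in (_ <= X)%E]/(charge_variation (hahnP mu') _) measure_bigsetU//.
by apply: lee_sum => l _; exact: tv_norm_restrict.
Qed.

End density.

(** * Triviality of the kernel *)

Section volume.
Context (R : realType) (d : nat).

Lemma box_interior (a : 'I_d -> R) r (z : 'rV[R]_d) :
  (forall i, a i < z ord0 i < a i + r) -> (box a r)° z.
Proof.
move=> h; exists (fun _ j => `]a j, a j + r[%classic).
  move=> i j; rewrite (ord1 i); apply: open_nbhs_nbhs; split; first exact: interval_open.
  by rewrite /= in_itv /=; exact: h.
by move=> y hy i; have := hy ord0 i; rewrite /= in_itv /= => /andP[/ltW -> /ltW ->].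
Qed.

Lemma card_ord_itv (N j m : nat) : (j + m <= N.+1)%N ->
  (m <= #|[pred i : 'I_N.+1 | (j <= i < j + m)%N]|)%N.
Proof.
move=> jm.
have lt (i : 'I_m) : (j + i < N.+1)%N by apply: leq_trans jm; rewrite ltn_add2l.
pose f (i : 'I_m) := Ordinal (lt i).
have fi : injective f by move=> x y [/addnI/val_inj].
rewrite -[X in (X <= _)%N](card_ord m) -(card_codom fi).
apply: subset_leq_card; apply/fintype.subsetP => _ /codomP[i ->].
by rewrite inE /= leq_addr ltn_add2l ltn_ord.
Qed.

(* Counts the points of the lattice of mesh [1 / N] inside the open cubes; the
   constant is not optimal. *)
Lemma packing_volume n (a : 'I_n -> 'I_d -> R) (r : 'I_n -> R) :
  (forall i, subbox (a i) (r i)) -> trivIset setT (fun i => (box (a i) (r i))°) ->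
  \sum_i r i ^+ d <= 8 ^+ d.
Proof.
move=> sa tr.
(* The mesh [1 / N] is at most a quarter of the side of each cube. *)
pose N := Num.bound (\sum_i 4 / r i).
have N0 : (0 < N)%N by [].
have NR : (0 : R) < N%:R by rewrite ltr0n.
have rN i : 4 <= r i * N%:R.
  have r0 := (sa i).1.
  rewrite mulrC -ler_pdivrMr//; apply: le_trans (ltW (archi_boundP _)); last first.
    by apply: sumr_ge0 => j _; rewrite divr_ge0// ltW// (sa j).1.
  by rewrite (bigD1 i)//= lerDl; apply: sumr_ge0 => j _; rewrite divr_ge0// ltW// (sa j).1.
(* The number of lattice points counted in each direction: half of the side leaves room for rounding
   at the corner, and [r i * N >= 4] ensures that at least [r i * N / 4] points remain. *)
pose m i := Num.trunc (r i * N%:R / 2).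
have hm i : r i * N%:R / 4 <= (m i)%:R /\ (m i)%:R <= r i * N%:R / 2.
  have h4 := rN i.
  have h0 : 0 <= r i * N%:R / 2 by lra.
  have /andP[h1 h2] := truncn_itv h0; rewrite -[X in _ < X]natr1 in h2.
  by rewrite -/(m i) in h1 h2; split; lra.
(* The first lattice coordinate strictly beyond the corner, so that the points counted are
   interior. *)
pose j0 i l := (Num.trunc (a i l * N%:R)).+1.
have hj i l : a i l * N%:R < (j0 i l)%:R /\ (j0 i l)%:R <= a i l * N%:R + 1.
  have a0 : 0 <= a i l * N%:R by rewrite mulr_ge0//; exact: ((sa i).2 l).1.
  have /andP[h1 h2] := truncn_itv a0.
  by rewrite /j0; split => //; rewrite -natr1 lerD2r.
have jm i l : (j0 i l + m i <= N.+1)%N.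
  rewrite -(ler_nat R) natrD -[N.+1%:R]natr1.
  have [h1 h2] := hm i; have [h3 h4] := hj i l; have [h5 h6] := (sa i).2 l.
  have h7 : (a i l + r i) * N%:R <= N%:R by rewrite -[leRHS]mul1r ler_wpM2r.
  have := rN i; rewrite mulrDl in h7; lra.
pose A i : {set {ffun 'I_d -> 'I_N.+1}} :=
  [set g in family (fun l => [pred x : 'I_N.+1 | (j0 i l <= x < j0 i l + m i)%N])].
have cA i : (m i ^ d <= #|A i|)%N.
  rewrite cardsE card_family.
  have H (s : seq 'I_d) : (m i ^ size s <= foldr muln 1 [seq #|[pred x : 'I_N.+1 | (j0 i l <= x < j0 i l + m i)%N]| | l <- s])%N.
    elim: s => //= l s ih; rewrite expnS; apply: leq_mul => //; exact: card_ord_itv.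
  by have := H (enum 'I_d); rewrite size_enum_ord.
have dA i j g : g \in A i -> g \in A j -> i = j.
  rewrite !inE => /familyP gi /familyP gj.
  have H t : (forall l, g l \in [pred x : 'I_N.+1 | (j0 t l <= x < j0 t l + m t)%N]) ->
     (box (a t) (r t))° (\row_l ((g l)%:R / N%:R)).
    move=> gt; apply: box_interior => l; rewrite mxE.
    rewrite ltr_pdivlMr// ltr_pdivrMr// mulrDl.
    have := gt l; rewrite inE => /andP[g1 g2].
    have [h1 h2] := hm t; have [h3 h4] := hj t l; have := rN t.
    have : (j0 t l)%:R <= (g l)%:R :> R by rewrite ler_nat.
    have : (g l)%:R + 1 <= (j0 t l)%:R + (m t)%:R :> R by rewrite natr1 -natrD ler_nat.
    lra.
  by apply: tr => //; exists (\row_l ((g l)%:R / N%:R)); split; exact: H.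
have cnt : (\sum_i m i ^ d <= N.+1 ^ d)%N.
  apply: (@leq_trans (\sum_i #|A i|)); first exact: leq_sum.
  have -> : (N.+1 ^ d = \sum_(g : {ffun 'I_d -> 'I_N.+1}) 1)%N.
    by rewrite sum1_card card_ffun !card_ord.
  under eq_bigr do rewrite -sum1_card big_mkcond /=.
  rewrite exchange_big /=; apply: leq_sum => g _.
  have [/existsP[i gi]|] := boolP [exists i, g \in A i].
    rewrite (bigD1 i)//= gi big1// => j ji; case: ifP => // gj.
    by move: ji; rewrite (dA _ _ _ gi gj) eqxx.
  rewrite negb_exists => /forallP h; rewrite big1// => j _.
  by rewrite (negbTE (h j)).
have cntR : \sum_i (m i)%:R ^+ d <= (N.+1%:R : R) ^+ d.
  by rewrite -natrX -(ler_nat R) natr_sum in cnt *;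
     apply: le_trans cnt; apply: ler_sum => i _; rewrite natrX.
(* Each cube holds at least [(r i * N / 4) ^+ d] points, out of at most [(2 * N) ^+ d] in all; the
   quotient of [2 * N] by [N / 4] is the constant 8. *)
have N4 : (0 : R) < (N%:R / 4) ^+ d by rewrite exprn_gt0// divr_gt0.
rewrite -(ler_pM2r N4) mulr_suml -exprMn.
apply: (@le_trans _ _ ((N.+1%:R : R) ^+ d)); last first.
  rewrite lerXn2r ?nnegrE ?mulr_ge0 ?divr_ge0//.
  rewrite -natr1; have : (1 : R) <= N%:R by rewrite ler1n.
  lra.
apply: le_trans cntR; apply: ler_sum => i _; rewrite -exprMn.
have r0 := (sa i).1; have [h1 _] := hm i.
by rewrite lerXn2r ?nnegrE ?mulr_ge0 ?divr_ge0 ?(ltW r0)// mulrA.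
Qed.

End volume.

(** * Local approximation of monomials by polynomials of low degree *)

Section polynomial_functions.
Context (R : realType) (d : nat).
Local Notation B := (borelQd R d).
Local Notation QD := (Qd R d).
Local Notation M := (signed_measure B R).

(** Polynomial functions, with the index as a strict bound on the degree, to match the order of the
    vanishing moments; index 0 leaves only the zero function. *)
Inductive poly_fun : nat -> (QD -> R) -> Prop :=
| poly_fun0 m : poly_fun m (fun=> 0)
| poly_fun_monomial m c (al : 'I_d -> nat) h : (\sum_i al i < m)%N -> poly_fun m h ->
    poly_fun m (fun x => c * monomial al x + h x).

Lemma poly_funD m h1 h2 : poly_fun m h1 -> poly_fun m h2 -> poly_fun m (fun x => h1 x + h2 x).
Proof.
elim=> [m' h|m' c al h hal _ ih p2].
  by rewrite (_ : (fun x => 0 + h2 x) = h2)//; apply/funext => x; rewrite add0r.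
rewrite (_ : (fun x => _) = (fun x => c * monomial al x + (h x + h2 x))).
  by apply: poly_fun_monomial => //; exact: ih.
by apply/funext => x; rewrite addrA.
Qed.

Lemma poly_fun_le m m' h : (m <= m')%N -> poly_fun m h -> poly_fun m' h.
Proof.
move=> mm p; elim: p m' mm => [m1 m' _|m1 c al h' hal _ ih m' mm]; first exact: poly_fun0.
by apply: poly_fun_monomial; [exact: leq_trans mm|exact: ih].
Qed.

Lemma monomialM (al be : 'I_d -> nat) (x : QD) :
  monomial al x * monomial be x = monomial (fun i => al i + be i)%N x.
Proof. by rewrite /monomial -big_split /=; apply: eq_bigr => i _; rewrite exprD. Qed.

Lemma poly_fun_mul_monomial m c al h : poly_fun m h ->
  poly_fun (\sum_i al i + m) (fun x => c * monomial al x * h x).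
Proof.
elim=> [m'|m' c' be h' hbe _ ih].
  rewrite (_ : (fun x => _) = (fun=> 0)); first exact: poly_fun0.
  by apply/funext => x; rewrite mulr0.
rewrite (_ : (fun x => _) = (fun x => c * c' * monomial (fun i => al i + be i)%N x +
   c * monomial al x * h' x)).
  by apply: poly_fun_monomial => //; rewrite big_split /= ltn_add2l.
by apply/funext => x; rewrite -monomialM; ring.
Qed.

Lemma poly_fun_mul m1 m2 h1 h2 : poly_fun m1 h1 -> poly_fun m2 h2 ->
  poly_fun (m1 + m2) (fun x => h1 x * h2 x).
Proof.
move=> p1 p2; elim: p1 => [m'|m' c al h hal _ ih].
  rewrite (_ : (fun x => _) = (fun=> 0)); first exact: poly_fun0.
  by apply/funext => x; rewrite mul0r.
rewrite (_ : (fun x => _) = (fun x => c * monomial al x * h2 x + h x * h2 x)).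
  apply: poly_funD => //; apply: poly_fun_le (poly_fun_mul_monomial c al p2).
  by rewrite leq_add2r ltnW.
by apply/funext => x; rewrite mulrDl.
Qed.

Lemma poly_fun_cst m c : poly_fun m.+1 (fun=> c).
Proof.
rewrite (_ : (fun=> c) = (fun x => c * monomial (fun=> 0%N) x + 0)).
  by apply: poly_fun_monomial; [rewrite big1|exact: poly_fun0].
by apply/funext => x; rewrite /monomial big1 ?mulr1 ?addr0// => i _; rewrite expr0.
Qed.

Lemma poly_fun_scale m c h : poly_fun m h -> poly_fun m (fun x => c * h x).
Proof.
move=> p; have := poly_fun_mul_monomial c (fun=> 0%N) p; rewrite big1// add0n.
rewrite (_ : (fun x => _) = (fun x => c * h x))//.
by apply/funext => x; rewrite /monomial big1 ?mulr1// => i _; rewrite expr0.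
Qed.

Definition delta (i j : 'I_d) : nat := (i == j)%N.

Lemma sum_delta i : (\sum_j delta i j = 1)%N.
Proof.
rewrite (bigD1 i)//= /delta eqxx big1// => j ji; by rewrite eq_sym (negbTE ji).
Qed.

Lemma monomial_delta i (x : QD) : monomial (delta i) x = cube_coord i x.
Proof.
rewrite /monomial (bigD1 i)//= /delta eqxx expr1 big1 ?mulr1// => j ji.
by rewrite eq_sym (negbTE ji) expr0.
Qed.

Lemma poly_fun_mul_coord m i h : poly_fun m h -> poly_fun m.+1 (fun x => cube_coord i x * h x).
Proof.
move=> p; have := poly_fun_mul_monomial 1 (delta i) p; rewrite sum_delta add1n.
rewrite (_ : (fun x => _) = (fun x => cube_coord i x * h x))//.
by apply/funext => x; rewrite monomial_delta mul1r.
Qed.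

Lemma poly_fun_coord i : poly_fun 2 (cube_coord i).
Proof.
have := poly_fun_mul_coord i (poly_fun_cst 0 1).
by rewrite (_ : (fun x => _) = cube_coord i)//; apply/funext => x; rewrite mulr1.
Qed.

Lemma poly_fun_prod (s : seq 'I_d) (F : 'I_d -> QD -> R) :
  (forall i, exists m, poly_fun m (F i)) -> exists m, poly_fun m (fun x => \prod_(i <- s) F i x).
Proof.
move=> h; elim: s => [|i s [m ih]].
  exists 1%N; rewrite (_ : (fun x => _) = (fun=> 1)); first exact: poly_fun_cst.
  by apply/funext => x; rewrite big_nil.
have [m' p] := h i; exists (m' + m)%N.
rewrite (_ : (fun x => _) = (fun x => F i x * \prod_(j <- s) F j x)); first exact: poly_fun_mul.
by apply/funext => x; rewrite big_cons.
Qed.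

Lemma poly_fun_exp n m h : poly_fun m h -> exists m', poly_fun m' (fun x => h x ^+ n).
Proof.
move=> p; elim: n => [|n [m' ih]].
  by exists 1%N; under eq_fun do rewrite expr0; exact: poly_fun_cst.
by exists (m + m')%N; under eq_fun do rewrite exprS; exact: poly_fun_mul.
Qed.

Lemma bounded_mfun_poly m h : poly_fun m h -> bounded_mfun (h : B -> R).
Proof.
elim=> [m'|m' c al h' _ _ ih]; first exact: bounded_mfun_cst.
by apply: bounded_mfunD => //; apply: bounded_mfunZ; exact: bounded_mfun_monomial.
Qed.

Lemma signed_integral_poly_fun k m (mu : M) h : vanishing k mu -> poly_fun m h -> (m <= k)%N ->
  signed_integral mu (h : B -> R) = 0.
Proof.
move=> vmu; elim=> [m' _|m' c al h' hal ph ih mk].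
  by rewrite signed_integral_cst mul0r.
rewrite signed_integralDr; [|by apply: bounded_mfunZ; exact: bounded_mfun_monomial|exact: bounded_mfun_poly ph].
rewrite signed_integralZr; last exact: bounded_mfun_monomial.
by rewrite vmu ?mulr0 ?add0r ?ih//; exact: leq_trans mk.
Qed.

(** A Taylor estimate of order [m] without derivatives: [P] depends on the centre [y] only, and one
    [C] serves all centres and all radii [t]. *)
Definition taylor_approx (m : nat) (f : QD -> R) := exists2 C : R, 0 <= C &
  forall y : QD, exists2 P, poly_fun m P & forall x t, 0 <= t ->
    (forall i, `|cube_coord i x - cube_coord i y| <= t) -> `|f x - P x| <= C * t ^+ m.

Lemma taylor_one m : taylor_approx m (fun=> 1).
Proof.
exists 1 => // y; case: m => [|m].
  exists (fun=> 0); first exact: poly_fun0.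
  by move=> x t _ _; rewrite subr0 normr1 expr0 mulr1.
exists (fun=> 1); first exact: poly_fun_cst.
by move=> x t t0 _; rewrite subrr normr0 mul1r exprn_ge0.
Qed.

(* [x_i g = y_i g + (x_i - y_i) g]: expand the first [g] to order [m + 1] and
   the second to order [m]. *)
Lemma taylor_mulx i f : (forall m, taylor_approx m f) -> forall m,
  taylor_approx m (fun x => cube_coord i x * f x).
Proof.
move=> h [|m].
  have [C C0 hC] := h 0%N; exists C => // y; exists (fun=> 0); first exact: poly_fun0.
  move=> x t t0 ht; have [P pP hP] := hC y.
  (* At order 0 the approximation is by zero, and the estimate is mere boundedness. *)
  have P0 : P = (fun=> 0) by inversion pP.
  have := hP x t t0 ht; rewrite P0 !subr0 normrM expr0 mulr1 => h1.
  have /andP[x0 x1] := coord01 i x; rewrite (ger0_norm x0).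
  by rewrite (le_trans _ h1)// ler_piMl.
have [C1 C10 h1] := h m.+1; have [C2 C20 h2] := h m.
exists (C1 + C2); first exact: addr_ge0.
move=> y; have [P1 p1 hP1] := h1 y; have [P2 p2 hP2] := h2 y.
exists (fun x => cube_coord i y * P1 x + (cube_coord i x * P2 x + (- cube_coord i y) * P2 x)).
  apply: poly_funD; first exact: poly_fun_scale.
  by apply: poly_funD; [exact: poly_fun_mul_coord|apply: poly_fun_scale; exact: poly_fun_le p2].
move=> x t t0 ht.
rewrite (_ : _ - _ = cube_coord i y * (f x - P1 x) + (cube_coord i x - cube_coord i y) * (f x - P2 x)); last by ring.
apply: le_trans (ler_normD _ _) _; rewrite !normrM mulrDl; apply: lerD.
  have /andP[y0 y1] := coord01 i y; rewrite (ger0_norm y0).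
  by apply: le_trans (hP1 x t t0 ht); rewrite ler_piMl.
by rewrite exprS mulrCA; apply: ler_pM => //; exact: hP2.
Qed.

(** Induction on the degree, splitting off one coordinate factor. All orders [m] are kept in the
    induction, because [taylor_mulx] uses two consecutive ones. *)
Lemma taylor_monomial m (al : 'I_d -> nat) : taylor_approx m (monomial al).
Proof.
move: m; move En : (\sum_i al i)%N => n; elim: n al En => [|n ih] al En m.
  rewrite (_ : monomial al = (fun=> 1)); first exact: taylor_one.
  apply/funext => x; rewrite /monomial big1// => i _.
  have : (al i <= 0)%N by rewrite -En (bigD1 i)//= leq_addr.
  by rewrite leqn0 => /eqP ->; rewrite expr0.
have [i ai] : exists i, (0 < al i)%N.
  apply: contrapT => /forallNP h; move: En; rewrite big1// => i _.
  by have /negP := h i; rewrite -eqn0Ngt => /eqP.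
pose be j := (al j - delta i j)%N.
have abe : al = (fun j => delta i j + be j)%N.
  apply/funext => j; rewrite /be subnKC// /delta; case: eqP => [<-//|//].
have Eb : (\sum_j be j = n)%N.
  by move: En; rewrite abe big_split /= sum_delta => -[].
rewrite (_ : monomial al = (fun x => cube_coord i x * monomial be x)).
  by apply: taylor_mulx => m'; exact: ih.
by apply/funext => x; rewrite abe -monomialM monomial_delta.
Qed.

End polynomial_functions.

(** * Continuity of the moments, and uniqueness of a measure with given moments *)

Section kernel.
Context (R : realType) (d k : nat) (p : R).
Hypothesis d_gt0 : (0 < d)%N.
Hypothesis k_gt0 : (0 < k)%N.
Hypothesis p_ge1 : 1 <= p.
Hypothesis dpk : d%:R / p <= k%:R.
Local Notation B := (borelQd R d).
Local Notation QD := (Qd R d).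
Local Notation M := (signed_measure B R).
Local Notation MA := (@matom R d k).

(** The polynomial approximating the monomial near a corner of the cube is annihilated by the atom,
    so only the error of the approximation is integrated. *)
Lemma atom_monomial_le (al : 'I_d -> nat) : exists2 C, 0 <= C &
  forall a r mu, subbox a r -> MA (box a r) mu ->
  `|signed_integral mu (monomial al : B -> R)| <= C * r ^+ k.
Proof.
have [C C0 hC] := taylor_monomial R k al; exists C => // a r mu sa mua.
have [cmu tmu vmu] := (matomP k mu sa).1 mua.
have [y hy] : exists y : QD, forall i, cube_coord i y = a i.
  by apply: exists_Qd => i; have := sa.1; have := sa.2 i; lra.
have [P pP hP] := hC y.
have bP := bounded_mfun_poly pP; have bm := bounded_mfun_monomial R al.
have -> : signed_integral mu (monomial al : B -> R) =
    signed_integral mu (fun x : B => monomial al x - P x).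
  by rewrite signed_integralBr// (signed_integral_poly_fun vmu pP)// subr0.
have r0 := sa.1.
rewrite -[leRHS]mulr1; apply: (@le_trans _ _ (C * r ^+ k * tv_norm mu)).
  apply: (signed_integral_carried_le (measurable_Qd_box a r)) => //.
  - exact: bounded_mfunB.
  - by rewrite mulr_ge0// exprn_ge0// ltW.
  - move=> x hx; apply: hP; first exact: ltW.
    by move=> i; rewrite hy; have /andP[h1 h2] := hx i; rewrite ger0_norm; lra.
by rewrite ler_wpM2l// mulr_ge0// exprn_ge0// ltW.
Qed.

Lemma chain_monomial_le (al : 'I_d -> nat) : exists2 C, 0 < C &
  forall b : chain MA,
  `|signed_integral (chain_val b) (monomial al : B -> R)| <= C * chain_norm p b.
Proof.
have p0 : 0 < p by apply: lt_le_trans p_ge1.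
have [C C0 hC] := atom_monomial_le al.
have [C' C'0 hH] := @lqnorm_hoelder R p p_ge1 (8 ^+ d) (exprn_ge0 d (ler0n _ 8)).
(* The added 1 makes the constant positive, to be divided by later. *)
exists (1 + C * C'); first by rewrite ltr_pwDl// mulr_ge0.
move=> b.
have /choice[ar har] : forall i, exists ar : ('I_d -> R) * R, subbox ar.1 ar.2 /\
    @chain_cube _ _ _ _ b i = box ar.1 ar.2.
  by move=> i; have [a [r h]] := matom_cube (@chain_atomP _ _ _ _ b i); exists (a, r).
have [_ tr] := @chain_packing _ _ _ _ b.
have tr' : trivIset setT (fun i => (box (ar i).1 (ar i).2)°).
  by move: tr; under eq_fun do rewrite (har _).2.
have vol := packing_volume (fun i => (har i).1) tr'.
have bm := bounded_mfun_monomial R al.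
(* Here [d / p <= k] enters: [r^(k p) <= r^d] because [r <= 1], and the volume bound applies. *)
have hp : \sum_i ((ar i).2 ^+ k) `^ p <= 8 ^+ d.
  apply: le_trans vol; apply: ler_sum => i _.
  have r0 := (har i).1.1; have r1 := subbox_le1 d_gt0 (har i).1.
  rewrite -powR_mulrn ?(ltW r0)// -powRrM -(powR_mulrn d (ltW r0)).
  apply: ger_powR; first by rewrite r0.
  by rewrite -ler_pdivrMr.
rewrite /chain_val signed_integral_sum//.
apply: le_trans (ler_norm_sum _ _ _) _.
apply: (@le_trans _ _ (\sum_i `|@chain_coef _ _ _ _ b i| * (C * (ar i).2 ^+ k))).
  apply: ler_sum => i _; rewrite normrM ler_wpM2l//.
  apply: hC; first exact: (har i).1.
  by rewrite -(har i).2; exact: chain_atomP.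
under eq_bigr do rewrite mulrCA.
rewrite -mulr_sumr.
have := hH _ (@chain_coef _ _ _ _ b) (fun i => (ar i).2 ^+ k)
  (fun i => exprn_ge0 k (ltW (har i).1.1)) hp.
move=> /(ler_wpM2l C0) h; apply: le_trans h _.
rewrite mulrA mulrDl lerDr mul1r; exact: chain_norm_ge0.
Qed.

Lemma Utnorm_moments mu al : Ut0 R d k mu -> Utnorm d k p mu = 0 ->
  signed_integral mu (monomial al : B -> R) = 0.
Proof.
move=> hmu mu0; have [C C0 hC] := chain_monomial_le al.
have bm := bounded_mfun_monomial R al.
apply/eqP; rewrite -normr_le0 -(pmulr_rle0 _ (_ : 0 < C^-1)) ?invr_gt0//.
rewrite -[leRHS]mu0; apply: atomic_norm_ge => //; first exact: matom_cube_in.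
move=> n b ->; rewrite mulrC ler_pdivrMr// mulrC mulr_sumr.
under [in X in `|X|]eq_bigr do rewrite -[chain_val _]scale1r.
rewrite signed_integral_sum//; apply: le_trans (ler_norm_sum _ _ _) _.
by apply: ler_sum => j _; rewrite mul1r.
Qed.

Lemma bernoulli_sub (v : R) n : 0 <= v <= 1 -> 1 - n%:R * v <= (1 - v) ^+ n.
Proof.
move=> v01; elim: n => [|n ih]; first by rewrite mul0r subr0 expr0.
rewrite exprSr -natr1; have h : 0 <= 1 - v by lra.
have := ler_wpM2r h ih; have : 0 <= n%:R * v * v by rewrite !mulr_ge0//; lra.
nra.
Qed.

Lemma bernoulli_add (v : R) n : 0 <= v -> 1 + n%:R * v <= (1 + v) ^+ n.
Proof.
move=> v0; elim: n => [|n ih]; first by rewrite mul0r addr0 expr0.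
rewrite exprSr -natr1; have h : 0 <= 1 + v by lra.
have := ler_wpM2r h ih; have : 0 <= n%:R * v * v by rewrite !mulr_ge0.
nra.
Qed.

(* [z <= w ^+ 2] with [w = (1 + z) / 2], and [n%:R * w ^+ n] is bounded. *)
Lemma natmul_expr_cvg0 (z : R) : 0 <= z < 1 -> n%:R * z ^+ n @[n --> \oo] --> (0 : R).
Proof.
move=> /andP[z0 z1].
pose w := (1 + z) / 2.
have w0 : 0 < w by rewrite /w; lra.
have w1 : w < 1 by rewrite /w; lra.
have zw : z <= w ^+ 2 by rewrite /w; nra.
pose s := w^-1 - 1.
have s0 : 0 < s by rewrite subr_gt0 invf_gt1.
have nw n : n%:R * w ^+ n <= s^-1.
  have h := bernoulli_add n (ltW s0).
  have e1 : 1 + s = w^-1 by rewrite /s; ring.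
  rewrite e1 exprVn in h.
  have wn : 0 < w ^+ n by rewrite exprn_gt0.
  rewrite -(ler_pM2r s0) mulVf ?gt_eqF// mulrAC.
  have := ler_wpM2r (ltW wn) h; rewrite mulVf ?gt_eqF//.
  rewrite mulrDl mul1r; lra.
apply: (@squeeze_cvgr _ _ _ _ (fun=> 0) (fun n => s^-1 * w ^+ n)).
- near=> n; rewrite mulr_ge0 ?exprn_ge0//=.
  apply: (@le_trans _ _ (n%:R * (w ^+ 2) ^+ n)).
    by rewrite ler_wpM2l// lerXn2r ?nnegrE// exprn_ge0// ltW.
  by rewrite expr2 exprMn mulrA ler_wpM2r// exprn_ge0// ltW.
- exact: cvg_cst.
- rewrite -[X in _ --> X](mulr0 s^-1); apply: cvgM; first exact: cvg_cst.
  by apply: cvg_expr; rewrite gtr0_norm.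
Unshelve. all: by end_near. Qed.

(* Approximates the indicator of [t < 1/2]; the usual exponent [2 ^ n] would
   give the limit [1 / e] at [t = 1/2]. *)
Definition step_poly n (t : R) : R := (1 - t ^+ n) ^+ (n * 2 ^ n).

Lemma step_poly01 n t : 0 <= t <= 1 -> 0 <= step_poly n t <= 1.
Proof.
move=> /andP[t0 t1]; have h1 : t ^+ n <= 1 by rewrite exprn_ile1.
have h0 : 0 <= t ^+ n by rewrite exprn_ge0.
by rewrite exprn_ge0 ?exprn_ile1//; lra.
Qed.

(** Bernoulli's inequality gives the lower bound [1 - n * (2 * t) ^+ n], and [2 * t < 1]. *)
Lemma step_poly_lt (t : R) : 0 <= t < 2^-1 -> step_poly n t @[n --> \oo] --> (1 : R).
Proof.
move=> /andP[t0 t1]; have t01 : 0 <= t <= 1 by lra.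
apply: (@squeeze_cvgr _ _ _ _ (fun n => 1 - n%:R * (2 * t) ^+ n) (fun=> 1)).
- near=> n; apply/andP; split; last by have /andP[] := step_poly01 n t01.
  have h : 0 <= t ^+ n <= 1 by rewrite exprn_ge0//= exprn_ile1//; lra.
  have := bernoulli_sub (n * 2 ^ n) h.
  by rewrite natrM natrX exprMn mulrA.
- rewrite -[X in _ --> X]subr0; apply: cvgB; first exact: cvg_cst.
  by apply: natmul_expr_cvg0; lra.
- exact: cvg_cst.
Unshelve. all: by end_near. Qed.

(** With [v = t ^+ n] and [m] the outer exponent, [(1 - v) ^+ m * (1 + v) ^+ m <= 1] and Bernoulli's
    inequality bound the value by [1 / (1 + m * v)], where [m * v = n * (2 * t) ^+ n >= n]. *)
Lemma step_poly_ge (t : R) : 2^-1 <= t <= 1 -> step_poly n t @[n --> \oo] --> (0 : R).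
Proof.
move=> /andP[t0 t1]; have t01 : 0 <= t <= 1 by lra.
apply: (@squeeze_cvgr _ _ _ _ (fun=> 0) (fun n => n.+1%:R^-1)).
- near=> n; apply/andP; split; first by have /andP[] := step_poly01 n t01.
  rewrite /step_poly; set v := t ^+ n; set m := (n * 2 ^ n)%N.
  have v0 : 0 <= v by rewrite exprn_ge0//; lra.
  have v1 : v <= 1 by rewrite exprn_ile1//; lra.
  have h := bernoulli_add m v0.
  have mv : n%:R <= m%:R * v.
    rewrite /m natrM natrX -mulrA -exprMn ler_peMr// exprn_ege1//; lra.
  have n1 : n.+1%:R <= (1 + v) ^+ m by rewrite -natr1; lra.
  have le1 : (1 - v) ^+ m * (1 + v) ^+ m <= 1.
    rewrite -exprMn exprn_ile1//; nra.
  have p1 : 0 <= (1 - v) ^+ m by rewrite exprn_ge0//; lra.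
  rewrite -[leRHS]mul1r ler_pdivlMr//.
  by apply: le_trans le1; rewrite ler_wpM2l.
- exact: cvg_cst.
- exact: cvg_harmonic.
Unshelve. all: by end_near. Qed.

(* The argument lies in [0, 1] for [0 <= a i <= 2], and is [< 1/2] exactly when
   [cube_coord i x < a i]. *)
Definition lower_box_poly (a : 'I_d -> R) n (x : QD) : R :=
  \prod_i step_poly n ((cube_coord i x - a i + 2) / 4).

Lemma poly_fun_lower_box a n : exists m, poly_fun m (lower_box_poly a n).
Proof.
apply: poly_fun_prod => i; rewrite /step_poly.
have p1 : poly_fun 2 (fun x : QD => (cube_coord i x - a i + 2) / 4).
  rewrite (_ : (fun x => _) = (fun x : QD => 4^-1 * cube_coord i x + (2 - a i) / 4)).
    by apply: poly_funD; [apply: poly_fun_scale; exact: poly_fun_coord|exact: poly_fun_cst].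
  by apply/funext => x; field.
have [m2 p2] := poly_fun_exp n p1.
have p3 : poly_fun (1 + m2)%N (fun x : QD => 1 - ((cube_coord i x - a i + 2) / 4) ^+ n).
  under eq_fun do rewrite -mulN1r.
  apply: poly_funD; first by rewrite add1n; exact: poly_fun_cst.
  by apply: poly_fun_scale; apply: poly_fun_le p2; rewrite leq_addl.
exact: poly_fun_exp p3.
Qed.

Lemma lower_box_arg01 (a : 'I_d -> R) (x : QD) i : 0 <= a i <= 2 ->
  0 <= (cube_coord i x - a i + 2) / 4 <= 1.
Proof. have := coord01 i x; lra. Qed.

Lemma lower_box_poly01 a n x : (forall i, 0 <= a i <= 2) -> 0 <= lower_box_poly a n x <= 1.
Proof.
move=> ha; apply/andP; split.
  by apply: prodr_ge0 => i _; have /andP[] := step_poly01 n (lower_box_arg01 x (ha i)).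
apply: prodr_ile1 => i _.
exact: step_poly01 (lower_box_arg01 x (ha i)).
Qed.

Lemma lower_box_poly_cvg a x : (forall i, 0 <= a i <= 2) ->
  lower_box_poly a n x @[n --> \oo] --> (\1_(lower_box a) x : R).
Proof.
move=> ha; rewrite indicE; have [xl|xl] := pselect (lower_box a x).
  rewrite mem_set// /lower_box_poly.
  suff H (s : seq 'I_d) : (fun n => \prod_(i <- s) step_poly n ((cube_coord i x - a i + 2) / 4))
      @ \oo --> (1 : R) by exact: H.
  elim: s => [|i s ih].
    rewrite (_ : (fun _ => _) = (fun=> 1)); first exact: cvg_cst.
    by apply/funext => n; rewrite big_nil.
  rewrite (_ : (fun _ => _) = (fun n => step_poly n ((cube_coord i x - a i + 2) / 4) *
      \prod_(i <- s) step_poly n ((cube_coord i x - a i + 2) / 4))); last first.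
    by apply/funext => n; rewrite big_cons.
  have t01 : 0 <= (cube_coord i x - a i + 2) / 4 < 2^-1.
    by have := xl i; have := lower_box_arg01 x (ha i); lra.
  have := cvgM (step_poly_lt t01) ih; rewrite mulr1; exact.
rewrite memNset//.
have [i hi] : exists i, a i <= cube_coord i x.
  by have /existsNP[i /negP] := xl; rewrite -leNgt; exists i.
apply: (@squeeze_cvgr _ _ _ _ (fun=> 0) (fun n => step_poly n ((cube_coord i x - a i + 2) / 4))).
- near=> n; have /andP[-> _] := lower_box_poly01 n x ha; rewrite /lower_box_poly (bigD1 i)//=.
  have /andP[s0 s1] := step_poly01 n (lower_box_arg01 x (ha i)).
  rewrite ler_piMr//.
  apply: prodr_ile1 => j _.
  exact: step_poly01 (lower_box_arg01 x (ha j)).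
- exact: cvg_cst.
- by apply: step_poly_ge; have := lower_box_arg01 x (ha i); lra.
Unshelve. all: by end_near. Qed.

(** The polynomials [lower_box_poly] are bounded by 1 and converge pointwise to the indicator of a
    lower box, so dominated convergence under each Jordan part carries the equality of integrals
    over to lower boxes. *)
Lemma moments_unique (mu : M) :
  (forall al, signed_integral mu (monomial al : B -> R) = 0) -> mu = 0.
Proof.
move=> h; apply: lower_box_unique => a ha.
have ml := @measurable_lower_box R d a.
have v m : vanishing m mu by move=> al _; exact: h.
have cvgm (m : {measure set B -> \bar R}) : (m setT < +oo)%E ->
    (\int[m]_x (lower_box_poly a n x)%:E)%E @[n --> \oo] --> (\int[m]_x (\1_(lower_box a) x)%:E)%E.
  move=> fm; apply: (@dominated_cvg _ _ _ m setT measurableT _ _ (cst 1%E)) => //.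
  - move=> n; apply/measurable_EFinP.
    by have [m' /bounded_mfun_poly[]] := poly_fun_lower_box a n.
  - by move=> x _; apply: cvg_EFin; [exact: nearW|exact: lower_box_poly_cvg].
  - by apply: (@bounded_mfun_integrable _ _ _ m (fun=> 1)) => //; exact: bounded_mfun_cst.
  - move=> n x _; have /andP[l0 l1] := lower_box_poly01 n x ha.
    by rewrite /= lee_fin ger0_norm.
have bl n : bounded_mfun (lower_box_poly a n : B -> R).
  by have [m' /bounded_mfun_poly] := poly_fun_lower_box a n.
have E n : (\int[pos_part mu]_x (lower_box_poly a n x)%:E = \int[neg_part mu]_x (lower_box_poly a n x)%:E)%E.
  have [m' pm] := poly_fun_lower_box a n.
  have := signed_integral_poly_fun (v m') pm (leqnn m'); rewrite signed_integralE => /eqP; rewrite subr_eq0 => /eqP e.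
  by rewrite -!Rintegral_fin ?e//; [exact: neg_part_fin|exact: pos_part_fin].
have := cvgm _ (pos_part_fin mu); under eq_fun do rewrite E.
move=> h1; have := cvg_unique _ h1 (cvgm _ (neg_part_fin mu)).
rewrite !integral_indic// !setIT => e.
apply: EFin_inj; rewrite signed_measureE// e//.
  by rewrite subee// neg_partE.
Qed.

Lemma Utnorm_eq0 mu : Ut0 R d k mu -> Utnorm d k p mu = 0 -> mu = 0.
Proof. by move=> hmu mu0; apply: moments_unique => al; exact: Utnorm_moments. Qed.

End kernel.

(** * Extension to the completions *)

Section extension.
Context (R : realType) (V : lmodType R) (S : set V) (U W : completeNormedModType R).
Variables (i : V -> U) (j : V -> W).
Hypothesis S_lin : forall (a : R) v w, S v -> S w -> S (a *: v + w).
Hypothesis i_lin : forall (a : R) v w, S v -> S w -> i (a *: v + w) = a *: i v + i w.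
Hypothesis j_lin : forall (a : R) v w, S v -> S w -> j (a *: v + w) = a *: j v + j w.
Hypothesis ij : forall v, S v -> `|i v| = `|j v|.
Hypothesis i_dense : dense (i @` S).

Let S_sub v w : S v -> S w -> S (v - w).
Proof. by move=> hv hw; rewrite addrC -scaleN1r; exact: S_lin. Qed.

Let dist_ij v w : S v -> S w -> `|i v - i w| = `|j v - j w|.
Proof.
move=> hv hw; have := ij (S_sub hv hw); rewrite addrC -scaleN1r i_lin// j_lin//.
by rewrite !scaleN1r addrC => ->; rewrite addrC.
Qed.

Let approx (u : U) (e : R) : 0 < e -> exists v, S v /\ `|u - i v| < e.
Proof.
move=> e0; have [||w [uw [v Sv vw]]] := @i_dense (ball u e).
- by exists u; exact: ballxx.
- exact: ball_open.
- by exists v; split => //; rewrite vw; move: uw; rewrite -ball_normE.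
Qed.

(** The closure of the set of pairs [(i v, j v)]. A relation, because [i] is not assumed injective
    on [S]; it proves to be the graph of a linear isometry. *)
Let graph (u : U) (y : W) := forall e : R, 0 < e ->
  exists v, [/\ S v, `|u - i v| < e & `|y - j v| < e].

Let graph_ex u : exists y, graph u y.
Proof.
have h n : exists v, S v /\ `|u - i v| < n.+1%:R^-1 by apply: approx; rewrite invr_gt0.
have /choice[v hv] := h.
have cv : cvg (j (v n) @[n --> \oo]).
  apply: cauchy_cvg; apply: cauchy_exP => e e0.
  have e2 : 0 < e / 2 by rewrite divr_gt0.
  pose N := Num.bound (e / 2)^-1.
  have small n : (N <= n)%N -> (n.+1%:R^-1 : R) < e / 2.
    move=> Nn; rewrite -[ltRHS]invrK ltf_pV2 ?posrE ?invr_gt0//.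
    apply: (lt_le_trans (archi_boundP _)); first by rewrite invr_ge0 ltW.
    by rewrite ler_nat (leq_trans Nn).
  exists (j (v N)); exists N => // n /= Nn; rewrite -ball_normE /=.
  have [S1 h1] := hv N; have [S2 h2] := hv n.
  (* The sequence of the [j (v n)] inherits the Cauchy property from that of the [i (v n)],
     distances being equal. *)
  rewrite -dist_ij// -(subrK u (i (v N))) -addrA.
  apply: le_lt_trans (ler_normD _ _) _; rewrite (splitr e); apply: ltrD.
    by rewrite distrC; apply: lt_trans h1 _; exact: small.
  by apply: lt_trans h2 _; exact: small.
exists (lim (j (v n) @[n --> \oo])) => e e0.
have /cvgrPdist_lt/(_ e e0) h1 := cv.
have h2 : \forall n \near \oo, (n.+1%:R^-1 : R) < e.
  by have /cvgrPdist_lt/(_ e e0) := @cvg_harmonic R;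
    apply: filterS => n /=; rewrite sub0r normrN gtr0_norm ?invr_gt0.
have [n [hn1 hn2]] := filter_ex (filterI h1 h2).
have [S1 h3] := hv n.
by exists (v n); split => //; exact: lt_trans h3 hn2.
Qed.

Let graph_norm u y : graph u y -> `|y| = `|u|.
Proof.
move=> g; apply/eqP; rewrite eq_le; apply/andP; split; apply/ler_addgt0Pr => e e0;
  have e2 : 0 < e / 2 by rewrite divr_gt0.
- have [v [Sv h1 h2]] := g _ e2.
  rewrite -(subrK (j v) y); apply: le_trans (ler_normD _ _) _.
  rewrite -ij// -(subrK u (i v)).
  have := ler_normD (i v - u) u; rewrite distrC in h1; lra.
- have [v [Sv h1 h2]] := g _ e2.
  rewrite -(subrK (i v) u); apply: le_trans (ler_normD _ _) _.
  rewrite ij// -(subrK y (j v)).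
  have := ler_normD (j v - y) y; rewrite distrC in h2; lra.
Qed.

Let graph_lin a u w y z : graph u y -> graph w z -> graph (a *: u + w) (a *: y + z).
Proof.
move=> g1 g2 e e0.
have a0 : 0 < `|a| + 1 by rewrite ltr_wpDl.
have e'0 : 0 < e / (`|a| + 1) by rewrite divr_gt0.
have [v1 [S1 h1 h2]] := g1 _ e'0; have [v2 [S2 h3 h4]] := g2 _ e'0.
exists (a *: v1 + v2); split; first exact: S_lin.
- rewrite i_lin// opprD addrACA -scalerBr; apply: le_lt_trans (ler_normD _ _) _.
  rewrite normrZ -[ltRHS](divfK (lt0r_neq0 a0)) mulrDr mulr1 mulrC.
  by apply: ler_ltD => //; rewrite ler_wpM2r// ltW.
- rewrite j_lin// opprD addrACA -scalerBr; apply: le_lt_trans (ler_normD _ _) _.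
  rewrite normrZ -[ltRHS](divfK (lt0r_neq0 a0)) mulrDr mulr1 mulrC.
  by apply: ler_ltD => //; rewrite ler_wpM2r// ltW.
Qed.

(** By linearity the difference of the two values is related to 0, and the relation preserves
    norms. *)
Let graph_uniq u y z : graph u y -> graph u z -> y = z.
Proof.
move=> g1 g2; apply/eqP; rewrite -subr_eq0 -normr_eq0.
have := graph_lin (-1) g2 g1; rewrite !scaleN1r addNr addrC => /graph_norm ->.
by rewrite normr0.
Qed.

Lemma isometric_extension : exists I : {linear U -> W},
  (forall v, S v -> I (i v) = j v) /\ (forall u, `|I u| = `|u|).
Proof.
pose I0 u := sval (cid (graph_ex u)).
have gI u : graph u (I0 u) by rewrite /I0; case: cid.
have linI : linear I0.
  by move=> a u w; apply: (graph_uniq (gI _)); exact: graph_lin.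
pose I : {linear U -> W} := HB.pack I0 (GRing.isLinear.Build R U W *:%R I0 linI).
exists I; split => [v Sv|u]; last exact: graph_norm (gI u).
apply: (graph_uniq (gI _)) => e e0; exists v.
by split => //; rewrite subrr normr0.
Qed.

End extension.

Theorem theorem2p26 (R : realType) (d k : nat) (p : R)
    (d_gt0 : (0 < d)%N) (k_gt0 : (0 < k)%N) (p_ge1 : 1 <= p)
    (dpk : d%:R / p <= k%:R)
    (U Ut : completeNormedModType R)
    (iU : (Qd R d -> R) -> U)
    (iUt : signed_measure (borelQd R d) R -> Ut)
    (completionU : is_completion (U0 R d k) (Unorm d k p) iU)
    (completionUt : is_completion (Ut0 R d k) (Utnorm d k p) iUt) :
  exists I : {linear U -> Ut},
    [/\ forall b, U0 R d k b -> Ut0 R d k (discrete_measure b),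
        forall b, U0 R d k b -> I (iU b) = iUt (discrete_measure b),
        forall u, `|I u| = `|u|
      & exists E : {linear Ut -> U},
          [/\ continuous E,
              range E = setT,
              forall mu, Ut0 R d k mu -> E (iUt mu) = 0 -> mu = 0
            & forall u, E (I u) = u]].
Proof.
have [linU normU denseU] := completionU.
have [linUt normUt denseUt] := completionUt.
have sub0 b : U0 R d k b -> Ut0 R d k (discrete_measure b) by exact: Ut0_discrete.
pose j (b : Qd R d -> R) := iUt (discrete_measure b).
have U0_lin (a : R) v w : U0 R d k v -> U0 R d k w -> U0 R d k (a *: v + w).
  exact: atom_hullP.
have j_lin (a : R) v w : U0 R d k v -> U0 R d k w -> j (a *: v + w) = a *: j v + j w.
  move=> hv hw; rewrite /j discrete_measureP; [|exact: U0_summable hv|exact: U0_summable hw].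
  by rewrite linUt//; exact: sub0.
have norm_ij b : U0 R d k b -> `|iU b| = `|j b|.
  by move=> hb; rewrite normU// normUt ?Unorm_eq//; exact: sub0.
(* A nonempty open set contains a ball about some [iUt mu] with [mu] in the hull, and
   [dense_discrete] provides a discrete measure in that ball. *)
have dense_j : dense (j @` U0 R d k).
  move=> O O0 oO; have [y [Oy [mu hmu muy]]] := denseUt O O0 oO.
  have /nbhs_ballP[e /= e0 he] : nbhs y O by exact: open_nbhs_nbhs.
  have e2 : 0 < e / 2 by rewrite divr_gt0.
  have [b hb hbe] := dense_discrete d_gt0 k_gt0 p_ge1 hmu e2.
  exists (j b); split; last by exists b.
  apply: he; rewrite -ball_normE /= -muy /j.
  have -> : iUt mu - iUt (discrete_measure b) = iUt (mu - discrete_measure b).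
    by rewrite addrC -scaleN1r -linUt// ?scaleN1r 1?addrC//; exact: sub0.
  rewrite normUt; first by apply: le_lt_trans hbe _; rewrite ltr_pdivrMr// ltr_pMr// ltr1n.
  by rewrite addrC -scaleN1r; apply: atom_hullP => //; exact: sub0.
have [I [Iij Inorm]] := isometric_extension U0_lin linU j_lin norm_ij denseU.
(* The same extension with the roles of the two maps exchanged; the density of the image of [j]
   makes it defined on all of [Ut]. *)
have [E [Eij Enorm]] := isometric_extension U0_lin j_lin linU (fun b hb => esym (norm_ij b hb)) dense_j.
(* The composite fixes the dense image of [iU], and both maps are isometries. *)
have EI u : E (I u) = u.
  apply/eqP; rewrite -subr_eq0 -normr_le0; apply/ler_addgt0Pr => e e0.
  have e2 : 0 < e / 2 by rewrite divr_gt0.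
  have [||w [uw [b hb bw]]] := @denseU (ball u (e / 2)).
  - by exists u; exact: ballxx.
  - exact: ball_open.
  move: uw; rewrite -ball_normE /= -bw => ub.
  have -> : E (I u) - u = E (I (u - iU b)) - (u - iU b).
    by rewrite [I (_ - _)]linearB [E (_ - _)]linearB /= Iij// Eij// opprB addrA subrK.
  rewrite add0r; apply: le_trans (ler_normB _ _) _.
  by rewrite Enorm Inorm (splitr e) lerD// ltW.
exists I; split => //; exists E; split => //.
- move=> x; apply/cvgrPdist_lt => e e0; near=> y.
  rewrite -linearB Enorm; near: y; exact: cvgr_dist_lt.
- by apply/seteqP; split => // u _; exists (I u).
(* [E] preserves norms, so [mu] has seminorm zero. *)
- move=> mu hmu Emu; apply: (Utnorm_eq0 d_gt0 p_ge1 dpk hmu).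
  by rewrite -normUt// -Enorm Emu normr0.
Unshelve. all: by end_near. Qed.
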